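(* Let $\Phi_S\in C^1(\mathbb{R}^3)$ and suppose that the seminorm $v\mapsto\|v''\|_{L^2(0,L)}$ is a norm on the kernel of $L_{\rm bc}:H^2(0,L;\mathbb{R}^3)\to\mathbb{R}^\ell$ and that $\mathcal{A}\cap H^3(0,L;\mathbb{R}^3)$ is dense in $\mathcal{A}$ with respect to strong convergence in $H^2$. (a) For every fixed $0<\gamma<1$, the problems of minimizing $I_{\gamma,h}$ approximate the problem of minimizing $I_\gamma$ as $h\to0$, i.e., $I_{\gamma,h}\to I_\gamma$ in the sense of $\Gamma$-convergence with respect to weak convergence in $H^2$: every sequence $u_h\in\mathcal{A}_h$, $h\to0$, with $I_{\gamma,h}[u_h]\le c$ has a subsequence (not relabeled) with $u_h\rightharpoonup u$ in $H^2$ for some $u\in\mathcal{A}$ and $I_\gamma[u]\le\liminf_{h\to0}I_{\gamma,h}[u_h]$; for every $u\in\mathcal{A}$ there are $u_h\in\mathcal{A}_h$ with $u_h\to u$ in $H^2$ and $I_{\gamma,h}[u_h]\to I_\gamma[u]$; and weak accumulation points of quasiminimizers of $I_{\gamma,h}$ are minimizers of $I_\gamma$. (b) Assume that $S$ is a $C^2$ surface whose principal curvatures are bounded in absolute value by a constant $c_S$. For $\gamma\to1$, $\gamma<1$, the problems of minimizing $I_\gamma$ approximate the problem of minimizing $I_1$, i.e., $I_\gamma\to I_1$ in the sense of $\Gamma$-convergence with respect to weak convergence in $H^2$: every sequence $u_\gamma\in\mathcal{A}$, $\gamma\to1$, with $I_\gamma[u_\gamma]\le c$ has a subsequence (not relabeled)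 with $u_\gamma\rightharpoonup u$ in $H^2$ for some $u\in\mathcal{A}$ and $I_1[u]\le\liminf_{\gamma\to1}I_\gamma[u_\gamma]$; for every $u\in\mathcal{A}$ there are $u_\gamma\in\mathcal{A}$ with $u_\gamma\to u$ in $H^2$ and $I_\gamma[u_\gamma]\to I_1[u]$; and weak accumulation points of quasiminimizers of $I_\gamma$ as $\gamma\to1$ are minimizers of $I_1$.
   Context: Let $L>0$. $S=\{s\in\mathbb{R}^3:\Phi_S(s)=0\}$ is a regular hypersurface ($\Phi_S'\ne0$ on $S$). $n_S:\mathbb{R}^3\to\mathbb{R}^3$ is a continuous vector field with $|n_S|\le1$ which on $S$ coincides with the unit normal $\Phi_S'/|\Phi_S'|$. $L_{\rm bc}:H^2(0,L;\mathbb{R}^3)\to\mathbb{R}^\ell$ is bounded and linear, $L_{\rm bc}[v]$ only depends on the boundary values of $v$ and $v'$, and $\ell_{\rm bc}\in\mathbb{R}^\ell$. The set $\mathcal{A}=\{v\in H^2(0,L;\mathbb{R}^3):|v'|^2=1,\ \Phi_S(v)=0\text{ on }[0,L],\ L_{\rm bc}[v]=\ell_{\rm bc}\}$ is assumed nonempty. For a partition $0=z_0<\dots<z_J=L$ with maximal mesh size $h=\max_j|z_j-z_{j-1}|$ (one arbitrary such partition for each $h$ in a sequence tending to $0$), $V_h$ is the space of all $v_h\in C^1([0,L];\mathbb{R}^3)$ that are componentwise polynomials of degree at most $3$ on each $[z_{j-1},z_j]$, and $\mathcal{A}_h=\{v_h\in V_h:|v_h'(z_j)|=1,\ \Phi_S(v_h(z_j))=0,\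 j=0,\dots,J,\ L_{\rm bc}[v_h]=\ell_{\rm bc}\}$. For $\gamma\in[0,1]$: $I_\gamma[u]=\frac12\int_0^L|u''|^2-\gamma|u''\cdot n_S(u)|^2\,dx$ if $u\in\mathcal{A}$ and $+\infty$ for all other $u\in H^2(0,L;\mathbb{R}^3)$ (for $\gamma=1$ the integrand is the squared geodesic curvature of $u$ on $S$); $I_{\gamma,h}[u_h]$ is given by the same integral if $u_h\in\mathcal{A}_h$ and is $+\infty$ for all other elements of $H^2(0,L;\mathbb{R}^3)$. A sequence is called a sequence of quasiminimizers if its functional values exceed the respective infima by at most amounts that tend to $0$ along the sequence. *)

(* Defs.v *)
From HB Require Import structures.
From mathcomp Require Import all_boot all_order all_algebra.
From mathcomp Require Import all_classical all_reals all_analysis.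

Set Implicit Arguments.
Unset Strict Implicit.
Unset Printing Implicit Defensive.

Import Order.TTheory GRing.Theory Num.Theory.
Import numFieldNormedType.Exports.

Local Open Scope classical_set_scope.
Local Open Scope ring_scope.

(* The library norm on row vectors is the sup norm; lengths in the formulas
   below are Euclidean. *)
Definition dot (R : realType) (n : nat) (u v : 'rV[R]_n) : R :=
  \sum_i u 0 i * v 0 i.

Definition enorm (R : realType) (n : nat) (u : 'rV[R]_n) : R :=
  Num.sqrt (dot u u).

Section surfaces.
Variable R : realType.
Implicit Types (f Psi : 'rV[R]_3 -> R) (U S : set 'rV[R]_3).

Definition grad f (s : 'rV[R]_3) : 'rV[R]_3 :=
  \row_i 'D_(delta_mx 0 i) f s.

Definition C1_on U f : Prop :=
  forall s, U s -> differentiable f s /\ {for s, continuous (grad f)}.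

Definition C2_on U f : Prop :=
  C1_on U f /\ forall i, C1_on U (fun s => grad f s 0 i).

Definition zero_set f : set 'rV[R]_3 := [set s | f s = 0].

Definition unit_normal f (s : 'rV[R]_3) : 'rV[R]_3 :=
  (enorm (grad f s))^-1 *: grad f s.

(* Psi is a regular C^2 equation of S in the open set U *)
Definition C2_equation S U Psi : Prop :=
  [/\ open U, C2_on U Psi, S `&` U = zero_set Psi `&` U
    & forall s, (S `&` U) s -> grad Psi s != 0].

Definition C2_surface S : Prop :=
  forall s, S s -> exists U Psi, U s /\ C2_equation S U Psi.

(* Principal curvatures at s: the eigenvalues of the Weingarten map, that is,
   of the differential of a unit normal field restricted to the tangent plane.
   The choice of the local equation only affects their common sign. *)
Definition principal_curvature S (s : 'rV[R]_3) (kappa : R) : Prop :=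
  S s /\ exists U Psi (t : 'rV[R]_3),
    [/\ U s, C2_equation S U Psi, t != 0, dot (grad Psi s) t = 0
      & 'D_t (unit_normal Psi) s = kappa *: t].

End surfaces.

Section sobolev.
Variables (R : realType) (L : R).

Local Notation mu := (@lebesgue_measure R).
Local Notation curve := (R -> 'rV[R]_3).
Implicit Types (u v w : curve) (k : nat).

(* Curves are total functions on R; only their values on [0, L] matter. *)

Definition L2 u : Prop := forall i,
  measurable_fun `[0, L] (fun x => u x 0 i) /\
  mu.-integrable `[0, L] (fun x => ((u x 0 i) ^+ 2)%:E).

Definition L2norm u : R := Num.sqrt (\int[mu]_(x in `[0, L]) dot (u x) (u x)).

(* C^1 functions with compact support in the open interval (0, L) *)
Definition test_function (phi : R -> R) : Prop :=
  [/\ forall x, derivable phi x 1, continuous (derive1 phi)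
    & exists a b, [/\ 0 < a, b < L & forall x, x \notin `[a, b] -> phi x = 0]].

Definition weak_derivative u v : Prop := forall i phi, test_function phi ->
  \int[mu]_(x in `[0, L]) (u x 0 i * derive1 phi x) =
  - \int[mu]_(x in `[0, L]) (v x 0 i * phi x).

(* H^k(0, L; R^3). For k >= 1 an element is given by its representative that is
   continuous on [0, L], so that pointwise and boundary values make sense. *)
Fixpoint sobolev k u : Prop :=
  L2 u /\
  match k with
  | 0 => True
  | k'.+1 => {within `[0, L], continuous u} /\
             exists v, weak_derivative u v /\ sobolev k' v
  end.

Definition H2 : set curve := [set u | sobolev 2 u].
Definition H3 : set curve := [set u | sobolev 3 u].

(* u' (continuous on [0, L]) and u'' (defined almost everywhere) for u in H^2 *)
Definition D1 u : curve :=
  xget (fun=> 0) [set v | weak_derivative u v /\ sobolev 1 v].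
Definition D2 u : curve :=
  xget (fun=> 0) [set v | weak_derivative (D1 u) v /\ sobolev 0 v].

Definition H2norm u : R :=
  Num.sqrt (L2norm u ^+ 2 + L2norm (D1 u) ^+ 2 + L2norm (D2 u) ^+ 2).

Definition bounded_linear (W : normedModType R) (F : curve -> W) : Prop :=
  (forall (a : R) u v, H2 u -> H2 v -> F (a *: u + v) = a *: F u + F v) /\
  exists C : R, forall u, H2 u -> `|F u| <= C * H2norm u.

Definition boundary_dependent (W : Type) (F : curve -> W) : Prop :=
  forall u v, H2 u -> H2 v ->
    u 0 = v 0 -> u L = v L -> D1 u 0 = D1 v 0 -> D1 u L = D1 v L -> F u = F v.

Definition norm_on (K : set curve) (N : curve -> R) : Prop :=
  [/\ forall u v, K u -> K v -> N (u + v) <= N u + N v,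
      forall (a : R) u, K u -> N (a *: u) = `|a| * N u
    & forall u, K u -> N u = 0 -> forall x, x \in `[0, L] -> u x = 0].

Definition strong_cvg (u_ : nat -> curve) u : Prop :=
  H2norm (u_ k - u) @[k --> \oo] --> (0 : R).

Definition weak_cvg (u_ : nat -> curve) u : Prop :=
  forall F : curve -> R^o, bounded_linear F -> F (u_ k) @[k --> \oo] --> F u.

Definition strongly_dense (B A : set curve) : Prop :=
  forall u, A u -> forall e : R, 0 < e -> exists2 v, B v & H2norm (v - u) < e.

End sobolev.

Section gamma_convergence.
Variables (R : realType) (L : R).

Local Notation curve := (R -> 'rV[R]_3).
Local Notation functional := (curve -> \bar R).
Local Open Scope ereal_scope.

Definition minimizer (I : functional) (u : curve) : Prop :=
  H2 L u /\ forall v, H2 L v -> I u <= I v.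

Definition quasiminimizers (I_ : nat -> functional) (u_ : nat -> curve) : Prop :=
  exists eps : nat -> R, eps @ \oo --> (0%R : R) /\
    forall k, H2 L (u_ k) /\ I_ k (u_ k) <= ereal_inf (I_ k @` H2 L) + (eps k)%:E.

Definition Gamma_limit (I_ : nat -> functional) (I : functional) : Prop :=
  forall u, H2 L u ->
    (forall u_, (forall k, H2 L (u_ k)) -> weak_cvg L u_ u ->
       I u <= limn_einf (fun k => I_ k (u_ k))) /\
    (exists u_, [/\ forall k, H2 L (u_ k), weak_cvg L u_ u
       & limn_esup (fun k => I_ k (u_ k)) <= I u]).

Definition equicoercive_liminf (A_ : nat -> set curve) (I_ : nat -> functional)
    (A : set curve) (I : functional) : Prop :=
  forall u_ (c : R), (forall k, A_ k (u_ k) /\ I_ k (u_ k) <= c%:E) ->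
    exists (phi : nat -> nat) u,
      [/\ {homo phi : m n / (m < n)%N}, A u, weak_cvg L (u_ \o phi) u
        & I u <= limn_einf (fun k => I_ (phi k) (u_ (phi k)))].

Definition recovery (A_ : nat -> set curve) (I_ : nat -> functional)
    (A : set curve) (I : functional) : Prop :=
  forall u, A u -> exists u_,
    [/\ forall k, A_ k (u_ k), strong_cvg L u_ u
      & I_ k (u_ k) @[k --> \oo] --> I u].

Definition accumulation_minimizers (I_ : nat -> functional)
    (I : functional) : Prop :=
  forall u_, quasiminimizers I_ u_ ->
  forall (phi : nat -> nat) u, {homo phi : m n / (m < n)%N} -> H2 L u ->
    weak_cvg L (u_ \o phi) u -> minimizer I u.

(* The first clause is the abstract (sequential, weak-topology) notion; the others
   are its explicit form, A_ k and A being the effective domains of I_ k and I. *)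
Definition Gamma_approximation (A_ : nat -> set curve) (I_ : nat -> functional)
    (A : set curve) (I : functional) : Prop :=
  [/\ Gamma_limit I_ I, equicoercive_liminf A_ I_ A I, recovery A_ I_ A I
    & accumulation_minimizers I_ I].

End gamma_convergence.

Section elastic_curves.
Variables (R : realType) (L : R) (Phi : 'rV[R]_3 -> R).
Variables (ell : nat) (Lbc : (R -> 'rV[R]_3) -> 'rV[R]_ell) (lbc : 'rV[R]_ell).

Local Notation mu := (@lebesgue_measure R).
Local Notation curve := (R -> 'rV[R]_3).

Definition admissible : set curve := [set v |
  [/\ H2 L v,
      forall x, x \in `[0, L] -> enorm (D1 L v x) ^+ 2 = 1 /\ Phi (v x) = 0
    & Lbc v = lbc]].

Definition mesh_partition (J : nat) (z : nat -> R) : Prop :=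
  [/\ z 0%N = 0, z J = L & forall j, (j < J)%N -> z j < z j.+1].

Definition mesh_size (J : nat) (z : nat -> R) : R :=
  \big[Num.max/0]_(j < J) `|z j.+1 - z j|.

(* C^1([0, L]; R^3): u is C^1 in (0, L), and u and u' extend continuously to
   the closed interval *)
Definition C1_closed (u : curve) : Prop :=
  {within `[0, L], continuous u} /\
  exists w : curve, {within `[0, L], continuous w} /\
    forall x i, x \in `]0, L[ -> is_derive x 1 (fun t => u t 0 i) (w x 0 i).

Definition cubic_C1_space (J : nat) (z : nat -> R) : set curve := [set v |
  C1_closed v /\
  forall (j : nat) i, (j < J)%N -> exists p : {poly R},
    (size p <= 4)%N /\ forall x, x \in `[z j, z j.+1] -> v x 0 i = p.[x]].

Definition admissible_h (J : nat) (z : nat -> R) : set curve := [set v |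
  [/\ cubic_C1_space J z v,
      forall j, (j <= J)%N -> enorm (D1 L v (z j)) = 1 /\ Phi (v (z j)) = 0
    & Lbc v = lbc]].

Definition energy_density (nS : 'rV[R]_3 -> 'rV[R]_3) (gamma : R) (u : curve)
    (x : R) : R :=
  enorm (D2 L u x) ^+ 2 - gamma * `|dot (D2 L u x) (nS (u x))| ^+ 2.

Definition bending_energy (nS : 'rV[R]_3 -> 'rV[R]_3) (A : set curve)
    (gamma : R) (u : curve) : \bar R :=
  if u \in A then
    ((2^-1)%:E * \int[mu]_(x in `[0%R, L]) (energy_density nS gamma u x)%:E)%E
  else +oo%E.

End elastic_curves.

(* Main.v *)
(** Both parts are reduced to sublevel sets: Gamma-convergence with compactness
    follows once sublevels are weakly closed along the sequence, weakly compact,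
    and every admissible curve has a recovery sequence.

    Lower semicontinuity and convergence of energies. With n_k = n_S(u_k) and
    Q_k(w) = int |w|^2 - gamma_k (w . n_k)^2 >= 0, expanding Q_k around w = u''
    gives Q_k(u_k'') = a_k + Q_k(u_k'' - u''), where a_k pairs the weakly
    convergent u_k'' with the strongly convergent w - gamma_k (w . n_k) n_k and
    tends to Q(u''). The last term is nonnegative and at most |u_k'' - u''|^2.

    Coercivity. L_bc is injective on constants, and |u'| <= 1 at the ends of the
    interval together with |u(L) - u(0)| controls the boundary data up to the
    constant u(0), hence u(0) itself. For gamma < 1 the energy dominates
    (1 - gamma) |u''|^2. For gamma -> 1 the curves stay in a compact part of S,
    where differentiating Psi(u) = 0 twice bounds u'' . n_S uniformly for unit
    speed curves; a C^2 equation Psi and the C^1 equation Phi of S have parallel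
    gradients, by the intermediate value theorem.

    Recovery in (a). The piecewise cubic Hermite interpolant satisfies all nodal
    constraints, and its second derivative is elementwise the best affine L^2
    approximation of u''; it is compared with the continuous second derivative of
    a nearby H^3 curve, so no higher regularity of u is needed.

    Weak compactness of bounded sequences comes from the Hilbert structure
    u(0).v(0) + u'(0).v'(0) + int u''.v'' and Riesz representation on the closed
    subspace of vectors against which an extracted subsequence converges. *)
Require Import Defs.
From HB Require Import structures.
From mathcomp Require Import all_boot all_order all_algebra.
From mathcomp Require Import all_classical all_reals all_analysis.
From mathcomp Require Import measurable_realfun ring lra.

Set Implicit Arguments.
Unset Strict Implicit.
Unset Printing Implicit Defensive.

Import Order.TTheory GRing.Theory Num.Theory.
Import numFieldNormedType.Exports.

Local Open Scope classical_set_scope.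
Local Open Scope ring_scope.

(** Weak derivatives are only chosen, never computed: [D1] and [D2] are values of a choice operator.
    The du Bois-Reymond lemma turns them into integral identities, and from then on a curve of H2 is
    handled as a triple in which each function is a primitive of the next. Polynomials, splines,
    linear combinations and limits are built as such triples, and [triple_H2] reads off their
    derivatives, the second one only almost everywhere.

    The discrete constraints hold at nodes only. This is harmless in both directions: the nodes
    become dense and bounded energy gives uniform Hoelder moduli for [u_h] and [u_h'], so the
    constraints hold everywhere in the limit; conversely Hermite interpolation keeps [u] and [u'] at
    every node, hence also the boundary data on which [Lbc] depends.

    In (b) the weight [1 - gamma] degenerates, so coercivity has to come from the geometry. The
    equation [Phi] is only C1 and cannot be differentiated twice along a curve; a local C2 equation
    takes its place, and since [u''] exists only almost everywhere, so does the resulting bound. *)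

Section real_sequences.
Variable R : realType.
Implicit Types (u v : nat -> R) (l : R).

Lemma cvgn_distP u l : u @ \oo --> l <->
  forall e, 0 < e -> exists N, forall n, (N <= n)%N -> `|u n - l| < e.
Proof.
split=> [/cvgrPdist_lt ul e e0|ul].
  have [N _ Nl] := ul e e0; exists N => n Nn.
  by rewrite distrC; exact: Nl.
apply/cvgrPdist_lt => e e0; have [N Nl] := ul e e0.
by exists N => // n Nn; rewrite /= distrC; exact: Nl.
Qed.

Lemma squeeze_dist u v l : (forall n, `|u n - l| <= v n) ->
  v @ \oo --> (0 : R) -> u @ \oo --> l.
Proof.
move=> uv /cvgn_distP v0; apply/cvgn_distP => e e0.
have [N Nv] := v0 e e0; exists N => n Nn.
apply: le_lt_trans (uv n) _; apply: le_lt_trans (Nv n Nn).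
by rewrite subr0 ler_norm.
Qed.

Lemma cvgn_cauchyP u : (forall e, 0 < e -> exists N, forall m n,
    (N <= m)%N -> (N <= n)%N -> `|u m - u n| < e) -> cvgn u.
Proof.
move=> h; apply: cauchy_cvg; apply: cauchy_exP => e e0.
have [N hN] := h e e0; exists (u N); exists N => // n Nn /=.
by rewrite /ball/=; exact: hN.
Qed.

Lemma cvgn_le u l c : u @ \oo --> l -> (forall n, u n <= c) -> l <= c.
Proof.
move=> ul uc; rewrite -(cvg_lim (@Rhausdorff R) ul).
by apply: limr_le; [apply/cvg_ex; exists l|exact: nearW].
Qed.

Lemma cvgn_ge u l c : u @ \oo --> l -> (forall n, c <= u n) -> c <= l.
Proof.
move=> ul uc; rewrite -(cvg_lim (@Rhausdorff R) ul).
by apply: limr_ge; [apply/cvg_ex; exists l|exact: nearW].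
Qed.

Lemma cvgn_sqrt u l : u @ \oo --> l -> Num.sqrt (u k) @[k --> \oo] --> Num.sqrt l.
Proof. by move=> ul; apply: continuous_cvg => //; exact: sqrt_continuous. Qed.

Lemma leq_subseq (phi : nat -> nat) :
  {homo phi : m n / (m < n)%N} -> forall n, (n <= phi n)%N.
Proof.
move=> hphi; elim=> // n IHn; apply: leq_ltn_trans IHn _; exact: hphi.
Qed.

Lemma subseq_cvgn (phi : nat -> nat) : {homo phi : m n / (m < n)%N} ->
  phi @ \oo --> \oo.
Proof.
move=> hphi A [N _ NA]; exists N => // n /= Nn; apply: NA => /=.
exact: leq_trans Nn (leq_subseq hphi n).
Qed.

Lemma cvgn_subseq (T : topologicalType) (phi : nat -> nat) (f : nat -> T) (x : T) :
  {homo phi : m n / (m < n)%N} -> f @ \oo --> x -> f (phi k) @[k --> \oo] --> x.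
Proof. by move=> hphi; exact: (cvg_comp phi f (subseq_cvgn hphi)). Qed.

(* Ultrafilter limits replace the iterated extraction of subsequences. *)
Lemma diagonal_extraction (x : nat -> nat -> R) (M : nat -> R) :
  (forall k j, `|x k j| <= M j) ->
  exists (phi : nat -> nat) (l : nat -> R), {homo phi : m n / (m < n)%N} /\
    forall j, x (phi k) j @[k --> \oo] --> l j.
Proof.
move=> xM.
have [U [UU sU]] := @ultraFilterLemma nat \oo%classic _.
have PU : ProperFilter U by exact: ultra_proper.
have lP j : exists l, x k j @[k --> U] --> l.
  have fP : ProperFilter (fmap (x ^~ j) U) by exact: fmap_proper_filter.
  have [|l [_ cl]] := @segment_compact R (- M j) (M j) _ fP.
    by apply: sU; exists 0%N => // k _ /=; rewrite in_itv/= -ler_norml.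
  (* A cluster point of an ultrafilter image is its limit: if the preimage of a neighbourhood were
     not in [U], the preimage of the complement would be, and the complement would have to meet the
     neighbourhood. *)
  exists l => A lA.
  have [//|UC] := in_ultra_setVsetC (x^~ j @^-1` A) UU.
  by have [y [+ Ay]] := cl (~` A) A UC lA.
have {lP}[l lP] := choice lP.
(* Finitely many coordinates cost only finite intersections of sets of [U], so a single index beyond
   [N] brings the first [n] coordinates close to their limits at once. *)
have ex n N : exists k, (N <= k)%N /\ forall j, (j < n)%N -> `|x k j - l j| < n.+1%:R^-1.
  have U1 : U [set k | forall j, (j < n)%N -> `|x k j - l j| < n.+1%:R^-1].
    suff h m : U [set k | forall j, (j < m)%N -> `|x k j - l j| < n.+1%:R^-1].
      exact: h.
    elim: m => [|m IH]; first by apply: filterS filterT.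
    have e0 : 0 < n.+1%:R^-1 :> R by rewrite invr_gt0.
    have /cvgrPdist_lt /(_ _ e0) := lP m.
    move: IH; apply: filterS2 => k /= h1 h2 j.
    by rewrite ltnS leq_eqVlt => /predU1P[->|/h1//]; rewrite distrC.
  have U2 : U [set k | (N <= k)%N] by apply: sU; exists N.
  by have [k [k1 k2]] := filter_ex (filterI U1 U2); exists k.
have [f fP] := choice (fun p : nat * nat => ex p.1 p.2).
pose fix phi n := if n is n'.+1 then f (n'.+1, (phi n').+1) else f (0, 0)%N.
have phiS n : (phi n < phi n.+1)%N by have [] := fP (n.+1, (phi n).+1).
have phi_lt : {homo phi : m n / (m < n)%N} by apply: homo_ltn => //; exact: ltn_trans.
exists phi, l; split => // j; apply/cvgn_distP => e e0.
have phiP n : (j < n)%N -> `|x (phi n) j - l j| < n.+1%:R^-1.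
  by case: n => // n jn; have [_] := fP (n.+1, (phi n).+1); exact.
have /cvgn_distP /(_ _ e0)[N hN] := @cvg_harmonic R.
exists (maxn N j.+1) => n; rewrite geq_max => /andP[Nn jn].
apply: lt_le_trans (phiP _ jn) _.
have := hN n Nn; rewrite subr0 /= ger0_norm; first exact: ltW.
by rewrite invr_ge0.
Qed.

End real_sequences.

(** * Weak compactness in semi-inner product spaces *)

Section hilbert.
Variables (R : realType) (V : lmodType R) (H : set V) (ip : V -> V -> R).

Hypothesis H0 : H 0.
Hypothesis H_lin : forall (a : R) u v, H u -> H v -> H (a *: u + v).
Hypothesis ip_sym : forall u v, H u -> H v -> ip u v = ip v u.
Hypothesis ip_lin : forall (a : R) u v w, H u -> H v -> H w ->
  ip (a *: u + v) w = a * ip u w + ip v w.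
(** Positivity is only semi-definite: curves are functions on the whole line and the forms used
    below do not see them off the interval, so a vector of length zero need not vanish. *)
Hypothesis ip_ge0 : forall u, H u -> 0 <= ip u u.

Let HZ (a : R) u : H u -> H (a *: u).
Proof. by move=> Hu; rewrite -[_ *: _]addr0; exact: H_lin. Qed.

Let HD u v : H u -> H v -> H (u + v).
Proof. by move=> Hu Hv; rewrite -[u]scale1r; exact: H_lin. Qed.

Let HB u v : H u -> H v -> H (u - v).
Proof. by move=> Hu Hv; apply: HD => //; rewrite -scaleN1r; exact: HZ. Qed.

Let ip0l w : H w -> ip 0 w = 0.
Proof.
move=> Hw; have := ip_lin 1 H0 H0 Hw.
rewrite scale1r addr0 mul1r => /eqP.
by rewrite -subr_eq0 opprD addrA subrr sub0r oppr_eq0 => /eqP.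
Qed.

Let ipZl (a : R) u w : H u -> H w -> ip (a *: u) w = a * ip u w.
Proof. by move=> Hu Hw; rewrite -[_ *: _]addr0 ip_lin// ip0l// addr0. Qed.

Let ipDl u v w : H u -> H v -> H w -> ip (u + v) w = ip u w + ip v w.
Proof. by move=> Hu Hv Hw; rewrite -[u in LHS]scale1r ip_lin// mul1r. Qed.

Let ipBl u v w : H u -> H v -> H w -> ip (u - v) w = ip u w - ip v w.
Proof.
move=> Hu Hv Hw; rewrite ipDl//; last by rewrite -scaleN1r; exact: HZ.
by rewrite -scaleN1r ipZl// mulN1r.
Qed.

Let ip_expand (t : R) u v : H u -> H v ->
  ip (u + t *: v) (u + t *: v) = ip u u + t * ip u v *+ 2 + t ^+ 2 * ip v v.
Proof.
move=> Hu Hv; have Htv := HZ t Hv; have Hs := HD Hu Htv.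
rewrite ipDl// ipZl// (ip_sym Hu Hs) (ip_sym Hv Hs) !ipDl// !ipZl//.
by rewrite (ip_sym Hv Hu); ring.
Qed.

Lemma ip_cauchy_schwarz u v : H u -> H v -> ip u v ^+ 2 <= ip u u * ip v v.
Proof.
move=> Hu Hv.
have key t : 0 <= ip u u + t * ip u v *+ 2 + t ^+ 2 * ip v v.
  by rewrite -ip_expand//; apply/ip_ge0/HD => //; exact: HZ.
have := ip_ge0 Hv; rewrite le_eqVlt => /predU1P[v0|v0].
  rewrite -v0 mulr0; move: key; rewrite -v0.
  have [->|uv0] := eqVneq (ip u v) 0; first by rewrite expr0n.
  (* When [ip v v = 0] the quadratic is affine in [t], and this [t] would give it the value [-1]. *)
  move=> /(_ (- (ip u u + 1) / (2 * ip u v))).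
  rewrite [X in _ <= X -> _](_ : _ = -1); first by rewrite lerNr oppr0 ler10.
  by field.
have := key (- ip u v / ip v v).
rewrite [X in _ <= X -> _](_ : _ = ip u u - ip u v ^+ 2 / ip v v); last first.
  by field; rewrite gt_eqF.
by rewrite subr_ge0 ler_pdivrMr.
Qed.

Lemma ip_norm_le u v : H u -> H v ->
  `|ip u v| <= Num.sqrt (ip u u) * Num.sqrt (ip v v).
Proof.
move=> Hu Hv; rewrite -sqrtrM ?ip_ge0// -sqrtr_sqr.
by rewrite ler_sqrt ?ip_cauchy_schwarz// mulr_ge0// ip_ge0.
Qed.

Hypothesis complete : forall u_ : nat -> V, (forall k, H (u_ k)) ->
  (forall e : R, 0 < e -> exists N, forall m n, (N <= m)%N -> (N <= n)%N ->
     ip (u_ m - u_ n) (u_ m - u_ n) < e) ->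
  exists2 u, H u & ip (u_ k - u) (u_ k - u) @[k --> \oo] --> (0 : R).

Let ip_cvgl (u_ : nat -> V) u y : (forall k, H (u_ k)) -> H u -> H y ->
  ip (u_ k - u) (u_ k - u) @[k --> \oo] --> (0 : R) ->
  ip (u_ k) y @[k --> \oo] --> ip u y.
Proof.
move=> Hu_ Hu Hy cu.
apply: (@squeeze_dist _ _
  (fun k => Num.sqrt (ip (u_ k - u) (u_ k - u)) * Num.sqrt (ip y y))).
  by move=> n; rewrite -ipBl//; apply: ip_norm_le => //; exact: HB.
rewrite -[X in _ --> X](mul0r (Num.sqrt (ip y y))).
apply: cvgM; last exact: cvg_cst.
by have := cvgn_sqrt cu; rewrite sqrtr0.
Qed.

Definition ip_closed (Y : set V) := forall (y_ : nat -> V) u,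
  (forall k, Y (y_ k)) -> H u ->
  ip (y_ k - u) (y_ k - u) @[k --> \oo] --> (0 : R) -> Y u.

(* The representing vector is the minimizer of |y|^2 - 2 l(y); a minimizing
   sequence is Cauchy by the parallelogram identity. *)
Lemma riesz_on_subspace (Y : set V) (l : V -> R) (C : R) : Y `<=` H -> Y 0 ->
  (forall (a : R) u v, Y u -> Y v -> Y (a *: u + v)) -> ip_closed Y ->
  (forall (a : R) u v, Y u -> Y v -> l (a *: u + v) = a * l u + l v) ->
  (forall u, Y u -> `|l u| <= C * Num.sqrt (ip u u)) ->
  exists2 w, Y w & forall y, Y y -> ip w y = l y.
Proof.
move=> YH Y0 Ylin Ycl llin lC.
have YZ (a : R) u : Y u -> Y (a *: u).
  by move=> Yu; rewrite -[_ *: _]addr0; exact: Ylin.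
have YD u v : Y u -> Y v -> Y (u + v).
  by move=> Yu Yv; rewrite -[u]scale1r; exact: Ylin.
have lD u v : Y u -> Y v -> l (u + v) = l u + l v.
  by move=> Yu Yv; rewrite -[u in LHS]scale1r llin// mul1r.
have l0 : l 0 = 0.
  have := lD _ _ Y0 Y0; rewrite addr0 => /eqP.
  by rewrite -subr_eq0 opprD addrA subrr sub0r oppr_eq0 => /eqP.
have lZ (a : R) u : Y u -> l (a *: u) = a * l u.
  by move=> Yu; rewrite -[_ *: _]addr0 llin// l0 addr0.
pose J y := ip y y - 2 * l y.
(* With [s] the length of [y], [J y] is at least [s^2 - 2 C s], whose minimum is [- C^2]. *)
have Jge y : Y y -> - C ^+ 2 <= J y.
  move=> Yy; have := lC y Yy; have := ler_norm (l y).
  have := sqr_sqrtr (ip_ge0 (YH y Yy)); rewrite /J.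
  set s := Num.sqrt _ => sE h1 h2; have := sqr_ge0 (s - C).
  by rewrite -sE; nra.
pose d := inf (J @` Y).
have hinf : has_inf (J @` Y).
  split; first by exists (J 0), 0.
  by exists (- C ^+ 2) => _ [y Yy <-]; exact: Jge.
have dle y : Y y -> d <= J y by move=> Yy; apply: ge_inf; [exact: hinf.2|exists y].
have ex k : exists y, Y y /\ J y < d + k.+1%:R^-1.
  have k0 : 0 < k.+1%:R^-1 :> R by rewrite invr_gt0.
  by have [_ [y Yy <-]] := inf_adherent k0 hinf; exists y.
have {ex}[y_ y_P] := choice ex.
have Yy_ k : Y (y_ k) by have [] := y_P k.
have Hy_ k : H (y_ k) by exact: YH.
have h0 : (k.+1%:R^-1 : R) @[k --> \oo] --> (0 : R) by exact: cvg_harmonic.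
have [e e0|w Hw cw] := complete Hy_.
  (* The squared distance of [y_ m] and [y_ n] is [2 J (y_ m) + 2 J (y_ n) - 4 J] of the midpoint,
     and the midpoint costs at least [d]; so it is below [2/(m+1) + 2/(n+1)], whence the quarter. *)
  have e4 : 0 < e / 4 by rewrite divr_gt0.
  have [N hN] := (cvgn_distP _ _).1 h0 _ e4.
  exists N => m n Nm Nn.
  have Hmid : Y (2^-1 *: (y_ m + y_ n)) by apply: YZ; exact: YD.
  have := dle _ Hmid; rewrite /J lZ ?lD//; last exact: YD.
  have -> : ip (2^-1 *: (y_ m + y_ n)) (2^-1 *: (y_ m + y_ n)) =
      (ip (y_ m) (y_ m) + 2 * ip (y_ m) (y_ n) + ip (y_ n) (y_ n)) / 4.
    have := ip_expand 1 (Hy_ m) (Hy_ n); rewrite scale1r => Emn.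
    have Hmn : H (y_ m + y_ n) by exact: HD.
    rewrite ipZl ?(ip_sym Hmn (HZ 2^-1 Hmn)) ?ipZl//; last exact: HZ.
    by rewrite Emn; field.
  have := ip_expand (-1) (Hy_ m) (Hy_ n); rewrite scaleN1r => ->.
  have [_ ] := y_P m; have [_] := y_P n; rewrite /J.
  have := hN _ Nm; have := hN _ Nn; rewrite !subr0 !ger0_norm ?invr_ge0//.
  move: n.+1%:R^-1 m.+1%:R^-1 => p q; lra.
have Yw : Y w by exact: (Ycl y_).
exists w => // y Yy; have Hy := YH y Yy.
(* The first variation at [w], obtained as the limit of [J (y_k + t y) - J (y_k) >= - 1/(k+1)], so
   that the value [J w] itself is never computed. *)
have key t : 0 <= t ^+ 2 * ip y y + 2 * t * (ip w y - l y).
  have c1 : t ^+ 2 * ip y y + 2 * t * (ip (y_ k) y - l y) + k.+1%:R^-1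
      @[k --> \oo] --> t ^+ 2 * ip y y + 2 * t * (ip w y - l y) + 0.
    apply: cvgD h0; apply: cvgD; first exact: cvg_cst.
    apply: cvgM; first exact: cvg_cst.
    by apply: cvgB; [exact: ip_cvgl|exact: cvg_cst].
  rewrite addr0 in c1; apply: cvgn_ge c1 _ => k.
  have := dle _ (YD _ _ (Yy_ k) (YZ t _ Yy)).
  rewrite /J ip_expand// lD ?lZ//; last exact: YZ.
  have [_ ] := y_P k; rewrite /J; move: k.+1%:R^-1 => p; lra.
apply/eqP; rewrite -subr_eq0; apply/eqP.
set D := ip w y - l y in key *.
have y0 := ip_ge0 Hy; set q := ip y y in key y0 *.
(* The optimal [t] would be [- D / q]; [q + 1] avoids dividing by zero when [y] has length zero. *)
have := key (- D / (q + 1)).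
have q1 : q + 1 != 0 by rewrite gt_eqF// ltr_wpDl.
rewrite [X in _ <= X -> _](_ : _ = - (D ^+ 2 * (q + 2) / (q + 1) ^+ 2)); last by field.
rewrite oppr_ge0 pmulr_lle0; last by rewrite invr_gt0 exprn_gt0// ltr_wpDl.
rewrite pmulr_lle0; last by rewrite ltr_wpDl.
by move=> D0; apply/eqP; rewrite -sqrf_eq0 eq_le D0 sqr_ge0.
Qed.

(** The sequence supplies its own test vectors: after extraction its pairings with each of its
    members converge. The set [Y] then contains the whole sequence and the limit [w], so a bounded
    functional [G] matters only on [Y], where it is the pairing with a vector of [Y]. *)
Lemma ip_weak_compactness (w_ : nat -> V) (M : R) : (forall k, H (w_ k)) ->
  (forall k, ip (w_ k) (w_ k) <= M) ->
  exists (phi : nat -> nat) w, [/\ {homo phi : m n / (m < n)%N}, H w &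
    forall (G : V -> R) (C : R),
      (forall (a : R) u v, H u -> H v -> G (a *: u + v) = a * G u + G v) ->
      (forall u, H u -> `|G u| <= C * Num.sqrt (ip u u)) ->
      G (w_ (phi k)) @[k --> \oo] --> G w].
Proof.
move=> Hw wM.
have bnd k y : H y -> `|ip (w_ k) y| <= Num.sqrt M * Num.sqrt (ip y y).
  move=> Hy; apply: le_trans (ip_norm_le (Hw k) Hy) _.
  by rewrite ler_wpM2r ?sqrtr_ge0// ler_wsqrtr.
have [phi [l [hphi cl]]] := diagonal_extraction (fun k j => bnd k (w_ j) (Hw j)).
pose Y := [set y | H y /\ cvgn (fun k => ip (w_ (phi k)) y)].
have YH : Y `<=` H by move=> y [].
have Y0 : Y 0.
  split=> //; apply/cvg_ex; exists 0.
  rewrite (_ : (fun k => _) = fun=> 0); first exact: cvg_cst.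
  by apply/funext => k; rewrite ip_sym// ip0l.
have ipr (a : R) u v w : H u -> H v -> H w ->
    ip w (a *: u + v) = a * ip w u + ip w v.
  by move=> Hu Hv Hw'; rewrite ip_sym ?ip_lin// ?(ip_sym Hu)// ?(ip_sym Hv)//; exact: H_lin.
pose lm y := limn (fun k => ip (w_ (phi k)) y).
have Ycvg y : Y y -> ip (w_ (phi k)) y @[k --> \oo] --> lm y by case.
have lmE y c : ip (w_ (phi k)) y @[k --> \oo] --> c -> lm y = c.
  by move=> /cvg_lim; apply; exact: Rhausdorff.
have lin_cvg (a : R) u v : Y u -> Y v ->
    ip (w_ (phi k)) (a *: u + v) @[k --> \oo] --> a * lm u + lm v.
  move=> Yu Yv; have [Hu _] := Yu; have [Hv _] := Yv.
  rewrite (_ : (fun k => _) = fun k => a * ip (w_ (phi k)) u + ip (w_ (phi k)) v).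
    by apply: cvgD; [apply: cvgM; [exact: cvg_cst|exact: Ycvg]|exact: Ycvg].
  by apply/funext => k; rewrite ipr.
have Ylin (a : R) u v : Y u -> Y v -> Y (a *: u + v).
  move=> Yu Yv; split; first exact: H_lin (YH _ Yu) (YH _ Yv).
  by apply/cvg_ex; exists (a * lm u + lm v); exact: lin_cvg.
(* The bound on the sequence makes its pairings with [u] uniformly close to those with a nearby
   [y_ N], whose convergence supplies the Cauchy property. *)
have Ycl : ip_closed Y.
  move=> y_ u Yy Hu cu; split => //; apply: cvgn_cauchyP => e e0.
  have Hy_ k : H (y_ k) by exact: YH.
  have M1 : 0 < Num.sqrt M + 1 by rewrite ltr_wpDl// sqrtr_ge0.
  have e3 : 0 < e / 3 / (Num.sqrt M + 1) by rewrite !divr_gt0.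
  have [N hN] := (cvgn_distP _ _).1 (cvgn_sqrt cu) _ e3.
  have := hN _ (leqnn N); rewrite sqrtr0 subr0 ger0_norm ?sqrtr_ge0// => sN.
  have close k : `|ip (w_ (phi k)) u - ip (w_ (phi k)) (y_ N)| <= e / 3.
    rewrite distrC ip_sym// (ip_sym (Hw _) Hu) -ipBl//.
    rewrite (ip_sym (HB (Hy_ N) Hu))//.
    apply: le_trans (bnd _ _ (HB (Hy_ N) Hu)) _.
    have {}sN := ltW sN; apply: le_trans (ler_wpM2l (sqrtr_ge0 _) sN) _.
    rewrite mulrA ler_pdivrMr// [leLHS]mulrC ler_pM2l ?divr_gt0//.
    by rewrite lerDl.
  have e3' : 0 < e / 6 by rewrite divr_gt0.
  have [N1 hN1] := (cvgn_distP _ _).1 (Ycvg _ (Yy N)) _ e3'.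
  exists N1 => m n Nm Nn.
  have := close m; have := close n; have := hN1 _ Nm; have := hN1 _ Nn.
  rewrite !ltr_norml !ler_norml => /andP[? ?] /andP[? ?] /andP[? ?] /andP[? ?].
  by apply/andP; split; lra.
have Yw k : Y (w_ k) by split => //; apply/cvg_ex; exists (l k); exact: cl.
have lm_lin (a : R) u v : Y u -> Y v -> lm (a *: u + v) = a * lm u + lm v.
  by move=> Yu Yv; apply: lmE; exact: lin_cvg.
have lm_bnd u : Y u -> `|lm u| <= Num.sqrt M * Num.sqrt (ip u u).
  move=> Yu; apply: (cvgn_le (cvg_norm (Ycvg _ Yu))) => n.
  by apply: bnd; exact: YH.
have [w Yw_ wE] := riesz_on_subspace YH Y0 Ylin Ycl lm_lin lm_bnd.
exists phi, w; split=> //; first exact: YH.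
move=> G C Glin GC.
have [g Yg gE] := @riesz_on_subspace Y G C YH Y0 Ylin Ycl
  (fun a u v Yu Yv => Glin a u v (YH _ Yu) (YH _ Yv)) (fun u Yu => GC u (YH _ Yu)).
rewrite (_ : (fun k => _) = fun k => ip (w_ (phi k)) g); last first.
  by apply/funext => k; rewrite -gE// ip_sym//; exact: YH.
by rewrite -gE// ip_sym ?wE//; [exact: Ycvg|exact: YH|exact: YH].
Qed.

End hilbert.

(** * Gamma-convergence from sublevel sets *)

Section gamma.
Variables (R : realType) (L : R).
Local Notation curve := (R -> 'rV[R]_3).
Local Notation functional := (curve -> \bar R).
Implicit Types (u v : curve).

Lemma ereal_real_between (x y : \bar R) : (x < y)%E ->
  exists2 r : R, (x < r%:E)%E & (r%:E < y)%E.
Proof.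
case: x => [x| |]; case: y => [y| |]//=.
- rewrite lte_fin => xy; exists ((x + y) / 2); rewrite lte_fin; lra.
- by move=> _; exists (x + 1); rewrite ?ltry// lte_fin ltrDl.
- by move=> _; exists (y - 1); rewrite ?ltNyr// lte_fin gtrBl.
- by move=> _; exists 0; rewrite ?ltNyr ?ltry.
Qed.

Lemma limn_einf_lt_subseq (a : nat -> \bar R) (c : \bar R) :
  (limn_einf a < c)%E ->
  exists2 phi : nat -> nat, {homo phi : m n / (m < n)%N} &
    forall k, (a (phi k) < c)%E.
Proof.
move=> ac.
have ex n : exists m, (n <= m)%N /\ (a m < c)%E.
  have : (einfs a n < c)%E.
    apply: le_lt_trans ac; rewrite limn_einf_lim.
    rewrite (cvg_lim _ (@cvg_einfs_sup _ a))//.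
    by apply: ereal_sup_ubound; exists n.
  move=> /ereal_inf_lt[_ [m /= nm <-] mc].
  by exists m.
have [f fP] := choice ex.
pose fix phi n := if n is n'.+1 then f (phi n').+1 else f 0%N.
exists phi.
  by apply: homo_ltn => [? ? ?|n]; [exact: ltn_trans|have [] := fP (phi n).+1].
by case=> [|n] /=; [have [] := fP 0%N|have [] := fP (phi n).+1].
Qed.

Lemma weak_cvg_subseq (u_ : nat -> curve) u (phi : nat -> nat) :
  {homo phi : m n / (m < n)%N} -> weak_cvg L u_ u -> weak_cvg L (u_ \o phi) u.
Proof.
by move=> hphi uu F bF; exact: (cvgn_subseq hphi (uu F bF)).
Qed.

Lemma comp_homo_ltn (phi psi : nat -> nat) : {homo phi : m n / (m < n)%N} ->
  {homo psi : m n / (m < n)%N} -> {homo phi \o psi : m n / (m < n)%N}.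
Proof. by move=> h1 h2 m n mn; apply: h1; exact: h2. Qed.

Variables (A_ : nat -> set curve) (I_ : nat -> functional).
Variables (A : set curve) (I : functional).

Hypothesis A_H2 : forall k u, A_ k u -> H2 L u.
Hypothesis A_infty : forall u, ~ A u -> I u = +oo%E.
Hypothesis strong_weak : forall (u_ : nat -> curve) u, (forall k, H2 L (u_ k)) -> H2 L u ->
  strong_cvg L u_ u -> weak_cvg L u_ u.
(** Stated along subsequences of the functionals, because a lower limit is tested on a subsequence
    that stays below a level. *)
Hypothesis sublevel_closed : forall (phi : nat -> nat) (u_ : nat -> curve) u (c : R),
  {homo phi : m n / (m < n)%N} -> (forall k, H2 L (u_ k)) -> H2 L u ->
  (forall k, (I_ (phi k) (u_ k) <= c%:E)%E) -> weak_cvg L u_ u ->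
  (I u <= c%:E)%E.
Hypothesis sublevel_compact : forall (u_ : nat -> curve) (c : R),
  (forall k, A_ k (u_ k) /\ (I_ k (u_ k) <= c%:E)%E) ->
  exists (phi : nat -> nat) u,
    [/\ {homo phi : m n / (m < n)%N}, H2 L u & weak_cvg L (u_ \o phi) u].
Hypothesis rec : recovery L A_ I_ A I.

(** A real number strictly between the lower limit and [I u] would bound the energies along a
    subsequence, and closed sublevels would carry the bound to [u]. *)
Let liminf_le (phi : nat -> nat) (u_ : nat -> curve) u : {homo phi : m n / (m < n)%N} ->
  (forall k, H2 L (u_ k)) -> H2 L u -> weak_cvg L u_ u ->
  (I u <= limn_einf (fun k => I_ (phi k) (u_ k)))%E.
Proof.
move=> hphi Hu_ Hu uu; rewrite leNgt; apply/negP => /ereal_real_between[r r1 r2].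
have [psi hpsi psir] := limn_einf_lt_subseq r1.
have := @sublevel_closed (phi \o psi) (u_ \o psi) u r (comp_homo_ltn hphi hpsi)
  (fun k => Hu_ (psi k)) Hu (fun k => ltW (psir k)) (weak_cvg_subseq hpsi uu).
by rewrite leNgt r2.
Qed.

Let shift_homo (N : nat) : {homo addn N : m n / (m < n)%N}.
Proof. by move=> m n; rewrite ltn_add2l. Qed.

Lemma gamma_approximation_of_sublevels : Gamma_approximation L A_ I_ A I.
Proof.
split.
- move=> u Hu; split; first by move=> u_ Hu_; exact: (@liminf_le id).
  have [Au|nAu] := pselect (A u).
    have [u_ [Au_ su cI]] := rec Au.
    have Hu_ k : H2 L (u_ k) by exact: A_H2.
    exists u_; split=> //; first exact: strong_weak.
    by have [_ ->] := cvg_limn_einf_sup cI.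
  exists (fun=> u); split => //; first by move=> F bF; exact: cvg_cst.
  by rewrite A_infty// leey.
- move=> u_ c h; have [phi [u [hphi Hu uu]]] := sublevel_compact h.
  have Hu_ k : H2 L (u_ (phi k)) by apply: A_H2; exact: (h _).1.
  exists phi, u; split => //; last exact: (liminf_le hphi Hu_).
  (* Off [A] the limit energy is infinite, against the sublevel bound that survives in the limit. *)
  apply: contrapT => /A_infty Iu.
  have := @sublevel_closed phi (u_ \o phi) u c hphi Hu_ Hu
    (fun k => (h _).2) uu.
  by rewrite Iu leye_eq.
- exact: rec.
- move=> u_ [eps [eps0 qm]] phi u hphi Hu uu; split=> // v Hv.
  have [Av|nAv] := pselect (A v); last by rewrite (A_infty nAv) leey.
  rewrite leNgt; apply/negP => /ereal_real_between[r r1 r2].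
  (* If [v] had less energy than [u], two levels [s < r] would fit between: a recovery sequence of
     [v] pushes the infima below [s], hence the quasiminimizers below [r], and closedness carries
     [r] to [u]. *)
  have [s s1 s2] := ereal_real_between r1.
  have [v_ [Av_ _ cI]] := rec Av.
  have [N1 _ N1P] : \forall k \near \oo, (I_ k (v_ k) < s%:E)%E.
    have /= := cI [set x | (x < s%:E)%E]; apply.
    by apply: open_nbhs_nbhs; split => //; exact: open_ereal_lt_ereal.
  have rs : 0 < r - s by rewrite subr_gt0 -lte_fin.
  have [N2 N2P] := (cvgn_distP _ _).1 eps0 _ rs.
  (* Dropping initial indices turns the eventual bounds into bounds for every index, as closedness
     of sublevels demands. *)
  pose psi := phi \o addn (N1 + N2)%N.
  have hpsi : {homo psi : m n / (m < n)%N}.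
    by apply: comp_homo_ltn => //; exact: shift_homo.
  have := @sublevel_closed psi (u_ \o psi) u r hpsi (fun k => (qm _).1) Hu.
  rewrite leNgt r2 => h; suff: false by []; apply: h; last first.
    exact: (weak_cvg_subseq (shift_homo _) uu).
  move=> k /=; set m := psi k.
  have mN : (N1 + N2 <= m)%N.
    by apply: leq_trans (leq_subseq hphi _); rewrite leq_addr.
  apply: le_trans (qm m).2 _.
  apply: (@le_trans _ _ (s%:E + (r - s)%:E)%E); last by rewrite -EFinD addrC subrK.
  apply: leeD; last first.
    have := N2P m (leq_trans (leq_addl _ _) mN); rewrite subr0 lee_fin => /ltW.
    exact/le_trans/ler_norm.
  apply: le_trans (ltW (N1P m (leq_trans (leq_addr _ _) mN))).
  by apply: ereal_inf_lbound; exists (v_ m) => //; exact: A_H2 (Av_ m).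
Qed.

End gamma.

(** * Primitives of integrable functions *)

Section interval_integrals.
Variable R : realType.
Local Notation mu := (@lebesgue_measure R).
Implicit Types (f g u v phi : R -> R) (a b c d x y : R).

Lemma within_continuous_distP f a b : {within `[a, b], continuous f} <->
  forall x, x \in `[a, b] -> forall e, 0 < e -> exists2 d, 0 < d &
    forall y, y \in `[a, b] -> `|x - y| < d -> `|f x - f y| < e.
Proof.
split=> [/subspace_continuousP cf x xab e e0|h].
  have /cvgrPdist_lt /(_ e e0) [d /= d0 dP] := cf x xab.
  by exists d => // y yab xy; exact: dP.
apply/subspace_continuousP => x xab; apply/cvgrPdist_lt => e e0.
by have [d d0 dP] := h x xab e e0; exists d => //= y xy yab; exact: dP.
Qed.

(** Heine-Cantor: the near-covering form of compactness is run over the filter of small positive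
    [d]. *)
Lemma within_continuous_uniform f a b : {within `[a, b], continuous f} ->
  forall e, 0 < e -> exists2 d, 0 < d & forall x y, x \in `[a, b] ->
    y \in `[a, b] -> `|x - y| < d -> `|f x - f y| < e.
Proof.
move=> /within_continuous_distP cf e e0.
have e2 : 0 < e / 2 by rewrite divr_gt0.
have := @segment_compact R a b; rewrite compact_near_coveringP.
move=> /(_ _ (0 : R)^'+ (fun d x => x \in `[a, b] -> forall y, y \in `[a, b] ->
  `|x - y| < d -> `|f x - f y| < e) _) [x /= xab|d0 /= d00 dP].
  have [d d0 dP] := cf x xab _ e2.
  have d2 : 0 < d / 2 by rewrite divr_gt0.
  exists (ball x (d / 2), [set t | t < d / 2]) => /=.
    split; first exact: nbhsx_ballx.
    exists (d / 2) => //= t /=; rewrite sub0r normrN => td t0.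
    by rewrite -(gtr0_norm t0).
  move=> [y t] /= [xy td] yab z zab yz.
  rewrite /ball/= in xy.
  have h1 : `|x - y| < d by apply: lt_trans xy _; rewrite ltr_pdivrMr// ltr_pMr// ltr1n.
  have h2 : `|x - z| < d.
    have -> : x - z = (x - y) + (y - z) by ring.
    apply: le_lt_trans (ler_normD _ _) _; rewrite (splitr d) ltrD//.
    exact: lt_trans td.
  have -> : f y - f z = (f x - f z) - (f x - f y) by ring.
  apply: le_lt_trans (ler_normB _ _) _.
  by rewrite (splitr e) ltrD// dP.
exists (d0 / 2); first by rewrite divr_gt0.
move=> x y xab yab xy; apply: (dP (d0 / 2)) => //=.
- rewrite sub0r normrN gtr0_norm ?divr_gt0// ltr_pdivrMr//.
  by rewrite ltr_pMr// ltr1n.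
- by rewrite divr_gt0.
Qed.

Lemma left_in_itvcc a b : a < b -> a \in `[a, b].
Proof. by move=> ab; rewrite in_itv/= lexx ltW. Qed.

Lemma right_in_itvcc a b : a < b -> b \in `[a, b].
Proof. by move=> ab; rewrite in_itv/= lexx ltW. Qed.

Lemma ae_eq_itvoo_cc a b f g : {ae mu, forall x, x \in `]a, b[ -> f x = g x} ->
  {ae mu, forall x, x \in `[a, b] -> f x = g x}.
Proof.
move=> [N [mN N0 sN]]; exists (N `|` ([set a] `|` [set b])); split.
- by apply: measurableU => //; apply: measurableU.
- rewrite null_set_setU//=; first by apply: measurableU.
  by rewrite null_set_setU//= lebesgue_measure_set1.
- move=> x /= /not_implyP[]; rewrite in_itv/= => /andP[ax xb] fgx.
  have [->|xa] := eqVneq x a; first by right; left.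
  have [->|xb'] := eqVneq x b; first by right; right.
  left; apply: sN => /= h; apply: fgx; apply: h.
  by rewrite in_itv/= !lt_neqAle eq_sym xa ax xb' xb.
Qed.

Lemma ae_eq_Rintegral a b f g : {ae mu, forall x, x \in `[a, b] -> f x = g x} ->
  measurable_fun `[a, b] f -> measurable_fun `[a, b] g ->
  \int[mu]_(x in `[a, b]) f x = \int[mu]_(x in `[a, b]) g x.
Proof.
move=> fg mf mg; congr fine; apply: ae_eq_integral => //.
- exact/measurable_EFinP.
- exact/measurable_EFinP.
- apply: filterS fg; first exact: (ae_filter_ringOfSetsType mu).
  by move=> x /= h xab; rewrite h.
Qed.

Lemma ae_eq_integrable a b f g : {ae mu, forall x, x \in `[a, b] -> f x = g x} ->
  measurable_fun `[a, b] g -> mu.-integrable `[a, b] (EFin \o f) ->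
  mu.-integrable `[a, b] (EFin \o g).
Proof.
move=> fg mg /integrableP[mf jf]; apply/integrableP; split.
  exact/measurable_EFinP.
apply: le_lt_trans jf; rewrite le_eqVlt; apply/orP; left; apply/eqP.
apply: ae_eq_integral => //.
- by apply: measurableT_comp => //; exact/measurable_EFinP.
- exact: measurableT_comp.
- apply: filterS fg; first exact: (ae_filter_ringOfSetsType mu).
  by move=> x /= h xab; rewrite h.
Qed.

(** Where two continuous functions differ, they differ on an interval of positive length, which no
    null set contains. *)
Lemma within_continuous_ae_eq f g a b : a < b ->
  {within `[a, b], continuous f} -> {within `[a, b], continuous g} ->
  {ae mu, forall x, x \in `[a, b] -> f x = g x} ->
  forall x, x \in `[a, b] -> f x = g x.
Proof.
move=> ab cf cg [N [mN N0 sN]] x xab; apply: contrapT => /eqP fgx.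
have ch : {within `[a, b], continuous (fun x => f x - g x)}.
  by move=> y; apply: cvgB; [exact: cf|exact: cg].
have e0 : 0 < `|f x - g x| by rewrite normr_gt0 subr_eq0.
have [d d0 dP] := (within_continuous_distP _ _ _).1 ch x xab _ e0.
pose m := Num.min (d / 2) ((b - a) / 2).
have m0 : 0 < m by rewrite lt_min; apply/andP; split; rewrite divr_gt0// subr_gt0.
have [md mL] : m <= d / 2 /\ m <= (b - a) / 2.
  by split; rewrite /m ge_min lexx ?orbT.
have /andP[xa xb] : a <= x <= b by rewrite in_itv in xab.
(* The interval of length [m] is laid to the side of [x] on which [[a, b]] has room for it. *)
pose c := if x <= (a + b) / 2 then x else x - m.
have [c0 cL cx1 cx2] : [/\ a <= c, c + m <= b, c <= x & x <= c + m].
  by rewrite /c; case: (leP x ((a + b) / 2)) => h; split; lra.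
have : (mu (`[c, (c + m)%R]%classic : set R) <= mu N)%E.
  apply: le_measure; rewrite ?inE//.
  move=> y; rewrite /= in_itv/= => /andP[cy yc]; apply: sN => /= h.
  have yab : y \in `[a, b] by rewrite in_itv/=; lra.
  have := dP y yab; rewrite (h yab) subrr subr0 ltxx => fal.
  suff: false by []; apply: fal.
  by rewrite ltr_norml; apply/andP; split; lra.
rewrite [X in (_ <= X)%E -> _](_ : _ = 0%E) ?N0//.
by rewrite lebesgue_measure_itv/= lte_fin ltrDl m0 -EFinB lee_fin; lra.
Qed.

Lemma within_continuous_oo_eq f g a b : a < b ->
  {within `[a, b], continuous f} -> {within `[a, b], continuous g} ->
  {in `]a, b[, f =1 g} -> {in `[a, b], f =1 g}.
Proof.
move=> ab cf cg fg; apply: within_continuous_ae_eq => //.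
by apply: ae_eq_itvoo_cc; apply: aeW => x; exact: fg.
Qed.

Lemma Rintegral_itv_cst a b c : a <= b -> \int[mu]_(x in `[a, b]) c = (b - a) * c.
Proof.
move=> ab; rewrite Rintegral_cst// mulrC [X in fine X](_ : _ = (b - a)%:E)//.
transitivity (mu (`[a, b]%classic : set R)) => //.
rewrite lebesgue_measure_itv/= lte_fin.
by move: ab; rewrite le_eqVlt => /predU1P[->|->]//; rewrite ltxx subrr.
Qed.

End interval_integrals.

Section primitives.
Variable R : realType.
Local Notation mu := (@lebesgue_measure R).
Implicit Types (f g u v phi : R -> R) (a b c d x y : R).

(** Absolute continuity of [f] with derivative [g], as an integral identity: it asks for no
    differentiability and is stable under changes of [g] on null sets. *)
Definition primitive_on a b f g : Prop :=
  mu.-integrable `[a, b] (EFin \o g) /\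
  forall x, x \in `[a, b] -> f x = f a + \int[mu]_(t in `[a, x]) g t.

Lemma sub_itvcc a b c d : a <= c -> d <= b ->
  [set` `[c, d]] `<=` [set` `[a, b]].
Proof. by move=> ac db; apply: subset_itvScc; rewrite bnd_simp. Qed.

Lemma integrable_sub_itvcc a b c d g : a <= c -> d <= b ->
  mu.-integrable `[a, b] (EFin \o g) -> mu.-integrable `[c, d] (EFin \o g).
Proof.
by move=> ac db; apply: integrableS => //; exact: sub_itvcc.
Qed.

Lemma within_continuous_integrable a b g : {within `[a, b], continuous g} ->
  mu.-integrable `[a, b] (EFin \o g).
Proof. by apply: continuous_compact_integrable; exact: segment_compact. Qed.

Lemma within_continuous_measurable a b g : {within `[a, b], continuous g} ->
  measurable_fun `[a, b] g.
Proof. by move=> /within_continuous_integrable/measurable_int/measurable_EFinP. Qed.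

Lemma Rintegral_cat a b c g : a <= c -> c <= b ->
  mu.-integrable `[a, b] (EFin \o g) ->
  \int[mu]_(t in `[a, b]) g t =
  \int[mu]_(t in `[a, c]) g t + \int[mu]_(t in `[c, b]) g t.
Proof.
move=> ac cb ig; have := @Rintegral_itvB R g (BLeft a) (BRight b) c ig.
rewrite !bnd_simp => /(_ ac cb) E; apply/eqP.
rewrite addrC -subr_eq E -Rintegral_itv_obnd_cbnd//.
by apply: integrableS ig => //; apply: subset_itvScc; rewrite bnd_simp.
Qed.

Lemma primitive_sub a b f g c d : primitive_on a b f g -> a <= c -> c <= d ->
  d <= b -> f d - f c = \int[mu]_(t in `[c, d]) g t.
Proof.
move=> [ig fE] ac cd db.
rewrite (fE d) ?(fE c) ?in_itv/= ?ac ?db ?(le_trans ac cd) ?(le_trans cd db)//.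
rewrite (@Rintegral_cat a d c)//; last exact: integrable_sub_itvcc ig.
by ring.
Qed.

Lemma primitive_restrict a b f g c d : primitive_on a b f g -> a <= c ->
  d <= b -> primitive_on c d f g.
Proof.
move=> fg ac db; split; first exact: (integrable_sub_itvcc _ _ fg.1).
move=> x; rewrite in_itv/= => /andP[cx xd].
by rewrite -(primitive_sub fg)// ?(le_trans xd)//; ring.
Qed.

Lemma integrable_cat a b c g : a <= c -> c <= b ->
  mu.-integrable `[a, c] (EFin \o g) -> mu.-integrable `[c, b] (EFin \o g) ->
  mu.-integrable `[a, b] (EFin \o g).
Proof.
move=> ac cb i1 i2.
have {}i2 : mu.-integrable `]c, b] (EFin \o g).
  by apply: integrableS i2 => //; apply: subset_itvScc; rewrite bnd_simp.
rewrite (@itv_bndbnd_setU _ _ _ (BRight c)) ?bnd_simp//.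
have /integrableP[m1 l1] := i1; have /integrableP[m2 l2] := i2.
have m12 : measurable_fun ([set` `[a, c]] `|` [set` `]c, b]]) (EFin \o g).
  by rewrite measurable_funU.
apply/integrableP; split => //.
rewrite ge0_integral_setU//=.
- by rewrite lte_add_pinfty.
- by apply/measurable_EFinP; apply: measurableT_comp => //; exact/measurable_EFinP.
- apply/disj_setPS => y [/=]; rewrite 2!in_itv/= => /andP[_ yx] /andP[].
  by rewrite ltNge yx.
Qed.

Lemma primitive_cat a b c f g : a <= c -> c <= b ->
  primitive_on a c f g -> primitive_on c b f g -> primitive_on a b f g.
Proof.
move=> ac cb fg1 fg2.
have ig : mu.-integrable `[a, b] (EFin \o g).
  exact: integrable_cat fg1.1 fg2.1.
split=> // x; rewrite in_itv/= => /andP[ax xb].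
have [xc|cx] := leP x c; first by rewrite fg1.2// in_itv/= ax.
have {}cx := ltW cx.
rewrite (@Rintegral_cat a x c)//; last exact: integrable_sub_itvcc ig.
by rewrite -(primitive_sub fg1)// -(primitive_sub fg2)//; ring.
Qed.

Lemma primitive_continuous a b f g : a <= b -> primitive_on a b f g ->
  {within `[a, b], continuous f}.
Proof.
move=> ab fg; have := parameterized_integral_continuous ab fg.1.
move=> /within_continuous_distP h; apply/within_continuous_distP => x xab e e0.
have [d d0 dP] := h x xab e e0; exists d => // y yab xy.
by rewrite fg.2// (fg.2 y)// opprD addrACA subrr add0r; exact: dP.
Qed.

Lemma primitive_eq a b f f' g : a <= b -> {in `[a, b], f =1 f'} ->
  primitive_on a b f g -> primitive_on a b f' g.
Proof.
move=> ab ff' fg; split; first exact: fg.1.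
have aab : a \in `[a, b] by rewrite in_itv/= lexx ab.
by move=> x xab; rewrite -(ff' x xab) -(ff' a aab) (fg.2 x xab).
Qed.

Lemma primitive_ae_eq a b f g g' : {ae mu, forall x, x \in `[a, b] -> g x = g' x} ->
  measurable_fun `[a, b] g' -> primitive_on a b f g -> primitive_on a b f g'.
Proof.
move=> gg' mg' fg; split=> [|x xab]; first exact: ae_eq_integrable fg.1.
have /andP[_ xb] : a <= x <= b by rewrite in_itv in xab.
rewrite fg.2//; congr (_ + _); apply: ae_eq_Rintegral.
- apply: filterS gg'; first exact: (ae_filter_ringOfSetsType mu).
  by move=> y h yx; apply: h; exact: sub_itvcc yx.
- apply/measurable_EFinP; exact: (measurable_int mu (integrable_sub_itvcc _ _ fg.1)).
- by apply: measurable_funS mg' => //; exact: sub_itvcc.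
Qed.

Lemma integrable_lincomb a b (k : R) g1 g2 (D := `[a, b]%classic) :
  mu.-integrable D (EFin \o g1) -> mu.-integrable D (EFin \o g2) ->
  mu.-integrable D (EFin \o (fun x => k * g1 x + g2 x)).
Proof.
have mD : measurable (D : set (measurableTypeR R)) by exact: measurable_itv.
by move=> i1 i2; have := integrableD mD (integrableZl mD k i1) i2; exact.
Qed.

Lemma Rintegral_lincomb a b (k : R) g1 g2 (D := `[a, b]%classic) :
  mu.-integrable D (EFin \o g1) -> mu.-integrable D (EFin \o g2) ->
  \int[mu]_(x in D) (k * g1 x + g2 x) =
  k * \int[mu]_(x in D) g1 x + \int[mu]_(x in D) g2 x.
Proof.
have mD : measurable (D : set (measurableTypeR R)) by exact: measurable_itv.
move=> i1 i2; rewrite RintegralD// ?RintegralZl//.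
by have := integrableZl mD k i1; exact.
Qed.

Lemma primitive_linear a b (k : R) f1 g1 f2 g2 : primitive_on a b f1 g1 ->
  primitive_on a b f2 g2 ->
  primitive_on a b (fun x => k * f1 x + f2 x) (fun x => k * g1 x + g2 x).
Proof.
move=> fg1 fg2; split.
  exact: integrable_lincomb fg1.1 fg2.1.
move=> x xab; have [ax xb] : a <= x /\ x <= b by apply/andP; rewrite in_itv in xab.
have i1 := integrable_sub_itvcc (lexx a) xb fg1.1.
have i2 := integrable_sub_itvcc (lexx a) xb fg2.1.
by rewrite Rintegral_lincomb// (fg1.2 x)// (fg2.2 x)//; ring.
Qed.

Lemma C1_primitive a b f : a <= b -> (forall x, derivable f x 1) ->
  continuous (derive1 f) -> primitive_on a b f (derive1 f).
Proof.
move=> ab df cf'; split.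
  apply: within_continuous_integrable; exact: continuous_subspaceT.
move=> x; rewrite in_itv/= => /andP[]; rewrite le_eqVlt => /predU1P[<-|ax] xb.
  by rewrite set_itv1 Rintegral_set1 addr0.
suff E : (\int[mu]_(t in `[a, x]) (derive1 f t)%:E = (f x)%:E - (f a)%:E)%E.
  by rewrite /Rintegral; move: E => /= ->/=; ring.
apply: (continuous_FTC2 ax); last by [].
  exact: continuous_subspaceT.
split.
- by move=> y _; exact: df.
- by apply: cvg_at_right_filter; apply: differentiable_continuous; exact/derivable1_diffP.
- by apply: cvg_at_left_filter; apply: differentiable_continuous; exact/derivable1_diffP.
Qed.

End primitives.

(** * Integration by parts for primitives of integrable functions *)

Section integration_by_parts_primitives.
Variable R : realType.
Local Notation mu := (@lebesgue_measure R).
Local Notation RT := (measurableTypeR R).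
Implicit Types (u v p q : R -> R) (a b : R).

Lemma integrable_mul_continuous a b u v : mu.-integrable `[a, b] (EFin \o u) ->
  {within `[a, b], continuous v} ->
  mu.-integrable `[a, b] (EFin \o (fun x => u x * v x)).
Proof.
move=> iu cv; have mI : measurable (`[a, b]%classic : set RT) by exact: measurable_itv.
have bv : [bounded v x | x in `[a, b]%classic].
  have /compact_bounded[M [_ mrt]] := continuous_compact cv (@segment_compact _ a b).
  by exists M; split; rewrite ?num_real // => ? ? ? ?; exact: mrt.
by have := integrableMl mI iu (within_continuous_measurable cv) bv; exact.
Qed.

Lemma integrable_scale a b k u : mu.-integrable `[a, b] (EFin \o u) ->
  mu.-integrable `[a, b] (EFin \o (fun x => k * u x)).
Proof.
move=> iu; have mI : measurable (`[a, b]%classic : set RT) by exact: measurable_itv.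
by have := integrableZl mI k iu; exact.
Qed.

(** The product [v t * q x] on the triangle [t <= x] of the square, as a function of the pair
    [(x, t)] on the whole plane. *)
Let triangle_kernel a b v q (z : RT * RT) : R :=
  if z.2 <= z.1 then (v \_ `[a, b]) z.2 * (q \_ `[a, b]) z.1 else 0.

Let measurable_triangle_kernel a b v q : measurable_fun `[a, b] v ->
  measurable_fun `[a, b] q -> measurable_fun setT (triangle_kernel a b v q).
Proof.
move=> mv mq; apply: measurable_fun_ifT => //.
- by apply: measurable_fun_ler; [exact: measurable_snd|exact: measurable_fst].
- apply: measurable_funM.
    apply: measurableT_comp (@measurable_snd _ _ RT RT).
    by apply/(measurable_restrictT _ _).1.
  apply: measurableT_comp (@measurable_fst _ _ RT RT).
  by apply/(measurable_restrictT _ _).1.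
Qed.

(** Dominated by [|v t| |q x|], whose iterated integral is the product of the two L1 norms. *)
Let integrable_triangle_kernel a b v q : mu.-integrable `[a, b] (EFin \o v) ->
  mu.-integrable `[a, b] (EFin \o q) ->
  (mu \x mu)%E.-integrable setT (EFin \o triangle_kernel a b v q).
Proof.
move=> iv iq.
have /measurable_EFinP mv := measurable_int mu iv.
have /measurable_EFinP mq := measurable_int mu iq.
have mv0 : measurable_fun setT (v \_ `[a, b]).
  by apply/(measurable_restrictT _ _).1.
have mq0 : measurable_fun setT (q \_ `[a, b]).
  by apply/(measurable_restrictT _ _).1.
have mK := measurable_triangle_kernel mv mq.
have mK' : measurable_fun setT (EFin \o triangle_kernel a b v q).
  exact/measurable_EFinP.
apply/(integrable12ltyP mu mu mK').
have /integrableP[_ lv] : mu.-integrable setT (EFin \o (v \_ `[a, b])).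
  by rewrite -restrict_EFin; apply/(integrable_mkcond _ _).1.
have /integrableP[_ lq] : mu.-integrable setT (EFin \o (q \_ `[a, b])).
  by rewrite -restrict_EFin; apply/(integrable_mkcond _ _).1.
set C := (\int[mu]_x _)%E in lv.
have C0 : (0 <= C)%E by exact: integral_ge0.
apply: (@le_lt_trans _ _ (\int[mu]_x (C * `|(q \_ `[a, b]) x|%:E))%E).
  apply: ge0_le_integral => //.
  - by move=> x _; exact: integral_ge0.
  - apply: (@measurable_fun_fubini_tonelli_F _ _ _ _ _ mu
      (abse \o (EFin \o triangle_kernel a b v q))) => //.
      by apply: measurableT_comp.
    by move=> z; exact: abse_ge0.
  - by apply: measurable_funeM; apply/measurable_EFinP; exact: measurableT_comp.
  - move=> x _; rewrite muleC -ge0_integralZl//.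
    + apply: ge0_le_integral => //.
      * apply: measurableT_comp => //; apply: measurableT_comp mK' _.
        exact: measurable_pair1.
      * apply: measurable_funeM; apply: measurableT_comp => //.
        exact/measurable_EFinP.
      * move=> t _; rewrite /triangle_kernel/=; case: ifPn => _.
          by rewrite lee_fin normrM mulrC.
        by rewrite normr0 -EFinM lee_fin mulr_ge0.
    + by apply: measurableT_comp => //; exact/measurable_EFinP.
rewrite ge0_integralZl//; first by rewrite lte_mul_pinfty// ge0_fin_numE.
by apply/measurable_EFinP; exact: measurableT_comp.
Qed.

Let triangle_kernelE a b v q x t : triangle_kernel a b v q (x, t) =
  ((fun t => q x * v t) \_ `[a, x]) t * (x \in `[a, b])%:R.
Proof.
rewrite /triangle_kernel/= !patchE !mem_setE/= !in_itv/=.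
by case: (leP t x) => tx; case: (leP a t) => at_; case: (leP t b) => tb;
  case: (leP a x) => ax; case: (leP x b) => xb;
  rewrite /= ?mulr0 ?mul0r ?mulr1// ?(mulrC (v t))//; exfalso; lra.
Qed.

Let triangle_kernelE' a b v q x t : triangle_kernel a b v q (x, t) =
  ((fun x => v t * q x) \_ `[t, b]) x * (t \in `[a, b])%:R.
Proof.
rewrite /triangle_kernel/= !patchE !mem_setE/= !in_itv/=.
by case: (leP t x) => tx; case: (leP a t) => at_; case: (leP t b) => tb;
  case: (leP a x) => ax; case: (leP x b) => xb;
  rewrite /= ?mulr0 ?mul0r ?mulr1//; exfalso; lra.
Qed.

Let integral_patch_scale (c d w : R) (f : R -> R) : mu.-integrable `[c, d] (EFin \o f) ->
  (\int[mu]_t (((fun t => w * f t) \_ `[c, d]) t)%:E)%E =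
  (w * \int[mu]_(t in `[c, d]) f t)%:E.
Proof.
move=> jf.
transitivity (\int[mu]_(t in `[c, d]) (w%:E * (f t)%:E))%E.
  rewrite [RHS]integral_mkcond; apply: eq_integral => t _.
  by rewrite !patchE; case: ifP.
rewrite integralZl// EFinM fineK//.
exact: integrable_fin_num jf.
Qed.

(** Integrating the triangle kernel first in [t] gives the integral of [q (u - u a)], first in [x]
    that of [v (p b - p)]; Fubini equates the two. *)
Lemma primitive_integration_by_parts a b u v p q : a <= b ->
  primitive_on a b u v -> primitive_on a b p q ->
  \int[mu]_(x in `[a, b]) (u x * q x) =
  u b * p b - u a * p a - \int[mu]_(x in `[a, b]) (v x * p x).
Proof.
move=> ab uv pq.
have bab : b \in `[a, b] by rewrite in_itv/= lexx ab.
have iK := integrable_triangle_kernel uv.1 pq.1.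
have F1 x : (\int[mu]_t (triangle_kernel a b v q (x, t))%:E)%E =
    ((fun x => q x * (u x - u a)) \_ `[a, b] x)%:E.
  rewrite patchE mem_setE; case: ifPn => xab.
    transitivity (\int[mu]_t (((fun t => q x * v t) \_ `[a, x]) t)%:E)%E.
      by apply: eq_integral => t _; rewrite triangle_kernelE xab mulr1.
    move: (xab); rewrite in_itv/= => /andP[ax xb].
    rewrite integral_patch_scale//; last exact: integrable_sub_itvcc uv.1.
    by rewrite (uv.2 x)// addrAC subrr add0r.
  rewrite -[RHS](@integral0 _ _ _ mu setT); apply: eq_integral => t _.
  by rewrite triangle_kernelE (negbTE xab) mulr0.
have F2 t : (\int[mu]_x (triangle_kernel a b v q (x, t))%:E)%E =
    ((fun t => v t * (p b - p t)) \_ `[a, b] t)%:E.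
  rewrite patchE mem_setE; case: ifPn => tab.
    transitivity (\int[mu]_x (((fun x => v t * q x) \_ `[t, b]) x)%:E)%E.
      by apply: eq_integral => x _; rewrite triangle_kernelE' tab mulr1.
    move: (tab); rewrite in_itv/= => /andP[at_ tb].
    rewrite integral_patch_scale//; last exact: integrable_sub_itvcc pq.1.
    by rewrite (primitive_sub pq).
  rewrite -[RHS](@integral0 _ _ _ mu setT); apply: eq_integral => x _.
  by rewrite triangle_kernelE' (negbTE tab) mulr0.
have := Fubini iK.
rewrite (eq_integral _ _ (fun x _ => F1 x)) (eq_integral _ _ (fun x _ => F2 x)).
have mkc (f : R -> R) : (\int[mu]_x ((f \_ `[a, b]) x)%:E = \int[mu]_(x in `[a, b]) (f x)%:E)%E.
  rewrite [RHS]integral_mkcond; apply: eq_integral => t _.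
  by rewrite !patchE; case: ifP.
rewrite !mkc => /(congr1 fine).
rewrite -!/(Rintegral _ _ _).
have cu := primitive_continuous ab uv; have cp := primitive_continuous ab pq.
have iuq : mu.-integrable `[a, b] (EFin \o (fun x => q x * u x)).
  exact: integrable_mul_continuous pq.1 cu.
have ivp : mu.-integrable `[a, b] (EFin \o (fun x => v x * p x)).
  exact: integrable_mul_continuous uv.1 cp.
have -> : \int[mu]_(x in `[a, b]) (q x * (u x - u a)) =
    \int[mu]_(x in `[a, b]) (- u a * q x + q x * u x).
  by apply: eq_Rintegral => x _; ring.
have -> : \int[mu]_(x in `[a, b]) (v x * (p b - p x)) =
    \int[mu]_(x in `[a, b]) (p b * v x + - 1 * (v x * p x)).
  by apply: eq_Rintegral => x _; ring.
have ivp' : mu.-integrable `[a, b] (EFin \o (fun x => - 1 * (v x * p x))).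
  by exact: integrable_scale.
rewrite (Rintegral_lincomb _ pq.1 iuq) (Rintegral_lincomb _ uv.1 ivp') RintegralZl//.
have -> : \int[mu]_(x in `[a, b]) (u x * q x) = \int[mu]_(x in `[a, b]) (q x * u x).
  by apply: eq_Rintegral => x _; ring.
rewrite -(primitive_sub uv)// -(primitive_sub pq)// => E.
move: E; lra.
Qed.

End integration_by_parts_primitives.

(** * The du Bois-Reymond lemma for continuous functions *)

Section du_bois_reymond.
Variable R : realType.
Local Notation mu := (@lebesgue_measure R).
Implicit Types (f g u v : R -> R) (a b L p q e x y : R).

(** Lets the piecewise quadratic functions below be differentiated at their break points by the same
    estimate as elsewhere. *)
Lemma is_derive_quadratic f x D C :
  (forall h, `|f (x + h) - f x - h * D| <= C * h ^+ 2) -> is_derive x 1 f D.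
Proof.
move=> fC.
have cD : h^-1 *: (f (h *: 1 + x) - f x) @[h --> (0 : R)^'] --> D.
  apply/cvgrPdist_le => e e0.
  have C1 : 0 < `|C| + 1 by rewrite ltr_wpDl.
  exists (e / (`|C| + 1)); first by rewrite /= divr_gt0.
  move=> h /= hd h0; rewrite [h *: 1]mulr1 (addrC h x) distrC.
  rewrite sub0r normrN in hd.
  have -> : h^-1 *: (f (x + h) - f x) - D = h^-1 * (f (x + h) - f x - h * D).
    by rewrite /GRing.scale/=; field.
  rewrite normrM normfV ler_pdivrMl ?normr_gt0//.
  apply: le_trans (fC h) _; rewrite -real_normK ?num_real// expr2 mulrCA.
  rewrite ler_wpM2l// mulrC.
  apply: (@le_trans _ _ (`|h| * (`|C| + 1))).
    by rewrite ler_wpM2l// ler_wpDr// ler_norm.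
  by rewrite -ler_pdivlMr// ltW.
apply: DeriveDef.
  by apply/cvg_ex; exists D.
by apply/cvg_lim => //; exact: Rhausdorff.
Qed.

Let pos x : R := Num.max 0 x.

Let pos_sq_derive c x : is_derive x 1 (fun y => pos (y + c) ^+ 2) (2 * pos (x + c)).
Proof.
apply: (@is_derive_quadratic _ _ _ 1) => h; rewrite mul1r /pos.
rewrite ler_norml; apply/andP.
have [h1|h1] := leP 0 (x + h + c); have [h2|h2] := leP 0 (x + c); split; nra.
Qed.

Let pos_continuous c : continuous (fun x => pos (x + c)).
Proof.
move=> x; apply/cvgrPdist_lt => e e0; exists e => //= y xy.
apply: le_lt_trans xy; rewrite /pos ler_norml.
have := ler_norm (x - y); have := ler_norm (y - x); rewrite (distrC y x).
have [h1|h1] := leP 0 (x + c); have [h2|h2] := leP 0 (y + c) => h3 h4;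
  apply/andP; split; lra.
Qed.

(** Half a second difference of squared positive parts: for [e > 0] a C1 step that rises from 0 to
    [e^2] between [p - e] and [p + e]. Its derivative [hat] is the tent of height [e] on that
    interval. *)
Definition smooth_step p e x : R :=
  (pos (x + (e - p)) ^+ 2 - 2 * pos (x + - p) ^+ 2 + pos (x + (- e - p)) ^+ 2) / 2.

Definition hat p e x : R :=
  pos (x + (e - p)) - 2 * pos (x + - p) + pos (x + (- e - p)).

Lemma smooth_step_derive p e x : is_derive x 1 (smooth_step p e) (hat p e x).
Proof.
have h1 := pos_sq_derive (e - p) x.
have h2 := pos_sq_derive (- p) x.
have h3 := pos_sq_derive (- e - p) x.
have h := @is_deriveM _ _ _ _ _ _ _ _ (is_deriveD (is_deriveB h1
  (is_deriveM (is_derive_cst (2 : R) x 1) h2)) h3) (is_derive_cst (2^-1 : R) x 1).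
apply: is_derive_eq h _; rewrite /hat /GRing.scale/=.
by field.
Qed.

Lemma hat_continuous p e : continuous (hat p e).
Proof.
move=> x; apply: cvgD; last exact: pos_continuous.
apply: cvgB; first exact: pos_continuous.
by apply: cvgM; [exact: cvg_cst|exact: pos_continuous].
Qed.

Lemma hat_ge0 p e x : 0 < e -> 0 <= hat p e x.
Proof.
move=> e0; rewrite /hat /pos.
have [h1|h1] := leP 0 (x + (e - p)); have [h2|h2] := leP 0 (x - p);
  have [h3|h3] := leP 0 (x + (- e - p)); lra.
Qed.

Lemma hat_eq0 p e x : 0 < e -> e <= `|x - p| -> hat p e x = 0.
Proof.
move=> e0; rewrite ler_normr => /orP h; rewrite /hat /pos.
have [h1|h1] := leP 0 (x + (e - p)); have [h2|h2] := leP 0 (x - p);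
  have [h3|h3] := leP 0 (x + (- e - p)); case: h => h; lra.
Qed.

Lemma smooth_step0 p e x : 0 < e -> x <= p - e -> smooth_step p e x = 0.
Proof.
move=> e0 xp; rewrite /smooth_step /pos !max_l; lra.
Qed.

Lemma smooth_step1 p e x : 0 < e -> p + e <= x -> smooth_step p e x = e ^+ 2.
Proof.
move=> e0 xp; rewrite /smooth_step /pos !max_r; lra.
Qed.

Lemma derive1_smooth_step p e : derive1 (smooth_step p e) = hat p e.
Proof. by apply/funext => x; rewrite derive1E; have [_ ->] := smooth_step_derive p e x. Qed.

Lemma smooth_step_primitive L p e : 0 <= L ->
  primitive_on 0 L (smooth_step p e) (hat p e).
Proof.
move=> L0; rewrite -(derive1_smooth_step p e); apply: C1_primitive => //.
  by move=> x; have [] := smooth_step_derive p e x.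
by rewrite derive1_smooth_step; exact: hat_continuous.
Qed.

(** The tent has mass [e^2] and lives within distance [e] of [p], so integrating against it averages
    [g] near [p]. *)
Lemma hat_average L g p d eps : 0 < p < L -> 0 < eps ->
  {within `[0, L], continuous g} -> (forall y, y \in `[0, L] ->
  `|y - p| < d -> `|g y - g p| <= eps) -> forall e, 0 < e -> e <= d ->
  0 < p - e -> p + e < L ->
  `|\int[mu]_(x in `[0, L]) (g x * hat p e x) - g p * e ^+ 2| <= eps * e ^+ 2.
Proof.
move=> /andP[p0 pL] eps0 cg gp e e0 ed pe peL.
have L0 : 0 <= L by lra.
have pr := smooth_step_primitive p e L0.
have ch : {within `[0, L], continuous (hat p e)}.
  by apply: continuous_subspaceT; exact: hat_continuous.
have ih := within_continuous_integrable ch.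
have Ih : \int[mu]_(x in `[0, L]) hat p e x = e ^+ 2.
  have := primitive_sub pr (lexx _) L0 (lexx _).
  by rewrite smooth_step1 ?smooth_step0// ?subr0// ltW.
have igh := integrable_mul_continuous (within_continuous_integrable cg) ch.
have E : \int[mu]_(x in `[0, L]) (g x * hat p e x) - g p * e ^+ 2 =
    \int[mu]_(x in `[0, L]) (- g p * hat p e x + g x * hat p e x).
  by rewrite (Rintegral_lincomb _ ih igh) Ih; ring.
rewrite E -Ih -RintegralZl//.
apply: le_trans (le_normr_Rintegral _ _) _ => //.
  exact: integrable_lincomb ih igh.
apply: le_Rintegral => //.
- by apply: integrable_norm; exact: integrable_lincomb ih igh.
- exact: integrable_scale.
- move=> x /= xL; rewrite -mulrDl addrC normrM (ger0_norm (hat_ge0 _ _ e0)).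
  have [xe|xe] := leP e `|x - p|; first by rewrite hat_eq0// !mulr0.
  by rewrite ler_wpM2r ?hat_ge0// gp// (lt_le_trans xe).
Qed.

(** The difference of the smooth steps at [p] and [q] is a test function whose derivative is the
    difference of the two tents. So [g] has equal averages near any two interior points, hence equal
    values there. *)
Lemma du_bois_reymond_continuous L g : 0 < L -> {within `[0, L], continuous g} ->
  (forall phi, test_function L phi ->
    \int[mu]_(x in `[0, L]) (g x * derive1 phi x) = 0) ->
  forall x, x \in `[0, L] -> g x = g 0.
Proof.
move=> L0 cg g0.
have dist := (within_continuous_distP g 0 L).1 cg.
have oo p q : 0 < p < L -> 0 < q < L -> g p = g q.
  move=> pL qL; apply/eqP; rewrite -subr_eq0 -normr_le0; apply/ler_addgt0Pl => eps eps0.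
  rewrite addr0.
  have e2 : 0 < eps / 2 by rewrite divr_gt0.
  have pc : p \in `[0, L] by rewrite in_itv/=; lra.
  have qc : q \in `[0, L] by rewrite in_itv/=; lra.
  have [d1 d10 d1P] := dist _ pc _ e2.
  have [d2 d20 d2P] := dist _ qc _ e2.
  pose m := Num.min (Num.min d1 d2) (Num.min (Num.min p (L - p)) (Num.min q (L - q))).
  have m0 : 0 < m by rewrite !lt_min d10 d20/=; lra.
  pose e := m / 2.
  have e0 : 0 < e by rewrite divr_gt0.
  have em : e < m by rewrite /e; lra.
  move: em; rewrite !lt_min => /andP[/andP[ed1 ed2] /andP[/andP[ep eLp] /andP[eq_ eLq]]].
  have near_p r d : (forall y, y \in `[0, L] -> `|r - y| < d ->
      `|g r - g y| < eps / 2) -> forall y, y \in `[0, L] ->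
      `|y - r| < d -> `|g y - g r| <= eps / 2.
    by move=> rP y yL yr; rewrite distrC ltW// rP// distrC.
  have pe : 0 < p - e by lra.
  have peL : p + e < L by lra.
  have qe : 0 < q - e by lra.
  have qeL : q + e < L by lra.
  have avp := hat_average pL e2 cg (near_p _ _ d1P) e0 (ltW ed1) pe peL.
  have avq := hat_average qL e2 cg (near_p _ _ d2P) e0 (ltW ed2) qe qeL.
  (* Both steps reach the same height [e^2], so their difference has compact support in the open
     interval. *)
  pose phi x := - 1 * smooth_step q e x + smooth_step p e x.
  have dphi x : is_derive x 1 phi (- 1 * hat q e x + hat p e x).
    have h := is_deriveD (is_deriveM (is_derive_cst (-1 : R) x 1)
      (smooth_step_derive q e x)) (smooth_step_derive p e x).
    by apply: is_derive_eq h _; rewrite /GRing.scale/=; ring.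
  have phi' : derive1 phi = (fun x => - 1 * hat q e x + hat p e x).
    by apply/funext => x; rewrite derive1E; have [_ ->] := dphi x.
  have tphi : test_function L phi.
    split; first by move=> x; have [] := dphi x.
      rewrite phi' => x; apply: cvgD; last exact: hat_continuous.
      by apply: cvgM; [exact: cvg_cst|exact: hat_continuous].
    exists (Num.min (p - e) (q - e)), (Num.max (p + e) (q + e)); split.
    - by rewrite lt_min pe qe.
    - by rewrite gt_max peL qeL.
    - move=> x; rewrite in_itv/= negb_and -!ltNge lt_min gt_max /phi.
      case/orP => /andP[h1 h2].
        by rewrite !smooth_step0 ?ltW// mulr0 addr0.
      by rewrite !smooth_step1 ?ltW//; ring.
  have ch r : {within `[0, L], continuous (hat r e)}.
    by apply: continuous_subspaceT; exact: hat_continuous.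
  have igh r : mu.-integrable `[0, L] (EFin \o (fun x => g x * hat r e x)).
    exact: integrable_mul_continuous (within_continuous_integrable cg) (ch r).
  have := g0 _ tphi; rewrite phi'.
  have -> : \int[mu]_(x in `[0, L]) (g x * (- 1 * hat q e x + hat p e x)) =
     \int[mu]_(x in `[0, L]) (- 1 * (g x * hat q e x) + g x * hat p e x).
    by apply: eq_Rintegral => x _; ring.
  rewrite (Rintegral_lincomb _ (igh q) (igh p)) => E.
  have ee : 0 < e ^+ 2 by rewrite exprn_gt0.
  rewrite -(ler_pM2r ee) -[X in `|_| * X](gtr0_norm ee) -normrM.
  move: avp avq E; set A := Rintegral _ _ _; set B := Rintegral _ _ _.
  rewrite !ler_norml => /andP[a1 a2] /andP[b1 b2] E.
  by apply/andP; split; lra.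
have gc : {in `[0, L], g =1 fun=> g (L / 2)}.
  apply: within_continuous_oo_eq => //.
    by apply: continuous_subspaceT => x; exact: cvg_cst.
  by move=> x; rewrite in_itv/= => xL; apply: oo => //; lra.
by move=> x xL; rewrite !gc// left_in_itvcc.
Qed.

End du_bois_reymond.

(** * Primitives, almost everywhere derivatives and weak derivatives *)

Section primitives_ae.
Variable R : realType.
Local Notation mu := (@lebesgue_measure R).
Implicit Types (f g u v : R -> R) (a b L p q e x y : R).

Lemma integrable_locally_restrict a b f : mu.-integrable `[a, b] (EFin \o f) ->
  locally_integrable setT (f \_ `[a, b]).
Proof. by apply: integrable_locally; exact: measurable_itv. Qed.

Lemma primitive_derive_ae a b u v : primitive_on a b u v ->
  {ae mu, forall x, x \in `]a, b[ -> is_derive x 1 u (v x)}.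
Proof.
move=> uv; have := lebesgue_differentiation (integrable_locally_restrict uv.1).
apply: filterS; first exact: (ae_filter_ringOfSetsType mu).
move=> x lx xab; move: (xab); rewrite in_itv/= => /andP[ax xb].
(* Extended by zero, [v] is locally integrable on the line, the setting of Lebesgue differentiation;
   nothing changes at interior points. *)
pose v0 := v \_ `[a, b].
have v0E y : y \in `[a, b] -> v0 y = v y.
  by move=> yab; rewrite /v0 patchE mem_setE yab.
have xab' : x \in `[a, b] by rewrite in_itv/= !ltW.
have iv0 : mu.-integrable `[a, b] (EFin \o v0).
  apply: eq_integrable uv.1 => // y; rewrite mem_setE => yab.
  by rewrite /= v0E.
have axb : (BLeft a < BRight x)%E by rewrite lte_fin.
have [dF F'] := FTC1_lebesgue_pt xb iv0 axb lx.
have uE y : y \in `[a, b] -> u y = u a + \int[mu]_(t in `[a, y]) v0 t.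
  move=> yab; rewrite uv.2//; congr (_ + _); apply: eq_Rintegral => t.
  move: yab; rewrite mem_setE !in_itv/= => /andP[ay yb] /andP[at_ ty].
  by rewrite v0E// in_itv/= at_ (le_trans ty).
rewrite -(v0E _ xab').
have dF' : is_derive x 1 (fun y => \int[mu]_(t in `[a, y]) v0 t) (v0 x).
  by apply: DeriveDef; [exact: dF|rewrite -derive1E; exact: F'].
have h := is_deriveD (is_derive_cst (u a) x 1) dF'; rewrite add0r in h.
apply: near_eq_is_derive h.
have := near_in_itvoo xab; apply: filterS => y yab.
by rewrite (uE y)//; apply: subset_itv_oo_cc yab.
Qed.

Lemma primitive_unique_ae a b u v w : primitive_on a b u v ->
  primitive_on a b u w -> {ae mu, forall x, x \in `[a, b] -> v x = w x}.
Proof.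
move=> uv uw; apply: ae_eq_itvoo_cc.
have := primitive_derive_ae uw; have := primitive_derive_ae uv.
apply: filterS2; first exact: (ae_filter_ringOfSetsType mu).
by move=> x h1 h2 xab; have [_ <-] := h1 xab; have [_ <-] := h2 xab.
Qed.

Lemma test_function_primitive L phi : 0 < L -> test_function L phi ->
  [/\ primitive_on 0 L phi (derive1 phi), phi 0 = 0 & phi L = 0].
Proof.
move=> L0 [d c [a [b [a0 bL ab0]]]]; split.
- exact: (C1_primitive (ltW L0) d c).
- by apply: ab0; rewrite in_itv/= leNgt a0.
- by apply: ab0; rewrite in_itv/= negb_and -!ltNge bL orbT.
Qed.

Lemma primitive_weak_derivative L u v : 0 < L -> primitive_on 0 L u v ->
  forall phi, test_function L phi ->
  \int[mu]_(x in `[0, L]) (u x * derive1 phi x) =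
  - \int[mu]_(x in `[0, L]) (v x * phi x).
Proof.
move=> L0 uv phi /(test_function_primitive L0)[pp p0 pL].
rewrite (primitive_integration_by_parts (ltW L0) uv pp) p0 pL; ring.
Qed.

(** Subtracting the primitive of [v] from [u] leaves a continuous function with vanishing weak
    derivative, which is constant. *)
Lemma weak_derivative_primitive L u v : 0 < L ->
  {within `[0, L], continuous u} -> mu.-integrable `[0, L] (EFin \o v) ->
  (forall phi, test_function L phi ->
    \int[mu]_(x in `[0, L]) (u x * derive1 phi x) =
    - \int[mu]_(x in `[0, L]) (v x * phi x)) ->
  primitive_on 0 L u v.
Proof.
move=> L0 cu iv uv; split=> // x xL.
pose U y := \int[mu]_(t in `[0, y]) v t.
have U0 : U 0 = 0 by rewrite /U set_itv1 Rintegral_set1.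
have Uv : primitive_on 0 L U v by split => // y _; rewrite U0 add0r.
have cU := primitive_continuous (ltW L0) Uv.
have cg : {within `[0, L], continuous (fun y => - 1 * U y + u y)}.
  move=> y; apply: cvgD; last exact: cu.
  by apply: cvgM; [exact: cvg_cst|exact: cU].
have := du_bois_reymond_continuous L0 cg _ xL; rewrite U0 mulr0 add0r => <-.
  by rewrite /U; ring.
move=> phi tphi; have [pp _ _] := test_function_primitive L0 tphi.
have cphi' : {within `[0, L], continuous (derive1 phi)}.
  by apply: continuous_subspaceT; case: tphi.
have i1 := integrable_mul_continuous (within_continuous_integrable cu) cphi'.
have i2 := integrable_mul_continuous (within_continuous_integrable cU) cphi'.
have -> : \int[mu]_(x in `[0, L]) ((- 1 * U x + u x) * derive1 phi x) =
    \int[mu]_(x in `[0, L]) (- 1 * (U x * derive1 phi x) + u x * derive1 phi x).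
  by apply: eq_Rintegral => y _; ring.
rewrite (Rintegral_lincomb _ i2 i1) uv// (primitive_weak_derivative L0 Uv)//.
by ring.
Qed.

End primitives_ae.

(** * Square integrable functions *)

Section square_integrable.
Variables (R : realType) (a b : R).
Local Notation mu := (@lebesgue_measure R).
Local Notation I := (`[a, b]%classic : set R).
Implicit Types (f g h : R -> R) (e x y : R).

Definition sq_integrable f : Prop :=
  measurable_fun I f /\ mu.-integrable I (EFin \o (fun x => f x ^+ 2)).

Let mI : measurable (I : set (measurableTypeR R)).
Proof. exact: measurable_itv. Qed.

Lemma integrable_dominated f g : measurable_fun I f ->
  mu.-integrable I (EFin \o g) -> (forall x, `|f x| <= g x) ->
  mu.-integrable I (EFin \o f).
Proof.
move=> mf ig fg; apply: le_integrable ig => //; first exact/measurable_EFinP.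
by move=> x _ /=; rewrite lee_fin; apply: le_trans (fg x) (ler_norm _).
Qed.

Lemma sq_integrable_mul f g : sq_integrable f -> sq_integrable g ->
  mu.-integrable I (EFin \o (fun x => f x * g x)).
Proof.
move=> [mf f2] [mg g2].
apply: (@integrable_dominated _ (fun x => 1 * f x ^+ 2 + g x ^+ 2)).
- exact: measurable_funM.
- exact: integrable_lincomb.
- move=> x; rewrite ler_norml mul1r; apply/andP.
  have := sqr_ge0 (f x + g x); have := sqr_ge0 (f x - g x).
  have := sqr_ge0 (f x); have := sqr_ge0 (g x).
  rewrite !expr2 => *; split; nra.
Qed.

Lemma sq_integrable_continuous f : {within I, continuous f} -> sq_integrable f.
Proof.
move=> cf; split; first exact: within_continuous_measurable.
rewrite (_ : (fun x => f x ^+ 2) = (fun x => f x * f x)).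
  by apply: within_continuous_integrable => x; apply: cvgM; exact: cf.
by apply/funext => x; rewrite expr2.
Qed.

Lemma sq_integrable_cst c : sq_integrable (fun=> c).
Proof.
by apply: sq_integrable_continuous; apply: continuous_subspaceT => x; exact: cvg_cst.
Qed.

Lemma sq_integrable_integrable f : sq_integrable f -> mu.-integrable I (EFin \o f).
Proof.
move=> sf; have := sq_integrable_mul sf (sq_integrable_cst 1).
by apply: eq_integrable => // x _ /=; rewrite mulr1.
Qed.

Lemma sq_integrable_lincomb (k : R) f g : sq_integrable f -> sq_integrable g ->
  sq_integrable (fun x => k * f x + g x).
Proof.
move=> sf sg; have [mf f2] := sf; have [mg g2] := sg; split.
  by apply: measurable_funD => //; apply: measurable_funM.
have h := integrable_lincomb (k ^+ 2) f2
  (integrable_lincomb (2 * k) (sq_integrable_mul sf sg) g2).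
by apply: eq_integrable h => // x _ /=; congr EFin; ring.
Qed.

Lemma sq_integrable_sub f g : sq_integrable f -> sq_integrable g ->
  sq_integrable (fun x => f x - g x).
Proof.
move=> sf sg; have [m i] := sq_integrable_lincomb (-1) sg sf.
have E : (fun x => f x - g x) = (fun x => - 1 * g x + f x).
  by apply/funext => x; ring.
by rewrite E; split.
Qed.

Lemma sq_integrable_ae f g : sq_integrable f -> measurable_fun I g ->
  {ae mu, forall x, x \in `[a, b] -> f x = g x} -> sq_integrable g.
Proof.
move=> [mf f2] mg fg; split => //.
apply: ae_eq_integrable f2; last exact: measurable_funX.
apply: filterS fg; first exact: (ae_filter_ringOfSetsType mu).
by move=> x h /h ->.
Qed.

Lemma Rintegral_cauchy_schwarz f g : sq_integrable f -> sq_integrable g ->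
  (\int[mu]_(x in I) (f x * g x)) ^+ 2 <=
  \int[mu]_(x in I) (f x ^+ 2) * \int[mu]_(x in I) (g x ^+ 2).
Proof.
move=> sf sg.
have := @ip_cauchy_schwarz R (R -> R^o : lmodType R) sq_integrable
  (fun f g => \int[mu]_(x in I) (f x * g x)).
have sqE h : \int[mu]_(x in I) (h x * h x) = \int[mu]_(x in I) (h x ^+ 2).
  by apply: eq_Rintegral => x _; rewrite expr2.
rewrite -!sqE; apply => //.
- exact: sq_integrable_cst.
- by move=> k u v su sv; exact: sq_integrable_lincomb.
- by move=> u v _ _; apply: eq_Rintegral => x _; rewrite mulrC.
- move=> k u v w su sv sw.
  rewrite -(Rintegral_lincomb _ (sq_integrable_mul su sw) (sq_integrable_mul sv sw)).
  apply: eq_Rintegral => x _.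
  by have -> : (k *: u + v) x = k * u x + v x by []; ring.
- by move=> u _; apply: Rintegral_ge0 => x _; rewrite -expr2 sqr_ge0.
Qed.

Lemma sq_Rintegral_le f : a <= b -> sq_integrable f ->
  (\int[mu]_(x in I) f x) ^+ 2 <= (b - a) * \int[mu]_(x in I) (f x ^+ 2).
Proof.
move=> ab sf; have := Rintegral_cauchy_schwarz (sq_integrable_cst 1) sf.
under eq_Rintegral do rewrite mul1r.
by rewrite Rintegral_itv_cst// expr1n mulr1.
Qed.

End square_integrable.

(** * Completeness of L2 on an interval *)

Section L2_complete.
Variables (R : realType) (a b : R).
Hypothesis ab : a <= b.
Local Notation mu := (@lebesgue_measure R).
Local Notation I := (`[a, b]%classic : set R).
Implicit Types (f g h : R -> R) (e x y : R).

Let mI : measurable (I : set (measurableTypeR R)).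
Proof. exact: measurable_itv. Qed.

Lemma integral_sq_integrable f : sq_integrable a b f ->
  (\int[mu]_(x in I) (f x ^+ 2)%:E)%E = (\int[mu]_(x in I) (f x ^+ 2))%:E.
Proof.
by move=> [_ f2]; rewrite /Rintegral fineK//; exact: integrable_fin_num f2.
Qed.

Let norm_le f (e : R) : 0 <= e -> sq_integrable a b f ->
  \int[mu]_(x in I) (f x ^+ 2) <= e ^+ 2 ->
  (\int[mu]_(x in I) `|f x|%:E <= (Num.sqrt (b - a) * e)%:E)%E.
Proof.
move=> e0 sf fe.
have sn : sq_integrable a b (fun x => `|f x|).
  case: sf => mf f2; split; first exact: measurableT_comp.
  by apply: eq_integrable f2 => // x _ /=; rewrite real_normK// num_real.
have i0 : 0 <= \int[mu]_(x in I) `|f x| by apply: Rintegral_ge0.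
have := integrable_fin_num mI (sq_integrable_integrable sn).
move=> /fineK <-; rewrite lee_fin -/(Rintegral _ _ _).
rewrite -(@ler_pXn2r _ 2)// ?nnegrE// ?mulr_ge0 ?sqrtr_ge0//.
apply: le_trans (sq_Rintegral_le ab sn) _.
rewrite exprMn sqr_sqrtr ?subr_ge0// ler_wpM2l ?subr_ge0//.
by under eq_Rintegral do rewrite real_normK ?num_real//.
Qed.

Section fast_sequence.
Variable g : nat -> R -> R.
Hypothesis sg : forall k, sq_integrable a b (g k).
Hypothesis fast : forall k,
  \int[mu]_(x in I) ((g k.+1 x - g k x) ^+ 2) <= ((2^-1) ^+ k) ^+ 2.

Let mg k : measurable_fun I (g k).
Proof. by have [] := sg k. Qed.

(** By Cauchy-Schwarz the increments have L1 norms at most [sqrt (b - a) 2^-k], so the sum of their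
    absolute values is integrable and therefore finite almost everywhere. *)
Lemma fast_cauchy_cvg_ae : {ae mu, forall x, x \in `[a, b] -> cvgn (fun k => g k x)}.
Proof.
pose d k x := (`|g k.+1 x - g k x|%:E : \bar R).
have md k : measurable_fun I (d k).
  by apply/measurable_EFinP; apply: measurableT_comp => //; exact: measurable_funB.
have d0 k x : I x -> (0 <= d k x)%E by move=> _; rewrite lee_fin.
have Id : (\int[mu]_(x in I) (\sum_(k <oo) d k x) <= (Num.sqrt (b - a) * 2)%:E)%E.
  rewrite integral_nneseries//.
  apply: (@le_trans _ _ (\sum_(k <oo) (Num.sqrt (b - a) * (2^-1) ^+ k)%:E)%E).
    apply: lee_nneseries => [k *|k *]; first by apply: integral_ge0 => x xI; exact: d0.
    apply: norm_le; last exact: fast.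
    - by rewrite exprn_ge0.
    - exact: sq_integrable_sub.
  apply: lime_le.
    by apply: is_cvg_nneseries => k _ _; rewrite lee_fin mulr_ge0 ?sqrtr_ge0.
  apply: nearW => n; rewrite sumEFin lee_fin -mulr_sumr ler_wpM2l ?sqrtr_ge0//.
  have -> : \sum_(0 <= k < n) (2^-1 : R) ^+ k = 2 * (1 - (2^-1) ^+ n).
    elim: n => [|n IHn]; first by rewrite big_geq// expr0 subrr mulr0.
    by rewrite big_nat_recr//= IHn exprS; field.
  by rewrite ger_pMr// gerBl.
have mS : measurable_fun I (fun x => \sum_(k <oo) d k x)%E.
  by apply: ge0_emeasurable_sum => // k x xI _; exact: d0.
have iS : mu.-integrable I (fun x => \sum_(k <oo) d k x)%E.
  apply/integrableP; split=> //.
  under eq_integral => x xI.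
    rewrite gee0_abs; last by apply: nneseries_ge0 => k _ _; apply: d0; exact: set_mem.
    over.
  by apply: le_lt_trans Id _; rewrite ltry.
have Sae : {ae mu, forall x, I x -> (\sum_(k <oo) d k x)%E \is a fin_num}.
  by have [N [mN N0 sN]] := integrable_ae mI iS; exists N; split=> // x h; apply: sN.
apply: filterS Sae; first exact: (ae_filter_ringOfSetsType mu).
move=> x Sx xab; have {}Sx := Sx xab.
have Dc : cvgn [normed series (fun k => g k.+1 x - g k x)].
  apply: nondecreasing_is_cvgn.
    by apply: nondecreasing_series => k _; rewrite normr_ge0.
  exists (fine (\sum_(k <oo) d k x)%E) => _ [n _ <-].
  rewrite -lee_fin fineK//= -sumEFin.
  by apply: (@nneseries_lim_ge R (d ^~ x) xpredT 0%N n) => k *; exact: d0.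
have -> : (fun k => g k x) = (fun n => g 0%N x + series (telescope (fun k => g k x)) n).
  by apply/funext => n; exact: eq_sum_telescope.
apply: is_cvgD; first exact: is_cvg_cst.
exact: normed_cvg.
Qed.

End fast_sequence.

(** Riesz-Fischer. A fast subsequence converges almost everywhere to [g], and Fatou transfers the
    Cauchy estimate to the distance of [g] from every late [f m], so the whole sequence
    converges. *)
Lemma L2_complete (f : nat -> R -> R) : (forall k, sq_integrable a b (f k)) ->
  (forall e, 0 < e -> exists N, forall m n, (N <= m)%N -> (N <= n)%N ->
    \int[mu]_(x in I) ((f m x - f n x) ^+ 2) < e) ->
  exists2 g, sq_integrable a b g &
    \int[mu]_(x in I) ((f k x - g x) ^+ 2) @[k --> \oo] --> (0 : R).
Proof.
move=> sf cf.
have ex k : exists N, forall m n, (N <= m)%N -> (N <= n)%N ->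
    \int[mu]_(x in I) ((f m x - f n x) ^+ 2) < ((2^-1) ^+ k) ^+ 2.
  by apply: cf; rewrite !exprn_gt0.
have {ex}[N NP] := choice ex.
pose fix phi k := if k is k'.+1 then maxn (phi k').+1 (N k) else N 0%N.
have phiN k : (N k <= phi k)%N by case: k => //= k; exact: leq_maxr.
have phiS k : (phi k < phi k.+1)%N by exact: leq_maxl.
have hphi : {homo phi : m n / (m < n)%N}.
  by apply: homo_ltn => [? ? ?|n]; [exact: ltn_trans|exact: phiS].
have fast k : \int[mu]_(x in I) ((f (phi k.+1) x - f (phi k) x) ^+ 2) <=
    ((2^-1) ^+ k) ^+ 2.
  apply/ltW/NP; last exact: phiN.
  exact: leq_trans (phiN k) (ltnW (phiS k)).
have cae := fast_cauchy_cvg_ae (fun k => sf (phi k)) fast.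
(* An upper limit is defined and measurable without a case distinction; its values where the
   subsequence diverges do not matter. *)
pose g x := fine (limn_esup (fun k => (f (phi k) x)%:E)).
have mg : measurable_fun I g.
  apply: measurableT_comp => //; apply: measurable_fun_limn_esup => k.
  by apply/measurable_EFinP; case: (sf (phi k)).
have fg : {ae mu, forall x, x \in `[a, b] -> f (phi k) x @[k --> \oo] --> g x}.
  apply: filterS cae; first exact: (ae_filter_ringOfSetsType mu).
  move=> x h /h /cvg_ex[l fl].
  rewrite /g; have -> : limn_esup (fun k => (f (phi k) x)%:E) = l%:E.
    apply: (cvg_limn_einf_sup _).2; apply: cvg_EFin => //.
    exact: nearW.
  exact: fl.
have fatou_le m (e : R) : (forall k, (m <= k)%N ->
    \int[mu]_(x in I) ((f (phi k) x - f m x) ^+ 2) <= e) ->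
    (\int[mu]_(x in I) ((g x - f m x) ^+ 2)%:E <= e%:E)%E.
  move=> fe.
  (* Fatou is applied to the tail starting at [m], since the bound [e] is assumed only from there
     on. *)
  pose h k x := ((f (phi (m + k)%N) x - f m x) ^+ 2)%:E : \bar R.
  have mh k : measurable_fun I (h k).
    apply/measurable_EFinP; apply: measurable_funX; apply: measurable_funB.
      by case: (sf (phi (m + k)%N)).
    by case: (sf m).
  have h0 k x : I x -> (0 <= h k x)%E by move=> _; rewrite lee_fin sqr_ge0.
  have <- : (\int[mu]_(x in I) limn_einf (h^~ x) =
      \int[mu]_(x in I) ((g x - f m x) ^+ 2)%:E)%E.
    apply: ae_eq_integral => //.
    - apply: (@measurableT_comp _ _ _ _ _ _ (fun x : \bar R => (- x)%E)).
        exact: oppe_measurable.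
      apply: measurable_fun_limn_esup => k.
      apply: (@measurableT_comp _ _ _ _ _ _ (fun x : \bar R => (- x)%E)).
        exact: oppe_measurable.
      exact: mh.
    - apply/measurable_EFinP; apply: measurable_funX; apply: measurable_funB => //.
      by case: (sf m).
    - apply: filterS fg; first exact: (ae_filter_ringOfSetsType mu).
      move=> x /= fx xI; apply: (cvg_limn_einf_sup _).1.
      apply: cvg_EFin; first exact: nearW.
      have fx' : f (phi (m + k)%N) x @[k --> \oo] --> g x.
        have := fx xI; rewrite -(cvg_shiftn m); under eq_fun do rewrite addnC.
        exact.
      rewrite /comp/= expr2; under eq_fun do rewrite expr2.
      by apply: cvgM; apply: cvgB => //; exact: cvg_cst.
  apply: le_trans (fatou mu mI mh h0) _.
  rewrite limn_einf_lim; apply: lime_le; first exact: is_cvg_einfs.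
  apply: nearW => k; apply: (@le_trans _ _ (\int[mu]_(x in I) h k x)%E).
    by apply: ereal_inf_lbound; exists k => //=.
  have := @integral_sq_integrable (fun x => f (phi (m + k)%N) x - f m x).
  rewrite /h => ->; last exact: sq_integrable_sub.
  by rewrite lee_fin fe// leq_addr.
have close e : 0 < e -> exists M, forall m, (M <= m)%N ->
    (\int[mu]_(x in I) ((g x - f m x) ^+ 2)%:E <= e%:E)%E.
  move=> e0; have [M MP] := cf e e0; exists M => m Mm.
  apply: fatou_le => k mk; apply/ltW/MP => //.
  exact: leq_trans (leq_trans Mm mk) (leq_subseq hphi k).
have sgf m (e : R) : (\int[mu]_(x in I) ((g x - f m x) ^+ 2)%:E <= e%:E)%E ->
    sq_integrable a b (fun x => g x - f m x).
  move=> le; have mgf : measurable_fun I (fun x => g x - f m x).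
    by apply: measurable_funB => //; case: (sf m).
  split=> //; apply/integrableP; split.
    by apply/measurable_EFinP; exact: measurable_funX.
  apply: le_lt_trans (ltry e); apply: le_trans le.
  rewrite le_eqVlt; apply/orP; left; apply/eqP; apply: eq_integral => x _ /=.
  by rewrite ger0_norm ?sqr_ge0.
have sg : sq_integrable a b g.
  have [M MP] := close 1 ltr01.
  have := sq_integrable_lincomb 1 (sf M) (sgf M _ (MP M (leqnn M))).
  by rewrite (_ : (fun x => _) = g)//; apply/funext => x; ring.
exists g => //; apply/cvgn_distP => e e0.
have e2 : 0 < e / 2 by rewrite divr_gt0.
have [M MP] := close _ e2; exists M => m Mm.
have s := sgf m _ (MP m Mm).
have := MP m Mm; rewrite (integral_sq_integrable s) lee_fin subr0 => h.
have -> : \int[mu]_(x in I) (f m x - g x) ^+ 2 = \int[mu]_(x in I) (g x - f m x) ^+ 2.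
  by apply: eq_Rintegral => x _; ring.
rewrite ger0_norm; last by apply: Rintegral_ge0 => x _; exact: sqr_ge0.
by apply: le_lt_trans h _; rewrite ltr_pdivrMr// ltr_pMr// ltr1n.
Qed.

End L2_complete.

(** * Curves in H2 *)

Section primitive_bounds.
Variables (R : realType) (L : R).
Hypothesis L0 : 0 < L.
Local Notation mu := (@lebesgue_measure R).
Implicit Types (f g h : R -> R) (e x y : R).

Lemma Rintegral_sq_ge0 a b f : 0 <= \int[mu]_(x in `[a, b]) (f x ^+ 2).
Proof. by apply: Rintegral_ge0 => x _; exact: sqr_ge0. Qed.

Lemma Rintegral_sq_sub f a b c d : a <= c -> c <= d -> d <= b ->
  sq_integrable a b f ->
  \int[mu]_(x in `[c, d]) (f x ^+ 2) <= \int[mu]_(x in `[a, b]) (f x ^+ 2).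
Proof.
move=> ac cd db [_ f2].
have i1 := integrable_sub_itvcc ac (lexx b) f2.
rewrite (@Rintegral_cat _ a b c _ ac (le_trans cd db) f2).
rewrite (@Rintegral_cat _ c b d _ cd db i1).
by have := Rintegral_sq_ge0 a c f; have := Rintegral_sq_ge0 d b f; lra.
Qed.

Lemma sq_integrable_sub_itvcc f a b c d : a <= c -> d <= b ->
  sq_integrable a b f -> sq_integrable c d f.
Proof.
move=> ac db [mf f2]; split; last exact: integrable_sub_itvcc f2.
by apply: measurable_funS mf => //; exact: sub_itvcc.
Qed.

Lemma primitive_holder f g x y : primitive_on 0 L f g -> sq_integrable 0 L g ->
  x \in `[0, L] -> y \in `[0, L] ->
  (f x - f y) ^+ 2 <= `|x - y| * \int[mu]_(t in `[0, L]) (g t ^+ 2).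
Proof.
move=> fg sg; wlog xy : x y / x <= y => [hw xL yL|].
  have [xy|/ltW xy] := leP x y; first exact: hw.
  have -> : (f x - f y) ^+ 2 = (f y - f x) ^+ 2 by ring.
  by rewrite distrC; exact: hw.
rewrite !in_itv/= => /andP[x0 xL] /andP[y0 yL].
have -> : (f x - f y) ^+ 2 = (f y - f x) ^+ 2 by ring.
rewrite (primitive_sub fg)//.
apply: le_trans (sq_Rintegral_le xy (sq_integrable_sub_itvcc x0 yL sg)) _.
rewrite distrC ger0_norm ?subr_ge0// ler_wpM2l ?subr_ge0//.
exact: Rintegral_sq_sub.
Qed.

Lemma primitive_dist f g x y : primitive_on 0 L f g -> sq_integrable 0 L g ->
  x \in `[0, L] -> y \in `[0, L] ->
  (f x - f y) ^+ 2 <= L * \int[mu]_(t in `[0, L]) (g t ^+ 2).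
Proof.
move=> fg sg xL yL; apply: le_trans (primitive_holder fg sg xL yL) _.
rewrite ler_wpM2r ?Rintegral_sq_ge0//; move: xL yL; rewrite !in_itv/=.
by move=> /andP[? ?] /andP[? ?]; rewrite ler_norml; apply/andP; split; lra.
Qed.

Let Rint_cst c : \int[mu]_(x in `[0, L]) c = L * c.
Proof. by rewrite Rintegral_itv_cst ?ltW// subr0. Qed.

Let icst c : mu.-integrable `[0, L] (EFin \o (fun=> c)).
Proof. by apply: sq_integrable_integrable; exact: sq_integrable_cst. Qed.

Lemma primitive_L2_bound f g : primitive_on 0 L f g -> sq_integrable 0 L g ->
  \int[mu]_(t in `[0, L]) (f t ^+ 2) <=
  2 * L * f 0 ^+ 2 + 2 * L ^+ 2 * \int[mu]_(t in `[0, L]) (g t ^+ 2).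
Proof.
set G := (X in _ -> _ -> _ <= _ + _ * X) => fg sg.
have sf : sq_integrable 0 L f.
  by apply: sq_integrable_continuous; exact: primitive_continuous (ltW L0) fg.
have -> : 2 * L * f 0 ^+ 2 + 2 * L ^+ 2 * G =
    \int[mu]_(t in `[0, L]) (2 * f 0 ^+ 2 + 2 * L * G) by rewrite Rint_cst; ring.
apply: le_Rintegral => //; first exact: sf.2.
move=> x xL; have := primitive_dist fg sg xL (left_in_itvcc L0); rewrite -/G.
(* This square is the slack in [f x^2 <= 2 f 0^2 + 2 (f x - f 0)^2]. *)
have := sqr_ge0 (f x - 2 * f 0); rewrite !expr2; nra.
Qed.

Lemma primitive_point_bound f g x : primitive_on 0 L f g -> sq_integrable 0 L g ->
  x \in `[0, L] ->
  L * f x ^+ 2 <= 2 * \int[mu]_(t in `[0, L]) (f t ^+ 2) +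
    2 * L ^+ 2 * \int[mu]_(t in `[0, L]) (g t ^+ 2).
Proof.
set G := (X in _ -> _ -> _ -> _ <= _ + 2 * L ^+ 2 * X) => fg sg xL.
have sf : sq_integrable 0 L f.
  by apply: sq_integrable_continuous; exact: primitive_continuous (ltW L0) fg.
have -> : 2 * \int[mu]_(t in `[0, L]) (f t ^+ 2) + 2 * L ^+ 2 * G =
    \int[mu]_(t in `[0, L]) (2 * f t ^+ 2 + 2 * L * G).
  by rewrite (Rintegral_lincomb _ sf.2 (icst _)) Rint_cst; ring.
rewrite -Rint_cst; apply: le_Rintegral => //.
  exact: integrable_lincomb sf.2 (icst _).
move=> t tL; have := primitive_dist fg sg xL tL; rewrite -/G.
have := sqr_ge0 (f x - 2 * f t); rewrite !expr2; nra.
Qed.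

End primitive_bounds.

Section H2_triples.
Variables (R : realType) (L : R).
Hypothesis L0 : 0 < L.
Local Notation mu := (@lebesgue_measure R).
Local Notation curve := (R -> 'rV[R]_3).
Implicit Types (u v w : curve).

Lemma row_entry_le_norm n (M : 'rV[R]_n) i : `|M 0 i| <= `|M|.
Proof. by rewrite [`|M|]mx_normrE; exact: (le_bigmax _ _ (0, i)). Qed.

Lemma within_continuous_rowP (A : set R) u : {within A, continuous u} <->
  forall i, {within A, continuous (fun x => u x 0 i)}.
Proof.
split=> [cu i x|cu x]; apply/cvgrPdist_lt => e e0.
  have /cvgrPdist_lt /(_ e e0) := cu x; apply: filterS => t.
  by apply: le_lt_trans; have := row_entry_le_norm (u x - u t) i; rewrite !mxE.
have h i : \forall t \near nbhs (x : subspace A), `|u x 0 i - u t 0 i| < e.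
  by have /cvgrPdist_lt := cu i x; exact.
apply: filterS (@filter_forall _ _ _ _ _ h) => t ht.
rewrite [`|_|]mx_normrE; apply: bigmax_lt => // -[i j] _ /=.
by rewrite !mxE !ord1; exact: ht.
Qed.

(** Describes H2 without weak derivatives or choice: [v] and [w] stand for [u'] and [u'']. The
    conditions are componentwise so that the scalar lemmas apply. *)
Definition H2_triple u v w : Prop := forall i,
  [/\ primitive_on 0 L (fun x => u x 0 i) (fun x => v x 0 i),
      primitive_on 0 L (fun x => v x 0 i) (fun x => w x 0 i)
    & sq_integrable 0 L (fun x => w x 0 i)].

Lemma D1P u : H2 L u -> weak_derivative L u (D1 L u) /\ sobolev L 1 (D1 L u).
Proof.
move=> [_ [_ [v vP]]].
exact: (@xgetPex _ _ [set v | weak_derivative L u v /\ sobolev L 1 v]) (ex_intro _ v vP).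
Qed.

Lemma D2P u : H2 L u -> weak_derivative L (D1 L u) (D2 L u) /\ L2 L (D2 L u).
Proof.
move=> /D1P[_ [_ [_ [w wP]]]].
have [? [? _]] := @xgetPex _ (fun=> 0) [set v | weak_derivative L (D1 L u) v /\ sobolev L 0 v] (ex_intro _ w wP).
by [].
Qed.

Lemma sobolev1_triple u v : weak_derivative L u v ->
  {within `[0, L], continuous u} -> L2 L v ->
  forall i, primitive_on 0 L (fun x => u x 0 i) (fun x => v x 0 i).
Proof.
move=> uv /within_continuous_rowP cu sv i; apply: weak_derivative_primitive => //.
  exact: sq_integrable_integrable (sv i).
exact: uv.
Qed.

Lemma H2_tripleP u : H2 L u -> H2_triple u (D1 L u) (D2 L u).
Proof.
move=> Hu; have [w1 [s1 [c1 _]]] := D1P Hu; have [w2 s2] := D2P Hu.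
have [_ [cu _]] := Hu.
by move=> i; split; [exact: sobolev1_triple|exact: sobolev1_triple|exact: s2].
Qed.

(** The means of computing the chosen derivatives. The first is determined everywhere on the
    interval, since continuous functions that agree almost everywhere coincide; the second only up
    to a null set, by uniqueness of the integrand of a primitive. *)
Lemma triple_H2 u v w : H2_triple u v w ->
  [/\ H2 L u, forall x, x \in `[0, L] -> D1 L u x = v x
    & forall i, {ae mu, forall x, x \in `[0, L] -> D2 L u x 0 i = w x 0 i}].
Proof.
move=> T.
have cu i : {within `[0, L], continuous (fun x => u x 0 i)}.
  by have [+ _ _] := T i; exact/primitive_continuous/ltW.
have cv i : {within `[0, L], continuous (fun x => v x 0 i)}.
  by have [_ + _] := T i; exact/primitive_continuous/ltW.
have wuv : weak_derivative L u v.
  by move=> i phi tphi; have [uv _ _] := T i; exact: primitive_weak_derivative.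
have wvw : weak_derivative L v w.
  by move=> i phi tphi; have [_ vw _] := T i; exact: primitive_weak_derivative.
have su : L2 L u by move=> i; exact: sq_integrable_continuous (cu i).
have sv : L2 L v by move=> i; exact: sq_integrable_continuous (cv i).
have sw : L2 L w by move=> i; have [_ _ +] := T i.
have Hu : H2 L u.
  split=> //; split; first exact/within_continuous_rowP.
  exists v; split=> //; split=> //; split; first exact/within_continuous_rowP.
  by exists w.
have T' := H2_tripleP Hu.
have E1 x : x \in `[0, L] -> D1 L u x = v x.
  move=> xL; apply/rowP => i.
  have [p1 q1 _] := T' i; have [p2 q2 _] := T i.
  apply: (@within_continuous_ae_eq R (fun x => D1 L u x 0 i)
    (fun x => v x 0 i) 0 L) => //.
    exact: primitive_continuous (ltW L0) q1.
  exact: primitive_unique_ae p1 p2.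
split=> // i; have [_ q1 _] := T' i; have [_ q2 _] := T i.
apply: (primitive_unique_ae _ q2).
apply: primitive_eq q1; first exact: ltW.
by move=> x xL; rewrite E1.
Qed.

Lemma curve_linE (a : R) u v x i : (a *: u + v) x 0 i = a * u x 0 i + v x 0 i.
Proof. by have -> : (a *: u + v) x = a *: u x + v x by []; rewrite !mxE. Qed.

Lemma H2_triple_lin (a : R) u1 v1 w1 u2 v2 w2 : H2_triple u1 v1 w1 ->
  H2_triple u2 v2 w2 ->
  H2_triple (a *: u1 + u2) (a *: v1 + v2) (a *: w1 + w2).
Proof.
move=> T1 T2 i; have [p1 q1 s1] := T1 i; have [p2 q2 s2] := T2 i.
have E (f g : curve) : (fun x => (a *: f + g) x 0 i) = (fun x => a * f x 0 i + g x 0 i).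
  by apply/funext => x; rewrite curve_linE.
by rewrite !E; split; [exact: primitive_linear|exact: primitive_linear|exact: sq_integrable_lincomb].
Qed.

Lemma H2_lin (a : R) u v : H2 L u -> H2 L v -> H2 L (a *: u + v).
Proof.
by move=> /H2_tripleP T1 /H2_tripleP T2; have [] := triple_H2 (H2_triple_lin a T1 T2).
Qed.

Lemma D1_lin (a : R) u v : H2 L u -> H2 L v -> forall x, x \in `[0, L] ->
  D1 L (a *: u + v) x = a *: D1 L u x + D1 L v x.
Proof.
move=> /H2_tripleP T1 /H2_tripleP T2 x xL.
by have [_ -> ] := triple_H2 (H2_triple_lin a T1 T2).
Qed.

Lemma D2_lin (a : R) u v i : H2 L u -> H2 L v -> {ae mu, forall x, x \in `[0, L] ->
  D2 L (a *: u + v) x 0 i = a * D2 L u x 0 i + D2 L v x 0 i}.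
Proof.
move=> /H2_tripleP T1 /H2_tripleP T2.
have [_ _ /(_ i)] := triple_H2 (H2_triple_lin a T1 T2).
apply: filterS; first exact: (ae_filter_ringOfSetsType mu).
move=> x h xL; exact: etrans (h xL) (curve_linE _ _ _ _ _).
Qed.

Lemma H2_0 : H2 L (0 : curve).
Proof.
have [] // := @triple_H2 0 0 0.
move=> i; have p : primitive_on 0 L (fun x => (0 : curve) x 0 i) (fun x => (0 : curve) x 0 i).
  have E : (fun x => (0 : curve) x 0 i) = (fun=> 0) by apply/funext => x; rewrite mxE.
  rewrite E; split; first by apply: sq_integrable_integrable; exact: sq_integrable_cst.
  by move=> x _; rewrite Rintegral_cst// mul0r addr0.
split=> //.
have E : (fun x => (0 : curve) x 0 i) = (fun=> 0) by apply/funext => x; rewrite mxE.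
by rewrite E; exact: sq_integrable_cst.
Qed.

Lemma H2B u v : H2 L u -> H2 L v -> H2 L (u - v).
Proof.
move=> Hu Hv; have := H2_lin (-1) Hv Hu.
by rewrite scaleN1r addrC.
Qed.

End H2_triples.

Lemma cvg_bigsum (R : realType) (T : Type) (G : set_system T) {FG : Filter G} n
  (F : 'I_n -> T -> R) (l : 'I_n -> R) :
  (forall i, F i @ G --> l i) -> \sum_i F i k @[k --> G] --> \sum_i l i.
Proof.
move=> Fl; rewrite (_ : (fun k => _) = \sum_i F i); last first.
  by apply/funext => k; rewrite fct_sumE.
elim/big_ind2 : _ => //; first exact: cvg_cst.
by move=> x1 x2 y1 y2; exact: cvgD.
Qed.

(** * The L2 inner product of curves *)

Section L2_curves.
Variables (R : realType) (L : R).
Hypothesis L0 : 0 < L.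
Local Notation mu := (@lebesgue_measure R).
Local Notation curve := (R -> 'rV[R]_3).
Implicit Types (u v w : curve).

Lemma integrable_bigsum n (F : 'I_n -> R -> R) :
  (forall i, mu.-integrable `[0, L] (EFin \o F i)) ->
  mu.-integrable `[0, L] (EFin \o (fun x => \sum_i F i x)) /\
  \int[mu]_(x in `[0, L]) (\sum_i F i x) = \sum_i \int[mu]_(x in `[0, L]) F i x.
Proof.
elim: n F => [|n IHn] F iF.
  have E : (fun x => \sum_(i < 0) F i x) = (fun=> 0) by apply/funext => x; rewrite big_ord0.
  rewrite E big_ord0 Rintegral_cst// mul0r; split=> //.
  by apply: sq_integrable_integrable; exact: sq_integrable_cst.
have [i1 E1] := IHn (fun i => F (lift ord0 i)) (fun i => iF _).
have E : (fun x => \sum_i F i x) =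
    (fun x => 1 * F ord0 x + \sum_(i < n) F (lift ord0 i) x).
  by apply/funext => x; rewrite big_ord_recl mul1r.
rewrite E; split; first exact: integrable_lincomb.
by rewrite Rintegral_lincomb// mul1r E1 big_ord_recl.
Qed.

Definition l2ip u v : R := \int[mu]_(x in `[0, L]) dot (u x) (v x).

Lemma integrable_dot u v : L2 L u -> L2 L v ->
  mu.-integrable `[0, L] (EFin \o (fun x => dot (u x) (v x))).
Proof. by move=> su sv; apply: (integrable_bigsum _).1 => i; exact: sq_integrable_mul. Qed.

Lemma l2ipE u v : L2 L u -> L2 L v ->
  l2ip u v = \sum_i \int[mu]_(x in `[0, L]) (u x 0 i * v x 0 i).
Proof. by move=> su sv; apply: (integrable_bigsum _).2 => i; exact: sq_integrable_mul. Qed.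

Lemma l2ip_sqE u : L2 L u ->
  l2ip u u = \sum_i \int[mu]_(x in `[0, L]) (u x 0 i ^+ 2).
Proof.
by move=> su; rewrite l2ipE//; apply: eq_bigr => i _; apply: eq_Rintegral => x _; rewrite expr2.
Qed.

Lemma dotC n (a b : 'rV[R]_n) : dot a b = dot b a.
Proof. by apply: eq_bigr => i _; rewrite mulrC. Qed.

Lemma dot_linl n (k : R) (a b c : 'rV[R]_n) :
  dot (k *: a + b) c = k * dot a c + dot b c.
Proof.
by rewrite /dot mulr_sumr -big_split/=; apply: eq_bigr => i _; rewrite !mxE; ring.
Qed.

Lemma dot_ge0 n (a : 'rV[R]_n) : 0 <= dot a a.
Proof. by apply: sumr_ge0 => i _; rewrite -expr2 sqr_ge0. Qed.

Lemma dot_entry n (a : 'rV[R]_n) i : a 0 i ^+ 2 <= dot a a.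
Proof.
rewrite /dot (bigD1 i)//= -expr2 lerDl.
by apply: sumr_ge0 => j _; rewrite -expr2 sqr_ge0.
Qed.

Lemma dot_sqE n (a : 'rV[R]_n) : dot a a = \sum_i a 0 i ^+ 2.
Proof. by apply: eq_bigr => i _; rewrite expr2. Qed.

Lemma L2_lin (a : R) u v : L2 L u -> L2 L v -> L2 L (a *: u + v).
Proof.
move=> su sv i; have := sq_integrable_lincomb a (su i) (sv i).
rewrite (_ : (fun x => _) = (fun x => (a *: u + v) x 0 i))//.
by apply/funext => x; rewrite curve_linE.
Qed.

Lemma L2_0 : L2 L (0 : curve).
Proof.
move=> i; have := sq_integrable_cst 0 L (0 : R).
by rewrite (_ : (fun=> 0) = (fun x => (0 : curve) x 0 i))//; apply/funext => x; rewrite mxE.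
Qed.

Lemma L2B u v : L2 L u -> L2 L v -> L2 L (u - v).
Proof. by move=> su sv; have := L2_lin (-1) sv su; rewrite scaleN1r addrC. Qed.

Lemma l2ip_lin (a : R) u v w : L2 L u -> L2 L v -> L2 L w ->
  l2ip (a *: u + v) w = a * l2ip u w + l2ip v w.
Proof.
move=> su sv sw; rewrite /l2ip.
rewrite -(Rintegral_lincomb _ (integrable_dot su sw) (integrable_dot sv sw)).
by apply: eq_Rintegral => x _; exact: dot_linl.
Qed.

Lemma l2ipC u v : l2ip u v = l2ip v u.
Proof. by apply: eq_Rintegral => x _; exact: dotC. Qed.

Lemma l2ip_ge0 u : 0 <= l2ip u u.
Proof. by apply: Rintegral_ge0 => x _; exact: dot_ge0. Qed.

Lemma l2ip_norm_le u v : L2 L u -> L2 L v ->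
  `|l2ip u v| <= Num.sqrt (l2ip u u) * Num.sqrt (l2ip v v).
Proof.
move=> su sv; apply: (@ip_norm_le R _ (L2 L : set curve)) => //.
- exact: L2_0.
- by move=> *; exact: L2_lin.
- by move=> *; exact: l2ipC.
- by move=> *; exact: l2ip_lin.
- by move=> *; exact: l2ip_ge0.
Qed.

Lemma l2ip_ae u u' v : L2 L u -> L2 L u' -> L2 L v ->
  (forall i, {ae mu, forall x, x \in `[0, L] -> u x 0 i = u' x 0 i}) ->
  l2ip u v = l2ip u' v.
Proof.
move=> su su' sv uu'; rewrite !l2ipE//; apply: eq_bigr => i _.
apply: ae_eq_Rintegral.
- apply: filterS (uu' i); first exact: (ae_filter_ringOfSetsType mu).
  by move=> x h xL; exact: (congr1 ( *%R^~ _) (h xL)).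
- by apply: measurable_funM; [case: (su i)|case: (sv i)].
- by apply: measurable_funM; [case: (su' i)|case: (sv i)].
Qed.

Lemma l2ip_sq_ae u v : L2 L u -> L2 L v ->
  (forall i, {ae mu, forall x, x \in `[0, L] -> u x 0 i = v x 0 i}) ->
  l2ip u u = l2ip v v.
Proof.
move=> su sv uv; rewrite (l2ip_ae su sv su uv) l2ipC; exact: l2ip_ae.
Qed.

Lemma l2_complete (w_ : nat -> curve) : (forall k, L2 L (w_ k)) ->
  (forall e, 0 < e -> exists N, forall m n, (N <= m)%N -> (N <= n)%N ->
    l2ip (w_ m - w_ n) (w_ m - w_ n) < e) ->
  exists2 w, L2 L w & l2ip (w_ k - w) (w_ k - w) @[k --> \oo] --> (0 : R).
Proof.
move=> sw cw.
have ex i : exists g : R -> R, sq_integrable 0 L g /\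
    \int[mu]_(x in `[0, L]) ((w_ k x 0 i - g x) ^+ 2) @[k --> \oo] --> (0 : R).
  have [|g sg cg] := @L2_complete R 0 L (ltW L0) (fun k x => w_ k x 0 i) (fun k => sw k i).
    move=> e e0; have [N NP] := cw e e0; exists N => m n Nm Nn.
    apply: le_lt_trans (NP m n Nm Nn); rewrite l2ip_sqE; last exact: L2B.
    rewrite (bigD1 i)//=; apply: ler_wpDr.
      by apply: sumr_ge0 => j _; exact: Rintegral_sq_ge0.
    by rewrite le_eqVlt; apply/orP; left; apply/eqP; apply: eq_Rintegral => x _; rewrite !mxE.
  by exists g.
have [g gP] := choice ex.
pose w : curve := fun x => \row_i g i x.
have wE i : (fun x => w x 0 i) = g i by apply/funext => x; rewrite mxE.
have sw' : L2 L w by move=> i; have [] := gP i; rewrite -wE.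
exists w => //.
rewrite (_ : (fun k => _) = fun k => \sum_i \int[mu]_(x in `[0, L]) ((w_ k x 0 i - g i x) ^+ 2)).
  rewrite [X in _ --> X](_ : _ = \sum_(i < 3) (0 : R)); last by rewrite big1.
  apply: cvg_bigsum => i; exact: (gP i).2.
apply/funext => k; rewrite l2ip_sqE; last exact: L2B.
by apply: eq_bigr => i _; apply: eq_Rintegral => x _; rewrite !mxE.
Qed.

End L2_curves.

(* D1 and D2 are choice values: unification must not compare them by unfolding. *)
Local Opaque D1 D2 l2ip.

(** * A complete semi-inner product on H2 *)

Section H2_hilbert.
Variables (R : realType) (L : R).
Hypothesis L0 : 0 < L.
Local Notation mu := (@lebesgue_measure R).
Local Notation curve := (R -> 'rV[R]_3).
Implicit Types (u v w : curve).

(** Initial value, initial slope and second derivative are independent data of a curve, so this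
    form, unlike one made from all three L2 norms, can be completed component by component. *)
Definition h2ip u v : R :=
  dot (u 0) (v 0) + dot (D1 L u 0) (D1 L v 0) + l2ip L (D2 L u) (D2 L v).

Lemma H2_D2 u : H2 L u -> L2 L (D2 L u).
Proof. by move=> /D2P[]. Qed.

Lemma l2ip_D2_lin (a : R) u v w : H2 L u -> H2 L v -> L2 L w ->
  l2ip L (D2 L (a *: u + v)) w = a * l2ip L (D2 L u) w + l2ip L (D2 L v) w.
Proof.
move=> Hu Hv sw; rewrite -l2ip_lin//; try exact: H2_D2.
apply: l2ip_ae => //; first exact/H2_D2/H2_lin.
  by apply: L2_lin; exact: H2_D2.
move=> i; apply: filterS (D2_lin L0 a i Hu Hv); first exact: (ae_filter_ringOfSetsType mu).
by move=> x h xL; rewrite curve_linE; exact: h.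
Qed.

Lemma h2ip_lin (a : R) u v w : H2 L u -> H2 L v -> H2 L w ->
  h2ip (a *: u + v) w = a * h2ip u w + h2ip v w.
Proof.
move=> Hu Hv Hw.
have := l2ip_D2_lin a Hu Hv (H2_D2 Hw); have := D1_lin L0 a Hu Hv (left_in_itvcc L0).
have : (a *: u + v) 0 = a *: u 0 + v 0 by [].
move: (a *: u + v) => s E0 E1 E2.
have alg (x1 x2 x3 p1 q1 p2 q2 p3 q3 : R) : x1 = a * p1 + q1 ->
    x2 = a * p2 + q2 -> x3 = a * p3 + q3 ->
    x1 + x2 + x3 = a * (p1 + p2 + p3) + (q1 + q2 + q3) by move=> -> -> ->; ring.
apply: (alg) => //.
- by rewrite E0; exact: dot_linl.
- by rewrite E1; exact: dot_linl.
Qed.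

Lemma h2ipC u v : h2ip u v = h2ip v u.
Proof.
have alg (x y z x' y' z' : R) : x = x' -> y = y' -> z = z' ->
    x + y + z = x' + y' + z' by move=> -> -> ->.
exact: (alg _ _ _ _ _ _ (dotC _ _) (dotC _ _) (l2ipC _ _ _)).
Qed.

Lemma h2ip_ge0 u : 0 <= h2ip u u.
Proof. by rewrite !addr_ge0 ?dot_ge0 ?l2ip_ge0. Qed.

Let sum3_ge (x y z : R) : 0 <= x -> 0 <= y -> 0 <= z ->
  [/\ x <= x + y + z, y <= x + y + z & z <= x + y + z].
Proof. by move=> *; split; lra. Qed.

Lemma h2ip_ge u : [/\ dot (u 0) (u 0) <= h2ip u u,
  dot (D1 L u 0) (D1 L u 0) <= h2ip u u &
  l2ip L (D2 L u) (D2 L u) <= h2ip u u].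
Proof. exact: (sum3_ge (dot_ge0 _) (dot_ge0 _) (l2ip_ge0 _ _)). Qed.

Let addN1 (p q : R) : -1 * q + p = p - q.
Proof. by ring. Qed.

Lemma curve_subE u v x i : (u - v) x 0 i = u x 0 i - v x 0 i.
Proof. by have -> : (u - v) x = u x - v x by []; rewrite !mxE. Qed.

Lemma l2ip_D2_sub u v : H2 L u -> H2 L v ->
  l2ip L (D2 L (u - v)) (D2 L (u - v)) = l2ip L (D2 L u - D2 L v) (D2 L u - D2 L v).
Proof.
move=> Hu Hv; have Huv := H2B L0 Hu Hv.
have ae i : {ae mu, forall x, x \in `[0, L] ->
    D2 L (u - v) x 0 i = (D2 L u - D2 L v) x 0 i}.
  have := D2_lin L0 (-1) i Hv Hu; rewrite scaleN1r addrC.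
  apply: filterS; first exact: (ae_filter_ringOfSetsType mu).
  by move=> x h xL; exact: etrans (etrans (h xL) (addN1 _ _)) (esym (curve_subE _ _ _ _)).
have s1 := H2_D2 Huv; have s2 := L2B (H2_D2 Hu) (H2_D2 Hv).
exact: l2ip_sq_ae ae.
Qed.

Lemma D1_sub u v x : H2 L u -> H2 L v -> x \in `[0, L] ->
  D1 L (u - v) x = D1 L u x - D1 L v x.
Proof.
move=> Hu Hv xL; have := D1_lin L0 (-1) Hv Hu xL.
by rewrite scaleN1r addrC => ->; rewrite scaleN1r addrC.
Qed.

Lemma h2_complete (u_ : nat -> curve) : (forall k, H2 L (u_ k)) ->
  (forall e, 0 < e -> exists N, forall m n, (N <= m)%N -> (N <= n)%N ->
    h2ip (u_ m - u_ n) (u_ m - u_ n) < e) ->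
  exists2 u, H2 L u & h2ip (u_ k - u) (u_ k - u) @[k --> \oo] --> (0 : R).
Proof.
move=> Hu cu.
have entry_cvg (a : nat -> 'rV[R]_3) : (forall e, 0 < e -> exists N, forall m n,
    (N <= m)%N -> (N <= n)%N -> dot (a m - a n) (a m - a n) < e) ->
    exists l : 'rV[R]_3, forall i, a k 0 i @[k --> \oo] --> l 0 i.
  move=> ca; have ex i : exists l : R, a k 0 i @[k --> \oo] --> l.
    have /cvg_ex[l] : cvgn (fun k => a k 0 i).
      apply: cvgn_cauchyP => e e0; have [|N NP] := ca (e ^+ 2).
        by rewrite exprn_gt0.
      exists N => m n Nm Nn; rewrite -(@ltr_pXn2r _ 2)// ?nnegrE ?ltW//.
      rewrite real_normK ?num_real//.
      by apply: le_lt_trans (NP m n Nm Nn); have := dot_entry (a m - a n) i; rewrite !mxE.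
    by exists l.
  have [l lP] := choice ex; exists (\row_i l i) => i; rewrite mxE; exact: lP.
have [u0 u0P] : exists l : 'rV[R]_3, forall i, u_ k 0 0 i @[k --> \oo] --> l 0 i.
  apply: (entry_cvg (fun k => u_ k 0)) => e e0.
  have [N NP] := cu e e0; exists N => m n Nm Nn; apply: le_lt_trans (NP m n Nm Nn).
  by have [] := h2ip_ge (u_ m - u_ n).
have [v0 v0P] : exists l : 'rV[R]_3, forall i, D1 L (u_ k) 0 0 i @[k --> \oo] --> l 0 i.
  apply: (entry_cvg (fun k => D1 L (u_ k) 0)) => e e0.
  have [N NP] := cu e e0; exists N => m n Nm Nn; apply: le_lt_trans (NP m n Nm Nn).
  have [_ + _] := h2ip_ge (u_ m - u_ n).
  by rewrite (D1_sub (Hu m) (Hu n) (left_in_itvcc L0)).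
have [|w sw cw] := l2_complete L0 (fun k => H2_D2 (Hu k)).
  move=> e e0.
  have [N NP] := cu e e0; exists N => m n Nm Nn; apply: le_lt_trans (NP m n Nm Nn).
  have [_ _] := h2ip_ge (u_ m - u_ n).
  by rewrite (l2ip_D2_sub (Hu m) (Hu n)).
(* The limit curve is rebuilt by integrating the limit of the second derivatives twice, from the
   limits of the initial data. *)
pose v x : 'rV[R]_3 := \row_i (v0 0 i + \int[mu]_(t in `[0, x]) w t 0 i).
pose u x : 'rV[R]_3 := \row_i (u0 0 i + \int[mu]_(t in `[0, x]) v t 0 i).
have v_0 : v 0 = v0 by apply/rowP => i; rewrite mxE set_itv1 Rintegral_set1 addr0.
have u_0 : u 0 = u0 by apply/rowP => i; rewrite mxE set_itv1 Rintegral_set1 addr0.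
have T : H2_triple L u v w.
  move=> i.
  have pv : primitive_on 0 L (fun x => v x 0 i) (fun x => w x 0 i).
    split; first exact: sq_integrable_integrable (sw i).
    by move=> x xL; rewrite v_0 mxE.
  split=> //; split; last by move=> x xL; rewrite u_0 mxE.
  exact: within_continuous_integrable (primitive_continuous (ltW L0) pv).
clearbody u v; have [Hu' D1u D2u] := triple_H2 L0 T.
exists u => //.
rewrite [X in _ --> X](_ : _ = \sum_(i < 3) (0 : R) ^+ 2 + \sum_(i < 3) (0 : R) ^+ 2 + 0); last first.
  by rewrite expr0n/= !big1// !addr0.
have dist0 (a : nat -> 'rV[R]_3) (l : 'rV[R]_3) : (forall i, a k 0 i @[k --> \oo] --> l 0 i) ->
    dot (a k - l) (a k - l) @[k --> \oo] --> \sum_(i < 3) (0 : R) ^+ 2.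
  move=> al; rewrite (_ : (fun k => _) = fun k => \sum_i (a k 0 i - l 0 i) ^+ 2).
    apply: cvg_bigsum => i; under eq_fun do rewrite expr2; rewrite expr2.
    by apply: cvgM; rewrite -(subrr (l 0 i)); apply: cvgB; (exact: al) || exact: cvg_cst.
  by apply/funext => k; rewrite dot_sqE; apply: eq_bigr => i _; rewrite !mxE.
apply: cvgD; first apply: cvgD.
- by have := dist0 _ _ u0P; rewrite -u_0.
- rewrite (_ : (fun k => _) = fun k => dot (D1 L (u_ k) 0 - v0) (D1 L (u_ k) 0 - v0)).
    exact: dist0 v0P.
  by apply/funext => k; rewrite (D1_sub (Hu k) Hu' (left_in_itvcc L0)) (D1u _ (left_in_itvcc L0)) v_0.
- rewrite (_ : (fun k => _) = fun k => l2ip L (D2 L (u_ k) - w) (D2 L (u_ k) - w)) //.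
  apply/funext => k; rewrite (l2ip_D2_sub (Hu k) Hu').
  have s1 := L2B (H2_D2 (Hu k)) (H2_D2 Hu'); have s2 := L2B (H2_D2 (Hu k)) sw.
  have ae i : {ae mu, forall x, x \in `[0, L] ->
      (D2 L (u_ k) - D2 L u) x 0 i = (D2 L (u_ k) - w) x 0 i}.
    apply: filterS (D2u i); first exact: (ae_filter_ringOfSetsType mu).
    move=> x h xL; rewrite curve_subE; apply: etrans (esym (curve_subE _ _ _ _)).
    exact: (congr1 (fun y => _ - y) (h xL)).
  exact: l2ip_sq_ae ae.
Qed.

End H2_hilbert.

Local Transparent D1 D2 l2ip.

(** * Norm comparison, point evaluation and weak compactness in H2 *)

Section H2_weak.
Variables (R : realType) (L : R).
Hypothesis L0 : 0 < L.
Local Notation curve := (R -> 'rV[R]_3).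
Implicit Types (u v w f g : curve).

Definition primitive_curve f g : Prop :=
  forall i, primitive_on 0 L (fun x => f x 0 i) (fun x => g x 0 i).

Lemma primitive_curve_L2 f g : primitive_curve f g -> L2 L f.
Proof.
move=> fg i; apply: sq_integrable_continuous.
exact: primitive_continuous (ltW L0) (fg i).
Qed.

Lemma curve_L2_bound f g : primitive_curve f g -> L2 L g ->
  l2ip L f f <= 2 * L * dot (f 0) (f 0) + 2 * L ^+ 2 * l2ip L g g.
Proof.
move=> fg sg; rewrite !l2ip_sqE//; last exact: primitive_curve_L2 fg.
rewrite dot_sqE !mulr_sumr -big_split/=; apply: ler_sum => i _.
exact: primitive_L2_bound.
Qed.

Lemma curve_point_bound f g x : primitive_curve f g -> L2 L g -> x \in `[0, L] ->
  L * dot (f x) (f x) <= 2 * l2ip L f f + 2 * L ^+ 2 * l2ip L g g.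
Proof.
move=> fg sg xL; rewrite !l2ip_sqE//; last exact: primitive_curve_L2 fg.
rewrite dot_sqE !mulr_sumr -big_split/=; apply: ler_sum => i _.
exact: primitive_point_bound.
Qed.

Lemma curve_holder f g x y : primitive_curve f g -> L2 L g ->
  x \in `[0, L] -> y \in `[0, L] ->
  dot (f x - f y) (f x - f y) <= `|x - y| * l2ip L g g.
Proof.
move=> fg sg xL yL; rewrite l2ip_sqE// dot_sqE mulr_sumr; apply: ler_sum => i _.
have -> : (f x - f y) 0 i = f x 0 i - f y 0 i by rewrite !mxE.
exact: (primitive_holder (fg i) (sg i)).
Qed.

Lemma H2_primitive1 u : H2 L u -> primitive_curve u (D1 L u).
Proof. by move=> /(H2_tripleP L0) T i; have [] := T i. Qed.

Lemma H2_primitive2 u : H2 L u -> primitive_curve (D1 L u) (D2 L u).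
Proof. by move=> /(H2_tripleP L0) T i; have [] := T i. Qed.

Lemma H2_D1_L2 u : H2 L u -> L2 L (D1 L u).
Proof. by move=> /H2_primitive2/primitive_curve_L2. Qed.

Lemma H2norm_sq u : H2norm L u ^+ 2 =
  l2ip L u u + l2ip L (D1 L u) (D1 L u) + l2ip L (D2 L u) (D2 L u).
Proof.
have E f : L2norm L f ^+ 2 = l2ip L f f by rewrite sqr_sqrtr// l2ip_ge0.
rewrite /H2norm sqr_sqrtr; first by rewrite !E.
by rewrite !addr_ge0 ?sqr_ge0.
Qed.

Lemma H2norm_ge0 u : 0 <= H2norm L u.
Proof. exact: sqrtr_ge0. Qed.

(** Inserts the bound for [u'] into the one for [u]. In units of [h2ip L u u], [u''] contributes 1,
    [u'] contributes [2 L + 2 L^2], and [u] contributes [2 L] plus [2 L^2] times the share of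
    [u']. *)
Let K : R := 2 * L + (2 * L ^+ 2 + 1) * (2 * L + 2 * L ^+ 2) + 1.

Lemma H2norm_sq_le u : H2 L u -> H2norm L u ^+ 2 <= K * h2ip L u u.
Proof.
move=> Hu; rewrite H2norm_sq.
have h1 := curve_L2_bound (H2_primitive1 Hu) (H2_D1_L2 Hu).
have h2 := curve_L2_bound (H2_primitive2 Hu) (H2_D2 Hu).
have [k1 k2 k3] := h2ip_ge L u.
have alg (A B C a b N : R) : A <= 2 * L * a + 2 * L ^+ 2 * B ->
   B <= 2 * L * b + 2 * L ^+ 2 * C -> a <= N -> b <= N -> C <= N ->
   A + B + C <= K * N.
  move=> e1 e2 e3 e4 e5.
  have L2 : 0 <= 2 * L ^+ 2 by rewrite mulr_ge0// sqr_ge0.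
  have LL : 0 <= 2 * L by rewrite mulr_ge0// ltW.
  have t1 : 2 * L * b <= 2 * L * N by rewrite ler_wpM2l.
  have t2 : 2 * L ^+ 2 * C <= 2 * L ^+ 2 * N by rewrite ler_wpM2l.
  have t3 : 2 * L * a <= 2 * L * N by rewrite ler_wpM2l.
  have t4 : B <= (2 * L + 2 * L ^+ 2) * N by lra.
  have t5 : 2 * L ^+ 2 * B <= 2 * L ^+ 2 * ((2 * L + 2 * L ^+ 2) * N) by rewrite ler_wpM2l.
  rewrite /K; move: t1 t2 t3 t4 t5 e1 e2 e5; move: (L ^+ 2 * B) => LB.
  set X := (2 * L + 2 * L ^+ 2) * N => *.
  have -> : (2 * L + (2 * L ^+ 2 + 1) * (2 * L + 2 * L ^+ 2) + 1) * N =
    2 * L * N + 2 * L ^+ 2 * X + X + N by rewrite /X; ring.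
  lra.
exact: alg h1 h2 k1 k2 k3.
Qed.

Lemma H2norm_le u : H2 L u -> H2norm L u <= Num.sqrt K * Num.sqrt (h2ip L u u).
Proof.
move=> Hu; have K0 : 0 <= K.
  by rewrite !addr_ge0// ?mulr_ge0 ?addr_ge0 ?mulr_ge0 ?sqr_ge0// ltW.
rewrite -sqrtrM// -[leLHS]ger0_norm ?H2norm_ge0// -sqrtr_sqr ler_wsqrtr//.
exact: H2norm_sq_le.
Qed.

(** The factor between squared point values and the squared H2 norm: dividing [L d <= 2 A + 2 L^2 B]
    by [L] gives the coefficients [2 / L] and [2 L]. *)
Let K' : R := 2 / L + 2 * L.

Let point_alg (d A B C : R) : 0 <= A -> 0 <= B -> 0 <= C ->
  L * d <= 2 * A + 2 * L ^+ 2 * B -> d <= K' * (A + B + C).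
Proof.
move=> A0 B0 C0 h; rewrite -(ler_pM2l L0); apply: le_trans h _.
have -> : L * (K' * (A + B + C)) = 2 * (A + B + C) + 2 * L ^+ 2 * (A + B + C).
  by rewrite /K'; field; rewrite gt_eqF.
have L2 : 0 <= 2 * L ^+ 2 by rewrite mulr_ge0// sqr_ge0.
by apply: lerD; [lra|rewrite ler_wpM2l//; lra].
Qed.

Lemma H2_point0 u x : H2 L u -> x \in `[0, L] ->
  dot (u x) (u x) <= K' * H2norm L u ^+ 2.
Proof.
move=> Hu xL; rewrite H2norm_sq; apply: point_alg; try exact: l2ip_ge0.
exact: curve_point_bound (H2_primitive1 Hu) (H2_D1_L2 Hu) xL.
Qed.

Lemma H2_point1 u x : H2 L u -> x \in `[0, L] ->
  dot (D1 L u x) (D1 L u x) <= K' * H2norm L u ^+ 2.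
Proof.
move=> Hu xL; rewrite H2norm_sq.
have alg (A B C : R) : A + B + C = B + C + A by ring.
rewrite alg; apply: point_alg; try exact: l2ip_ge0.
exact: curve_point_bound (H2_primitive2 Hu) (H2_D2 Hu) xL.
Qed.

Let K'0 : 0 <= K'.
Proof. by have l := ltW L0; apply: addr_ge0; [exact: divr_ge0|exact: mulr_ge0]. Qed.

Let sqrt_bound (y d N : R) : 0 <= N -> y ^+ 2 <= d -> d <= K' * N ^+ 2 ->
  `|y| <= Num.sqrt K' * N.
Proof.
move=> N0 yd dN; rewrite -sqrtr_sqr -[X in _ * X]ger0_norm// -sqrtr_sqr -sqrtrM ?K'0//.
by rewrite ler_wsqrtr// (le_trans yd).
Qed.

(** Makes weak convergence in H2 imply pointwise convergence of the curves; the next lemma does this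
    for their derivatives. *)
Lemma bounded_linear_point0 x i : x \in `[0, L] ->
  bounded_linear L (fun u => u x 0 i : R^o).
Proof.
move=> xL; split; first by move=> a u v Hu Hv; rewrite curve_linE.
exists (Num.sqrt K') => u Hu.
exact: sqrt_bound (H2norm_ge0 u) (dot_entry _ _) (H2_point0 Hu xL).
Qed.

Lemma bounded_linear_point1 x i : x \in `[0, L] ->
  bounded_linear L (fun u => D1 L u x 0 i : R^o).
Proof.
move=> xL; split.
  move=> a u v Hu Hv; have E := congr1 (fun M : 'rV[R]_3 => M 0 i) (D1_lin L0 a Hu Hv xL).
  have lin (p q : 'rV[R]_3) : (a *: p + q) 0 i = a * p 0 i + q 0 i by rewrite !mxE.
  exact: etrans E (lin _ _).
exists (Num.sqrt K') => u Hu.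
exact: sqrt_bound (H2norm_ge0 u) (dot_entry _ _) (H2_point1 Hu xL).
Qed.

Lemma bounded_linear_D2 g : L2 L g ->
  bounded_linear L (fun u => l2ip L (D2 L u) g : R^o).
Proof.
move=> sg; split; first by move=> a u v Hu Hv; exact: l2ip_D2_lin.
exists (Num.sqrt (l2ip L g g)) => u Hu.
apply: le_trans (l2ip_norm_le (H2_D2 Hu) sg) _.
rewrite mulrC ler_wpM2l ?sqrtr_ge0//.
rewrite -[leRHS]ger0_norm ?H2norm_ge0// -sqrtr_sqr ler_wsqrtr// H2norm_sq.
have alg (A B C : R) : 0 <= A -> 0 <= B -> C <= A + B + C by lra.
by apply: alg; exact: l2ip_ge0.
Qed.

Lemma bounded_linear_entry n (F : curve -> 'rV[R]_n) j : bounded_linear L F ->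
  bounded_linear L (fun u => F u 0 j : R^o).
Proof.
move=> [Flin [C FC]]; split.
  by move=> a u v Hu Hv; rewrite Flin// mxE [in LHS]mxE.
by exists C => u Hu; apply: le_trans (FC u Hu); exact: row_entry_le_norm.
Qed.

Lemma bounded_linear_sub (F : curve -> R^o) u v : bounded_linear L F ->
  H2 L u -> H2 L v -> F (u - v) = F u - F v.
Proof.
move=> [Flin _] Hu Hv; have := Flin (-1) v u Hv Hu.
by rewrite scaleN1r addrC => ->; rewrite scaleN1r addrC.
Qed.

Lemma strong_weak_cvg (u_ : nat -> curve) u : (forall k, H2 L (u_ k)) -> H2 L u ->
  strong_cvg L u_ u -> weak_cvg L u_ u.
Proof.
move=> Hu_ Hu cu F bF; have [_ [C FC]] := bF.
apply: (@squeeze_dist R (fun k => F (u_ k)) (fun k => C * H2norm L (u_ k - u))).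
  by move=> k; rewrite -bounded_linear_sub//; apply: FC; exact: H2B.
rewrite -[X in _ --> X](mulr0 C).
by apply: cvgM; [exact: cvg_cst|exact: cu].
Qed.

Lemma H2_weak_compactness (u_ : nat -> curve) (M : R) : (forall k, H2 L (u_ k)) ->
  (forall k, h2ip L (u_ k) (u_ k) <= M) ->
  exists (phi : nat -> nat) u,
    [/\ {homo phi : m n / (m < n)%N}, H2 L u & weak_cvg L (u_ \o phi) u].
Proof.
move=> Hu_ uM.
have [||||||phi [u [hphi Hu uP]]] := @ip_weak_compactness R _ (H2 L : set curve) (h2ip L)
  _ _ _ _ _ _ u_ M Hu_ uM.
- exact: H2_0.
- by move=> *; exact: H2_lin.
- by move=> *; exact: h2ipC.
- by move=> *; exact: h2ip_lin.
- by move=> *; exact: h2ip_ge0.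
- exact: h2_complete.
exists phi, u; split=> // F [Flin [C FC]].
apply: (uP F (`|C| * Num.sqrt K)) => // v Hv.
apply: le_trans (FC v Hv) _; rewrite -mulrA.
apply: (@le_trans _ _ (`|C| * H2norm L v)).
  by rewrite ler_wpM2r ?H2norm_ge0// ler_norm.
by rewrite ler_wpM2l// H2norm_le.
Qed.

End H2_weak.

(** * Quadratic energies *)

Section quadratic_energy.
Variables (R : realType) (L : R).
Hypothesis L0 : 0 < L.
Local Notation mu := (@lebesgue_measure R).
Local Notation curve := (R -> 'rV[R]_3).
Implicit Types (u v w n : curve) (a b : 'rV[R]_3).

Lemma Rdominated_convergence (f_ : nat -> R -> R) (f g : R -> R) :
  (forall k, measurable_fun `[0, L] (f_ k)) -> measurable_fun `[0, L] f ->
  (forall x, x \in `[0, L] -> f_ k x @[k --> \oo] --> f x) ->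
  mu.-integrable `[0, L] (EFin \o g) ->
  (forall k x, x \in `[0, L] -> `|f_ k x| <= g x) ->
  \int[mu]_(x in `[0, L]) f_ k x @[k --> \oo] --> \int[mu]_(x in `[0, L]) f x.
Proof.
move=> mf_ mf ff ig fg.
have mI : measurable (`[0, L]%classic : set (measurableTypeR R)) by exact: measurable_itv.
have h1 k : measurable_fun `[0, L] (EFin \o f_ k) by exact/measurable_EFinP.
have h2 : measurable_fun `[0, L] (EFin \o f) by exact/measurable_EFinP.
have h3 : {ae mu, forall x, `[0, L]%classic x -> (EFin \o f_ k) x @[k --> \oo] --> (EFin \o f) x}.
  by apply: aeW => x xL; apply: cvg_EFin; [exact: nearW|exact: ff].
have h4 : {ae mu, forall x k, `[0, L]%classic x -> (`|(EFin \o f_ k) x| <= (EFin \o g) x)%E}.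
  by apply: aeW => x k xL; rewrite lee_fin; exact: fg.
have [fi _ cvgE] := dominated_convergence mI h1 h2 h3 ig h4.
have fin : (\int[mu]_(x in `[0%R, L]) (EFin \o f) x)%E \is a fin_num.
  exact: integrable_fin_num fi.
by move: cvgE; rewrite -(fineK fin) => /fine_cvgP[_]; exact.
Qed.

Lemma dot_cauchy_schwarz a b : dot a b ^+ 2 <= dot a a * dot b b.
Proof.
apply: (@ip_cauchy_schwarz R _ (setT : set 'rV[R]_3)) => //.
- by move=> *; exact: dotC.
- by move=> *; exact: dot_linl.
- by move=> *; exact: dot_ge0.
Qed.

(** The symmetric operator, applied to [a], of the quadratic form [|a|^2 - gamma (a . b)^2]. *)
Definition reduced (gamma : R) a b : 'rV[R]_3 := a - (gamma * dot a b) *: b.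

Lemma dot_reduced (gamma : R) a b c :
  dot c (reduced gamma a b) = dot c a - gamma * dot a b * dot c b.
Proof.
rewrite /reduced addrC -scaleNr dotC dot_linl (dotC b c) (dotC a c).
by ring.
Qed.

Lemma dot_sub_sq a b : dot (a - b) (a - b) = dot a a - 2 * dot a b + dot b b.
Proof.
rewrite -scaleN1r addrC dot_linl (dotC b) (dotC a) !dot_linl (dotC b a).
by ring.
Qed.

(** The first two terms are affine in [a], hence accessible to weak convergence; the last is the
    same quadratic form at [a - b]. *)
Lemma reduced_identity (gamma : R) a b (m : 'rV[R]_3) :
  dot a a - gamma * dot a m ^+ 2 =
  2 * dot a (reduced gamma b m) - dot b (reduced gamma b m) +
  (dot (a - b) (a - b) - gamma * dot (a - b) m ^+ 2).
Proof.
rewrite !dot_reduced dot_sub_sq.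
have -> : dot (a - b) m = dot a m - dot b m.
  by rewrite -scaleN1r addrC dot_linl; ring.
by ring.
Qed.

Lemma reduced_quadratic_ge0 (gamma : R) a (m : 'rV[R]_3) :
  0 <= gamma <= 1 -> dot m m <= 1 -> 0 <= dot a a - gamma * dot a m ^+ 2.
Proof.
move=> /andP[g0 g1] n1; rewrite subr_ge0.
apply: (@le_trans _ _ (1 * dot a m ^+ 2)); first by rewrite ler_wpM2r ?sqr_ge0.
rewrite mul1r (le_trans (dot_cauchy_schwarz a m))//.
by rewrite ler_piMr// dot_ge0.
Qed.

Lemma dotZr (k : R) a b : dot a (k *: b) = k * dot a b.
Proof. by rewrite /dot mulr_sumr; apply: eq_bigr => i _; rewrite mxE; ring. Qed.

Lemma dotZl (k : R) a b : dot (k *: a) b = k * dot a b.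
Proof. by rewrite dotC dotZr dotC. Qed.

(** The operator has the eigenvalues 1 and [1 - gamma |m|^2], both in [0, 1]. *)
Lemma reduced_norm_le (gamma : R) a (m : 'rV[R]_3) :
  0 <= gamma <= 1 -> dot m m <= 1 ->
  dot (reduced gamma a m) (reduced gamma a m) <= dot a a.
Proof.
move=> /andP[g0 g1] n1.
rewrite {1 2}/reduced dot_sub_sq !dotZr !dotZl.
have d0 := sqr_ge0 (dot a m); have m0 := dot_ge0 m.
have -> : dot a a - 2 * (gamma * dot a m * dot a m) +
    gamma * dot a m * (gamma * dot a m * dot m m) =
    dot a a - gamma * dot a m ^+ 2 * (2 - gamma * dot m m) by ring.
have : 0 <= gamma * dot a m ^+ 2 * (2 - gamma * dot m m).
  apply: mulr_ge0; first exact: mulr_ge0.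
  have : gamma * dot m m <= 1 * 1 by rewrite ler_pM.
  by lra.
by lra.
Qed.

Lemma dot_sub_le a b : dot (a - b) (a - b) <= 2 * dot a a + 2 * dot b b.
Proof.
have := dot_ge0 (a + b); rewrite dot_sub_sq -[a in dot (a + b)]scale1r dot_linl (dotC b) (dotC a (a + b)).
rewrite -[a in dot (a + b)]scale1r !dot_linl (dotC b a).
by lra.
Qed.

Lemma dot_convergence (a_ : nat -> 'rV[R]_3) a (b_ : nat -> 'rV[R]_3) b :
  (forall i, a_ k 0 i @[k --> \oo] --> a 0 i) ->
  (forall i, b_ k 0 i @[k --> \oo] --> b 0 i) ->
  dot (a_ k) (b_ k) @[k --> \oo] --> dot a b.
Proof. by move=> ca cb; apply: cvg_bigsum => i; exact: cvgM. Qed.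

Section reduced_convergence.
Variables (w_ : nat -> curve) (w : curve) (n_ : nat -> curve) (n : curve).
Variables (g_ : nat -> R) (g M : R).
Hypothesis sw_ : forall k, L2 L (w_ k).
Hypothesis sw : L2 L w.
Hypothesis mn_ : forall k i, measurable_fun `[0, L] (fun x => n_ k x 0 i).
Hypothesis mn : forall i, measurable_fun `[0, L] (fun x => n x 0 i).
Hypothesis n_le1 : forall k x, dot (n_ k x) (n_ k x) <= 1.
Hypothesis n1 : forall x, dot (n x) (n x) <= 1.
Hypothesis n_cvg : forall x i, x \in `[0, L] -> n_ k x 0 i @[k --> \oo] --> n x 0 i.
Hypothesis g01_ : forall k, 0 <= g_ k <= 1.
Hypothesis g01 : 0 <= g <= 1.
Hypothesis g_cvg : g_ @ \oo --> g.
Hypothesis w_weak : forall f : curve, L2 L f -> l2ip L (w_ k) f @[k --> \oo] --> l2ip L w f.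
Hypothesis w_bnd : forall k, l2ip L (w_ k) (w_ k) <= M.

Lemma measurable_dot (f h : curve) : (forall i, measurable_fun `[0, L] (fun x => f x 0 i)) ->
  (forall i, measurable_fun `[0, L] (fun x => h x 0 i)) ->
  measurable_fun `[0, L] (fun x => dot (f x) (h x)).
Proof. by move=> mf mh; apply: measurable_sum => i; exact: measurable_funM. Qed.

Lemma L2_dominated (f h : curve) : (forall i, measurable_fun `[0, L] (fun x => f x 0 i)) ->
  L2 L h -> (forall x, dot (f x) (f x) <= dot (h x) (h x)) -> L2 L f.
Proof.
move=> mf sh fh i; split; first exact: mf.
apply: (@integrable_dominated _ _ _ _ (fun x => dot (h x) (h x))).
- exact: measurable_funX.
- exact: integrable_dot.
- by move=> x; rewrite ger0_norm ?sqr_ge0// (le_trans _ (fh x))// dot_entry.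
Qed.

Lemma L2_reduced (gam : R) (m : curve) : 0 <= gam <= 1 ->
  (forall i, measurable_fun `[0, L] (fun x => m x 0 i)) ->
  (forall x, dot (m x) (m x) <= 1) ->
  L2 L (fun x => reduced gam (w x) (m x)).
Proof.
move=> gam01 mm m1; have mw i : measurable_fun `[0, L] (fun x => w x 0 i) by case: (sw i).
apply: (L2_dominated _ sw) => [i|x]; last exact: reduced_norm_le.
rewrite (_ : (fun x => _) = fun x => w x 0 i - (gam * dot (w x) (m x)) * m x 0 i).
  apply: measurable_funB => //; apply: measurable_funM => //.
  by apply: measurable_funM => //; exact: measurable_dot.
by apply/funext => x; rewrite !mxE.
Qed.

Let r_ k : curve := fun x => reduced (g_ k) (w x) (n_ k x).
Let r : curve := fun x => reduced g (w x) (n x).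

Let sr_ k : L2 L (r_ k). Proof. exact: L2_reduced. Qed.
Let sr : L2 L r. Proof. exact: L2_reduced. Qed.

(** Since [w] is fixed, pointwise convergence of the normals is enough for dominated convergence.
    The majorant [4 |w|^2] comes from [|r_k - r|^2 <= 2 |r_k|^2 + 2 |r|^2]. *)
Let reduced_cvg : l2ip L (r_ k - r) (r_ k - r) @[k --> \oo] --> (0 : R).
Proof.
have sd k := L2B (sr_ k) sr.
rewrite [X in _ --> X](_ : _ = \int[mu]_(x in `[0, L]) (fun=> (0 : R)) x); last first.
  by rewrite Rintegral_cst// mul0r.
apply: (@Rdominated_convergence _ _ (fun x => 4 * dot (w x) (w x))).
- by move=> k; apply: measurable_dot => i; case: (sd k i).
- exact: measurable_cst.
- move=> x xL; have -> : (0 : R) = dot (r x - r x) (r x - r x).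
    by rewrite subrr /dot big1// => i _; rewrite mxE mul0r.
  have c i : (r_ k - r) x 0 i @[k --> \oo] --> (r x - r x) 0 i.
    rewrite (_ : (fun k => _) = fun k =>
      (w x 0 i - (g_ k * dot (w x) (n_ k x)) * n_ k x 0 i) - r x 0 i); last first.
      by apply/funext => k; rewrite curve_subE /r_ /reduced !mxE.
    rewrite [X in _ --> X](_ : _ =
      (w x 0 i - (g * dot (w x) (n x)) * n x 0 i) - r x 0 i); last first.
      by rewrite /r /reduced !mxE.
    apply: cvgB; last exact: cvg_cst.
    apply: cvgB; first exact: cvg_cst.
    apply: cvgM; last exact: n_cvg.
    apply: cvgM; first exact: g_cvg.
    by apply: dot_convergence => j; [exact: cvg_cst|exact: n_cvg].
  exact: dot_convergence.
- by apply: integrable_scale; exact: integrable_dot.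
- move=> k x _; rewrite ger0_norm ?dot_ge0//.
  apply: le_trans (dot_sub_le _ _) _.
  have h1 := reduced_norm_le (w x) (g01_ k) (n_le1 k x).
  have h2 := reduced_norm_le (w x) g01 (n1 x).
  by rewrite /r_ /r; lra.
Qed.

Definition quad (gam : R) (v m : curve) : R :=
  \int[mu]_(x in `[0, L]) (dot (v x) (v x) - gam * dot (v x) (m x) ^+ 2).

Let a k : R := 2 * l2ip L (w_ k) (r_ k) - l2ip L w (r_ k).

Let l2ip_subr u v (f : curve) : L2 L u -> L2 L v -> L2 L f ->
  l2ip L f u = l2ip L f v + l2ip L (u - v) f.
Proof.
move=> su sv sf; rewrite l2ipC -[in RHS]scaleN1r [in RHS]addrC (_ : u + _ = -1 *: v + u); last exact: addrC.
by rewrite l2ip_lin// (l2ipC L f v); ring.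
Qed.

Let small (f_ : nat -> curve) (C : R) : (forall k, L2 L (f_ k)) -> (forall k, l2ip L (f_ k) (f_ k) <= C) ->
  l2ip L (r_ k - r) (f_ k) @[k --> \oo] --> (0 : R).
Proof.
move=> sf fC; apply: (@squeeze_dist _ _ (fun k =>
  Num.sqrt (l2ip L (r_ k - r) (r_ k - r)) * Num.sqrt C)).
  move=> k; rewrite subr0; apply: le_trans (l2ip_norm_le (L2B (sr_ k) sr) (sf k)) _.
  by rewrite ler_wpM2l ?sqrtr_ge0// ler_wsqrtr.
rewrite -[X in _ --> X](mul0r (Num.sqrt C)); apply: cvgM; last exact: cvg_cst.
by have := cvgn_sqrt reduced_cvg; rewrite sqrtr0.
Qed.

Let quad_reduced : quad g w n = l2ip L w r.
Proof. by apply: eq_Rintegral => x _; rewrite dot_reduced; ring. Qed.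

Let a_cvg : a @ \oo --> quad g w n.
Proof.
have c1 : l2ip L (w_ k) (r_ k) @[k --> \oo] --> l2ip L w r + 0.
  (* Weak times strong: the first term converges by weak convergence, the second because [r_ k]
     tends to [r] strongly while [w_ k] is bounded. *)
  rewrite (_ : (fun k => _) = fun k => l2ip L (w_ k) r + l2ip L (r_ k - r) (w_ k)).
    by apply: cvgD; [exact: w_weak|exact: small w_bnd].
  by apply/funext => k; exact: l2ip_subr.
have c2 : l2ip L w (r_ k) @[k --> \oo] --> l2ip L w r + 0.
  rewrite (_ : (fun k => _) = fun k => l2ip L w r + l2ip L (r_ k - r) w).
    apply: cvgD; first exact: cvg_cst.
    exact: (@small (fun=> w) (l2ip L w w)).
  by apply/funext => k; exact: l2ip_subr.
rewrite quad_reduced (_ : l2ip L w r = 2 * (l2ip L w r + 0) - (l2ip L w r + 0)); last by ring.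
apply: cvgB; last exact: c2.
by apply: cvgM; [exact: cvg_cst|exact: c1].
Qed.

Lemma integrable_quad (gam : R) (v m : curve) : L2 L v -> 0 <= gam <= 1 ->
  (forall i, measurable_fun `[0, L] (fun x => m x 0 i)) ->
  (forall x, dot (m x) (m x) <= 1) ->
  mu.-integrable `[0, L] (EFin \o (fun x => dot (v x) (v x) - gam * dot (v x) (m x) ^+ 2)).
Proof.
move=> sv gam01 mm m1; have mv i : measurable_fun `[0, L] (fun x => v x 0 i) by case: (sv i).
apply: (@integrable_dominated _ _ _ _ (fun x => dot (v x) (v x))).
- apply: measurable_funB; first exact: measurable_dot.
  by apply: measurable_funM => //; apply: measurable_funX; exact: measurable_dot.
- exact: integrable_dot.
- move=> x; rewrite ger0_norm ?reduced_quadratic_ge0// gerBl.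
  by case/andP: gam01 => g0 _; rewrite mulr_ge0 ?sqr_ge0.
Qed.

Let quad_expand k : quad (g_ k) (w_ k) (n_ k) = a k + quad (g_ k) (w_ k - w) (n_ k).
Proof.
have i1 := integrable_dot (sw_ k) (sr_ k).
have i2 := integrable_scale (-1) (integrable_dot sw (sr_ k)).
have i3 := integrable_quad (L2B (sw_ k) sw) (g01_ k) (mn_ k) (n_le1 k).
have i23 := integrable_lincomb 1 i2 i3.
transitivity (\int[mu]_(x in `[0, L]) (2 * dot (w_ k x) (r_ k x) +
   (1 * (-1 * dot (w x) (r_ k x)) + (dot ((w_ k - w) x) ((w_ k - w) x) -
   g_ k * dot ((w_ k - w) x) (n_ k x) ^+ 2)))).
  apply: eq_Rintegral => x _; rewrite (reduced_identity _ _ (w x)).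
  by have -> : (w_ k - w) x = w_ k x - w x by []; rewrite /r_; ring.
rewrite (Rintegral_lincomb _ i1 i23) (Rintegral_lincomb _ i2 i3).
rewrite RintegralZl//; last exact: integrable_dot.
by rewrite /a /l2ip /quad; ring.
Qed.

(** The lower bound yields lower semicontinuity under weak convergence, the upper one convergence of
    the energies when [w_ k] tends to [w] strongly. Both come from the remainder
    [quad (g_ k) (w_ k - w) (n_ k)]. *)
Lemma quad_asymptotics : exists2 a : nat -> R, a @ \oo --> quad g w n &
  forall k, a k <= quad (g_ k) (w_ k) (n_ k) <= a k + l2ip L (w_ k - w) (w_ k - w).
Proof.
exists a => [|k]; [exact: a_cvg|]; rewrite quad_expand lerD2l lerDl; apply/andP; split.
  by apply: Rintegral_ge0 => x _; exact: reduced_quadratic_ge0.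
have sd := L2B (sw_ k) sw.
apply: le_Rintegral => //.
- exact: integrable_quad.
- exact: integrable_dot.
- move=> x _; rewrite gerBl mulr_ge0 ?sqr_ge0//.
  by case/andP: (g01_ k).
Qed.

End reduced_convergence.
End quadratic_energy.

(** * Cubic splines *)

Section splines.
Variable R : realType.
Local Notation mu := (@lebesgue_measure R).
Implicit Types (f g u v w s y : R -> R) (a b c d x L : R) (p : {poly R}).

Lemma poly_primitive a b p : a <= b -> primitive_on a b (horner p) (horner p^`()).
Proof.
move=> ab; have h := C1_primitive ab (@derivable_horner _ p).
by rewrite derivE; apply: h; rewrite -derivE; exact: continuous_horner.
Qed.

Lemma hermite_poly a b (ua va ub vb : R) : a < b -> exists p,
  [/\ (size p <= 4)%N, p.[a] = ua, p^`().[a] = va, p.[b] = ub & p^`().[b] = vb].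
Proof.
move=> ab; have h0 : b - a != 0 by rewrite gt_eqF// subr_gt0.
(* In powers of [x - a] the first two coefficients are the data at [a]; value and slope at [b] then
   determine [c2] and [c3]. *)
pose c2 := (3 * (ub - ua) / (b - a) - 2 * va - vb) / (b - a).
pose c3 := (va + vb - 2 * (ub - ua) / (b - a)) / (b - a) ^+ 2.
pose t : {poly R} := 'X - a%:P.
exists (ua%:P + va *: t + c2 *: t ^+ 2 + c3 *: t ^+ 3).
have pE x : (ua%:P + va *: t + c2 *: t ^+ 2 + c3 *: t ^+ 3).[x] =
    ua + va * (x - a) + c2 * (x - a) ^+ 2 + c3 * (x - a) ^+ 3.
  by rewrite /t !hornerE /=; ring.
have dE x : (ua%:P + va *: t + c2 *: t ^+ 2 + c3 *: t ^+ 3)^`().[x] =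
    va + 2 * c2 * (x - a) + 3 * c3 * (x - a) ^+ 2.
  rewrite /t !(derivD, derivN, derivC, derivZ, deriv_exp, derivX) /=.
  rewrite ?(oppr0, addr0, add0r, mul1r, expr1); clearbody c2 c3.
  by rewrite !(hornerE, hornerMn) /=; ring.
split.
- rewrite (leq_trans (size_polyD _ _))// geq_max; apply/andP; split; last first.
    by rewrite (leq_trans (size_scale_leq _ _))// size_exp_XsubC.
  rewrite (leq_trans (size_polyD _ _))// geq_max; apply/andP; split; last first.
    by rewrite (leq_trans (size_scale_leq _ _))// size_exp_XsubC.
  rewrite (leq_trans (size_polyD _ _))// geq_max; apply/andP; split.
    by rewrite (leq_trans (size_polyC_leq1 _)).
  by rewrite (leq_trans (size_scale_leq _ _))// size_XsubC.
- by rewrite pE; ring.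
- by rewrite dE; ring.
- by rewrite pE /c2 /c3; field.
- by rewrite dE /c2 /c3; field.
Qed.

(** One integration by parts leaves a constant times the integral of the slope of the error; every
    boundary term vanishes because the error and its slope vanish at both ends. *)
Lemma hermite_orthogonal a b u v w p (c d : R) : a <= b ->
  primitive_on a b u v -> primitive_on a b v w ->
  p.[a] = u a -> p^`().[a] = v a -> p.[b] = u b -> p^`().[b] = v b ->
  \int[mu]_(x in `[a, b]) ((c + d * x) * (- 1 * p^`()^`().[x] + w x)) = 0.
Proof.
move=> ab uv vw pa pa' pb pb'.
have e1 := primitive_linear (-1) (poly_primitive p ab) uv.
have e2 := primitive_linear (-1) (poly_primitive p^`() ab) vw.
have q1 := poly_primitive (c%:P + d *: 'X) ab.
have qE : horner (c%:P + d *: 'X) = (fun x => c + d * x).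
  by apply/funext => x; rewrite !hornerE.
have qE' : horner (c%:P + d *: 'X)^`() = (fun=> d).
  by apply/funext => x; rewrite derivD derivC derivZ derivX !hornerE.
rewrite qE qE' in q1.
rewrite (primitive_integration_by_parts ab q1 e2) pa' pb'.
have ie1 := e1.1; rewrite RintegralZl//.
by rewrite -(primitive_sub e1)// pa pb; ring.
Qed.

(** The second derivative of the cubic is affine and the error [w - p''] is orthogonal to affine
    functions, so Pythagoras gives minimality. Constants are the competitors of interest, as a
    continuous function is nearly constant on small elements. *)
Lemma hermite_best_approximation a b u v w p (c : R) : a <= b ->
  primitive_on a b u v -> primitive_on a b v w -> sq_integrable a b w ->
  p.[a] = u a -> p^`().[a] = v a -> p.[b] = u b -> p^`().[b] = v b ->
  (size p <= 4)%N ->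
  \int[mu]_(x in `[a, b]) ((w x - p^`()^`().[x]) ^+ 2) <=
  \int[mu]_(x in `[a, b]) ((w x - c) ^+ 2).
Proof.
move=> ab uv vw sw pa pa' pb pb' sp.
set q := p^`()^`().
have [d0 [d1 qE]] : exists d0 d1, forall x, q.[x] = d0 + d1 * x.
  exists q`_0, q`_1 => x.
  have sq : (size q <= 2)%N.
    apply/leq_sizeP => j j2; rewrite !coef_deriv (nth_default 0 (n := j.+2)) ?mul0rn//.
    by rewrite (leq_trans sp).
  by rewrite (horner_coef_wide _ sq) !big_ord_recl big_ord0 /= expr0 expr1; ring.
have sq : sq_integrable a b (horner q).
  by apply: sq_integrable_continuous; apply: continuous_subspaceT; exact: continuous_horner.
have se : sq_integrable a b (fun x => - 1 * q.[x] + w x) by exact: sq_integrable_lincomb.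
have sr : sq_integrable a b (fun x => - 1 * c + q.[x]).
  by apply: sq_integrable_lincomb => //; exact: sq_integrable_cst.
have orth := hermite_orthogonal (d0 - c) d1 ab uv vw pa pa' pb pb'.
have i1 := sq_integrable_mul sr se.
have i2 := integrable_lincomb 1 se.2 sr.2.
have -> : \int[mu]_(x in `[a, b]) ((w x - c) ^+ 2) =
    \int[mu]_(x in `[a, b]) (2 * ((- 1 * c + q.[x]) * (- 1 * q.[x] + w x)) +
      (1 * (- 1 * q.[x] + w x) ^+ 2 + (- 1 * c + q.[x]) ^+ 2)).
  by apply: eq_Rintegral => x _; ring.
rewrite (Rintegral_lincomb _ i1 i2) (Rintegral_lincomb _ se.2 sr.2).
have -> : \int[mu]_(x in `[a, b]) ((- 1 * c + q.[x]) * (- 1 * q.[x] + w x)) = 0.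
  by rewrite -[RHS]orth; apply: eq_Rintegral => x _; rewrite -/q qE; ring.
have -> : \int[mu]_(x in `[a, b]) (w x - q.[x]) ^+ 2 =
   \int[mu]_(x in `[a, b]) (- 1 * q.[x] + w x) ^+ 2.
  by apply: eq_Rintegral => x _; ring.
by rewrite mulr0 add0r mul1r lerDl Rintegral_sq_ge0.
Qed.

Section assembly.
Variables (L : R) (J : nat) (z : nat -> R) (P : nat -> {poly R}).
Hypothesis part : mesh_partition L J z.

Lemma partition_le i j : (i <= j)%N -> (j <= J)%N -> z i <= z j.
Proof.
move=> ij jJ; elim: j ij jJ => [|j IHj]; first by rewrite leqn0 => /eqP ->.
rewrite leq_eqVlt => /predU1P[->//|]; rewrite ltnS => ij jJ.
by have [_ _ /(_ j jJ)/ltW] := part; apply: le_trans; apply: IHj => //; exact: ltnW.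
Qed.

Lemma partition_in j : (j <= J)%N -> z j \in `[0, L].
Proof.
have [z0 zJ _] := part => jJ; rewrite in_itv/= -z0 -zJ.
by rewrite !partition_le.
Qed.

Lemma partition_find x : x \in `[0, L] -> (0 < J)%N ->
  exists2 j, (j < J)%N & x \in `[z j, z j.+1].
Proof.
move=> + J0; rewrite in_itv/= => /andP[x0 xL].
have [z0 zJ _] := part.
have : exists j, (j < J)%N && (x <= z j.+1) by exists J.-1; rewrite prednK// leqnn zJ.
move=> ex; have [j /andP[jJ xj] jmin] := ex_minnP ex.
exists j => //; rewrite in_itv/= xj andbT.
case: j jJ xj jmin => [_ _ _|j jJ xj jmin]; first by rewrite z0.
rewrite leNgt; apply/negP => xj'.
have h : (j < J)%N && (x <= z j.+1) by rewrite (ltn_trans (ltnSn _) jJ) ltW.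
by have := jmin _ h; rewrite ltnn.
Qed.

(* the last element also owns its right end point *)
Definition element x : nat := find (fun j => x < z j.+1) (iota 0 J.-1).

Lemma elementP j x : (j < J)%N -> z j <= x -> x < z j.+1 -> element x = j.
Proof.
move=> jJ zx xz; rewrite /element.
have e1 : (j <= J.-1)%N by rewrite -ltnS prednK// (leq_ltn_trans _ jJ).
apply/eqP; rewrite eqn_leq; apply/andP; split.
  rewrite leqNgt; apply/negP => h.
  have := before_find 0%N h; rewrite nth_iota; first by rewrite add0n xz.
  by apply: leq_trans h _; rewrite -[X in (_ <= X)%N](size_iota 0); exact: find_size.
rewrite leqNgt; apply/negP => h.
have hs : (find (fun j => (x < z j.+1)%R) (iota 0 J.-1) < size (iota 0 J.-1))%N.
  by rewrite size_iota (leq_trans h).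
have := nth_find 0%N (_ : has (fun j => x < z j.+1) (iota 0 J.-1)).
rewrite has_find hs => /(_ isT); rewrite nth_iota; last by rewrite size_iota in hs.
rewrite add0n => xz'; suff : z (find (fun j => x < z j.+1) (iota 0 J.-1)).+1 <= z j.
  by move=> h2; have := lt_le_trans xz' (le_trans h2 zx); rewrite ltxx.
by apply: partition_le => //; exact: ltnW.
Qed.

Lemma element_last x : (0 < J)%N -> L <= x -> element x = J.-1.
Proof.
move=> J0 Lx; rewrite /element -[RHS](size_iota 0); apply: hasNfind.
apply/hasPn => j; rewrite mem_iota add0n => /andP[_ jJ].
rewrite -leNgt (le_trans _ Lx)//; have [_ <- _] := part.
by apply: partition_le => //; rewrite (leq_trans jJ)// leq_pred.
Qed.

Definition spline x : R := (P (element x)).[x].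
Definition spline1 x : R := (P (element x))^`().[x].
Definition spline2 x : R := (P (element x))^`()^`().[x].

(** Adjacent elements share the values of [f] and [f1] at their common node, so the primitives on
    the elements concatenate. The second derivative may jump there, which a null set absorbs. *)
Lemma spline2_primitive f f1 : 0 < L ->
  (forall j x, (j < J)%N -> x \in `[z j, z j.+1] -> f x = (P j).[x]) ->
  (forall j x, (j < J)%N -> x \in `[z j, z j.+1] -> f1 x = (P j)^`().[x]) ->
  [/\ primitive_on 0 L f f1, primitive_on 0 L f1 spline2 & sq_integrable 0 L spline2].
Proof.
move=> L0 fP f1P; have [z0 zJ zlt] := part.
have J0 : (0 < J)%N.
  by rewrite lt0n; apply/eqP => J0; move: L0; rewrite -zJ J0 z0 ltxx.
have elem j : (j < J)%N -> [/\ primitive_on (z j) (z j.+1) f f1,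
    primitive_on (z j) (z j.+1) f1 spline2 & sq_integrable (z j) (z j.+1) spline2].
  move=> jJ; have ab := zlt j jJ; have ab' := ltW ab.
  have p1 : primitive_on (z j) (z j.+1) f (horner (P j)^`()).
    by apply: primitive_eq (poly_primitive (P j) ab') => // x xj; rewrite (fP j).
  have p2 : primitive_on (z j) (z j.+1) f1 (horner (P j)^`()^`()).
    by apply: primitive_eq (poly_primitive (P j)^`() ab') => // x xj; rewrite (f1P j).
  have c1 : {within `[z j, z j.+1], continuous f1}.
    exact: primitive_continuous ab' p2.
  have s2E x : x \in `]z j, z j.+1[ -> (P j)^`()^`().[x] = spline2 x.
    by rewrite in_itv/= => /andP[zx xz]; rewrite /spline2 (elementP jJ (ltW zx) xz).
  have mh (q : {poly R}) (A : set R) : measurable_fun A (horner q).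
    apply: (@measurable_funS _ _ _ _ setT) => //.
    by apply: continuous_measurable_fun; exact: continuous_horner.
  have ms : measurable_fun `[z j, z j.+1] spline2.
    apply: (@measurable_fun_itv_cc _ _ _ false true).
    apply: eq_measurable_fun (mh (P j)^`()^`() _) => x; rewrite mem_setE.
    exact: s2E.
  have s2ae : {ae mu, forall x, x \in `[z j, z j.+1] -> (P j)^`()^`().[x] = spline2 x}.
    by apply: ae_eq_itvoo_cc; apply: aeW => x; exact: s2E.
  split.
  - apply: primitive_ae_eq p1; last exact: within_continuous_measurable.
    by apply: aeW => x xj; rewrite (f1P j).
  - exact: primitive_ae_eq p2.
  - have sq : sq_integrable (z j) (z j.+1) (horner (P j)^`()^`()).
      by apply: sq_integrable_continuous; apply: continuous_subspaceT; exact: continuous_horner.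
    exact: sq_integrable_ae sq ms s2ae.
have acc j : (j <= J)%N -> (0 < j)%N -> [/\ primitive_on 0 (z j) f f1,
    primitive_on 0 (z j) f1 spline2 & sq_integrable 0 (z j) spline2].
  elim: j => [//|[|j] IHj] jJ _; first by rewrite -z0; exact: elem.
  have [a1 a2 [a3 a3']] := IHj (ltnW jJ) isT; have [b1 b2 [b3 b3']] := elem _ jJ.
  have h1 : 0 <= z j.+1 by rewrite -z0 partition_le// ltnW.
  have h2 : z j.+1 <= z j.+2 by rewrite ltW// zlt.
  split; [exact: primitive_cat a1 b1|exact: primitive_cat a2 b2|].
  split; last exact: integrable_cat a3' b3'.
  have [/measurable_int/measurable_EFinP m _] := primitive_cat h1 h2 a2 b2.
  exact: m.
by rewrite -zJ; exact: acc.
Qed.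

Hypothesis match0 : forall j, (j.+1 < J)%N -> (P j).[z j.+1] = (P j.+1).[z j.+1].
Hypothesis match1 : forall j, (j.+1 < J)%N -> (P j)^`().[z j.+1] = (P j.+1)^`().[z j.+1].

(** At the right end of an element, [element] already points to the next one; the matching
    conditions, or at [L] the choice of the last element, give the value of the left polynomial. *)
Lemma splineE j x : (j < J)%N -> x \in `[z j, z j.+1] ->
  spline x = (P j).[x] /\ spline1 x = (P j)^`().[x].
Proof.
move=> jJ; rewrite in_itv/= => /andP[zx]; rewrite le_eqVlt => /predU1P[->|xz]; last first.
  by rewrite /spline /spline1 (elementP jJ zx xz).
have [_ zJ zlt] := part.
have [jJ'|] := ltnP j.+1 J.
  have e := elementP jJ' (lexx _) (zlt _ jJ').
  by rewrite /spline /spline1 e match0 ?match1.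
move=> Jj; have Ej : J = j.+1 by apply/eqP; rewrite eqn_leq Jj jJ.
have zL : z j.+1 = L by rewrite -zJ Ej.
have e : element (z j.+1) = J.-1.
  by apply: element_last; [exact: leq_ltn_trans jJ|rewrite zL].
by rewrite /spline /spline1 e Ej.
Qed.

End assembly.

End splines.

(** * Piecewise cubic curves and Hermite interpolants *)

Section curve_splines.
Variables (R : realType) (L : R).
Hypothesis L0 : 0 < L.
Local Notation mu := (@lebesgue_measure R).
Local Notation curve := (R -> 'rV[R]_3).
Implicit Types (u v w y : curve).

Lemma within_continuous_sub (a b c d : R) (f : R -> R) : a <= c -> d <= b ->
  {within `[a, b], continuous f} -> {within `[c, d], continuous f}.
Proof.
move=> ac db; apply: continuous_subspaceW; exact: sub_itvcc.
Qed.

Lemma primitive_derive (a b : R) (f g : R -> R) : primitive_on a b f g ->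
  {within `[a, b], continuous g} -> forall x, x \in `]a, b[ -> is_derive x 1 f (g x).
Proof.
move=> fg cg x xab; move: (xab); rewrite in_itv/= => /andP[ax xb].
have ab : a < b by exact: lt_trans xb.
have [+ _ _] := (continuous_within_itvP _ ab).1 cg => /(_ x xab) cx.
have [dF F'] := continuous_FTC1_closed xb fg.1 ax cx.
have dF' : is_derive x 1 (fun s => \int[mu]_(t in `[a, s]) g t) (g x).
  by apply: DeriveDef; [exact: dF|rewrite -derive1E; exact: F'].
have h := is_deriveD (is_derive_cst (f a) x 1) dF'; rewrite add0r in h.
apply: near_eq_is_derive h.
have := near_in_itvoo xab; apply: filterS => s yab.
by rewrite (fg.2 s)//; apply: subset_itv_oo_cc yab.
Qed.

Section partition.
Variables (J : nat) (z : nat -> R).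
Hypothesis part : mesh_partition L J z.

Let J0 : (0 < J)%N.
Proof.
have [z0 zJ _] := part.
by rewrite lt0n; apply/eqP => J0; move: L0; rewrite -zJ J0 z0 ltxx.
Qed.

Let elem_sub j : (j < J)%N -> 0 <= z j /\ z j.+1 <= L.
Proof.
move=> jJ; have [z0 zJ _] := part.
by rewrite -{1}z0 -zJ !(partition_le part)// ltnW.
Qed.

(** Being C1, a piecewise cubic curve has no jump in value or slope at the nodes, so its piecewise
    second derivative is also its weak one. *)
Lemma cubic_space_triple v : cubic_C1_space L J z v ->
  exists w s, H2_triple L v w s.
Proof.
move=> [[cv [w [cw dv]]] pv].
have {}pv i : exists P : nat -> {poly R}, forall j x, (j < J)%N ->
    x \in `[z j, z j.+1] -> v x 0 i = (P j).[x].
  have ex j : exists p : {poly R}, (j < J)%N ->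
      forall x, x \in `[z j, z j.+1] -> v x 0 i = p.[x].
    have [jJ|] := boolP (j < J)%N; last by exists 0.
    by have [p [_ pP]] := pv j i jJ; exists p.
  by have [P PP] := choice ex; exists P => j x jJ; exact: PP.
have {pv}[P PP] := choice pv.
(* Differentiability is given in the open interval only; continuity of [w] extends the identity to
   the ends of the element. *)
have P1 i j x : (j < J)%N -> x \in `[z j, z j.+1] -> w x 0 i = (P i j)^`().[x].
  move=> jJ; have [_ _ /(_ j jJ) zz] := part; have [zj zj1] := elem_sub jJ.
  move: x; apply: within_continuous_oo_eq => //.
  - by apply: within_continuous_sub zj zj1 _; move: i; apply/within_continuous_rowP.
  - by apply: continuous_subspaceT; exact: continuous_horner.
  move=> x xz; have xL : x \in `]0, L[.
    by move: xz; rewrite !in_itv/= => /andP[h1 h2]; rewrite (le_lt_trans zj h1) (lt_le_trans h2 zj1).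
  have d1 := dv x i xL.
  have d2 : is_derive x 1 (horner (P i j)) (P i j)^`().[x].
    by apply: DeriveDef; [exact: derivable_horner|rewrite derivE derive1E].
  have d3 : is_derive x 1 (fun t => v t 0 i) (P i j)^`().[x].
    apply: near_eq_is_derive d2; have := near_in_itvoo xz; apply: filterS => t tz.
    by rewrite (PP i j t jJ)//; apply: subset_itv_oo_cc tz.
  by have [_ <-] := d1; have [_ <-] := d3.
exists w, (fun x => \row_i spline2 J z (P i) x) => i.
have [h1 h2 h3] := spline2_primitive part L0 (fun j x => PP i j x) (fun j x => P1 i j x).
have E : (fun x => (\row_i spline2 J z (P i) x) 0 i) = spline2 J z (P i).
  by apply/funext => x; rewrite mxE.
by rewrite E; split.
Qed.

(** On each element the best approximation property is used with the constant [y (z j)], for which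
    [|h - y (z j)|^2 <= 2 |h - y|^2 + 2 e^2]. *)
Lemma spline_error (f g h y : R -> R) (P : nat -> {poly R}) (e : R) :
  primitive_on 0 L f g -> primitive_on 0 L g h -> sq_integrable 0 L h ->
  {within `[0, L], continuous y} ->
  (forall j, (j < J)%N -> [/\ (size (P j) <= 4)%N, (P j).[z j] = f (z j),
    (P j)^`().[z j] = g (z j), (P j).[z j.+1] = f (z j.+1) &
    (P j)^`().[z j.+1] = g (z j.+1)]) ->
  sq_integrable 0 L (spline2 J z P) ->
  (forall j x, (j < J)%N -> x \in `[z j, z j.+1] -> `|y x - y (z j)| <= e) ->
  \int[mu]_(x in `[0, L]) ((h x - spline2 J z P x) ^+ 2) <=
  \int[mu]_(x in `[0, L]) (2 * (h x - y x) ^+ 2 + 2 * e ^+ 2).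
Proof.
move=> fg gh sh cy PP ss ye; have [z0 zJ zlt] := part.
have sy := sq_integrable_continuous cy.
have i1 : mu.-integrable `[0, L] (EFin \o (fun x => (h x - spline2 J z P x) ^+ 2)).
  by have [] := sq_integrable_sub sh ss.
have i2 : mu.-integrable `[0, L] (EFin \o (fun x => 2 * (h x - y x) ^+ 2 + 2 * e ^+ 2)).
  apply: integrable_lincomb; first by have [] := sq_integrable_sub sh sy.
  exact: sq_integrable_integrable (sq_integrable_cst _ _ _).
have elem j : (j < J)%N ->
    \int[mu]_(x in `[z j, z j.+1]) ((h x - spline2 J z P x) ^+ 2) <=
    \int[mu]_(x in `[z j, z j.+1]) (2 * (h x - y x) ^+ 2 + 2 * e ^+ 2).
  move=> jJ; have ab := ltW (zlt j jJ); have [zj zj1] := elem_sub jJ.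
  have [s4 pa pa' pb pb'] := PP j jJ.
  have sh' := sq_integrable_sub_itvcc zj zj1 sh.
  have ss' := sq_integrable_sub_itvcc zj zj1 ss.
  have best := hermite_best_approximation (y (z j)) ab (primitive_restrict fg zj zj1)
    (primitive_restrict gh zj zj1) sh' pa pa' pb pb' s4.
  rewrite (_ : \int[mu]_(x in `[z j, z j.+1]) ((h x - spline2 J z P x) ^+ 2) =
    \int[mu]_(x in `[z j, z j.+1]) ((h x - (P j)^`()^`().[x]) ^+ 2)); last first.
    apply: ae_eq_Rintegral.
    - apply: ae_eq_itvoo_cc; apply: aeW => x; rewrite in_itv/= => /andP[zx xz].
      by rewrite /spline2 (elementP part jJ (ltW zx) xz).
    - by have [/measurable_funX] := sq_integrable_sub sh' ss'; exact.
    - apply: measurable_funX; apply: measurable_funB; first by case: sh'.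
      apply: within_continuous_measurable; apply: continuous_subspaceT.
      exact: continuous_horner.
  apply: le_trans best _; apply: le_Rintegral => //.
  - by have [] := sq_integrable_sub sh' (sq_integrable_cst _ _ (y (z j))).
  - exact: integrable_sub_itvcc i2.
  - move=> x xz; have h1 := ye j x jJ xz.
    have h2 : (y x - y (z j)) ^+ 2 <= e ^+ 2.
      rewrite -(real_normK (num_real (y x - y (z j)))).
      by rewrite ler_pXn2r// nnegrE (le_trans _ h1).
    move: h2; rewrite !expr2.
    have := sqr_ge0 (h x - y x - (y x - y (z j))); rewrite expr2; nra.
have acc j : (j <= J)%N ->
    \int[mu]_(x in `[0, z j]) ((h x - spline2 J z P x) ^+ 2) <=
    \int[mu]_(x in `[0, z j]) (2 * (h x - y x) ^+ 2 + 2 * e ^+ 2).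
  elim: j => [_|j IHj jJ]; first by rewrite z0 set_itv1 !Rintegral_set1.
  have [zj zj1] := elem_sub jJ; have ab := ltW (zlt j jJ).
  rewrite (Rintegral_cat zj ab); last exact: integrable_sub_itvcc i1.
  rewrite [leRHS](Rintegral_cat zj ab); last exact: integrable_sub_itvcc i2.
  by apply: lerD; [exact/IHj/ltnW|exact: elem].
by rewrite -zJ; exact: acc.
Qed.

(** The estimate compares with an arbitrary continuous [y], since [u''] is merely square integrable
    and has no modulus of continuity. The factor 6 is twice the number of components. *)
Lemma cubic_interpolant u : H2 L u -> exists U,
  [/\ cubic_C1_space L J z U, H2 L U,
      forall j, (j <= J)%N -> U (z j) = u (z j) /\ D1 L U (z j) = D1 L u (z j)
    & forall y (e : R), {within `[0, L], continuous y} ->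
      (forall j x i, (j < J)%N -> x \in `[z j, z j.+1] ->
        `|y x 0 i - y (z j) 0 i| <= e) ->
      l2ip L (D2 L u - D2 L U) (D2 L u - D2 L U) <=
      2 * l2ip L (D2 L u - y) (D2 L u - y) + 6 * L * e ^+ 2].
Proof.
move=> Hu; have [z0 zJ zlt] := part.
have T := H2_tripleP L0 Hu.
have ex i : exists P : nat -> {poly R}, forall j, (j < J)%N ->
    [/\ (size (P j) <= 4)%N, (P j).[z j] = u (z j) 0 i,
    (P j)^`().[z j] = D1 L u (z j) 0 i, (P j).[z j.+1] = u (z j.+1) 0 i &
    (P j)^`().[z j.+1] = D1 L u (z j.+1) 0 i].
  have ex j : exists p : {poly R}, (j < J)%N ->
    [/\ (size p <= 4)%N, p.[z j] = u (z j) 0 i,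
    p^`().[z j] = D1 L u (z j) 0 i, p.[z j.+1] = u (z j.+1) 0 i &
    p^`().[z j.+1] = D1 L u (z j.+1) 0 i].
    have [jJ|] := boolP (j < J)%N; last by exists 0.
    by have [p pP] := hermite_poly (u (z j) 0 i) (D1 L u (z j) 0 i)
      (u (z j.+1) 0 i) (D1 L u (z j.+1) 0 i) (zlt j jJ); exists p.
  by have [P PP] := choice ex; exists P.
have {ex}[P PP] := choice ex.
have m0 i j : (j.+1 < J)%N -> (P i j).[z j.+1] = (P i j.+1).[z j.+1].
  by move=> jJ; have [_ _ _ -> _] := PP i _ (ltnW jJ); have [_ -> _ _ _] := PP i _ jJ.
have m1 i j : (j.+1 < J)%N -> (P i j)^`().[z j.+1] = (P i j.+1)^`().[z j.+1].
  by move=> jJ; have [_ _ _ _ ->] := PP i _ (ltnW jJ); have [_ _ -> _ _] := PP i _ jJ.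
pose U : curve := fun x => \row_i spline J z (P i) x.
pose W : curve := fun x => \row_i spline1 J z (P i) x.
pose S : curve := fun x => \row_i spline2 J z (P i) x.
have UE i : (fun x => U x 0 i) = spline J z (P i) by apply/funext => x; rewrite mxE.
have WE i : (fun x => W x 0 i) = spline1 J z (P i) by apply/funext => x; rewrite mxE.
have SE i : (fun x => S x 0 i) = spline2 J z (P i) by apply/funext => x; rewrite mxE.
have TU : H2_triple L U W S.
  move=> i; rewrite UE WE SE.
  have [//|//|h1 h2 h3] := @spline2_primitive R L J z (P i) part (spline J z (P i))
     (spline1 J z (P i)) L0.
  - by move=> j x jJ xz; have [] := splineE part (m0 i) (m1 i) jJ xz.
  - by move=> j x jJ xz; have [] := splineE part (m0 i) (m1 i) jJ xz.
  - by split.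
have node j : (j <= J)%N -> U (z j) = u (z j) /\ W (z j) = D1 L u (z j).
  rewrite leq_eqVlt => /predU1P[->|jJ].
    have jJ : (J.-1 < J)%N by rewrite prednK.
    have xz : z J \in `[z J.-1, z J.-1.+1].
      by rewrite in_itv/= prednK// lexx andbT (partition_le part)// leq_pred.
    split; apply/rowP => i; rewrite mxE; have [e1 e2] := splineE part (m0 i) (m1 i) jJ xz.
      by rewrite e1; have [_ _ _ + _] := PP i _ jJ; rewrite prednK.
    by rewrite e2; have [_ _ _ _] := PP i _ jJ; rewrite prednK.
  have xz : z j \in `[z j, z j.+1] by rewrite in_itv/= lexx ltW// zlt.
  split; apply/rowP => i; rewrite mxE; have [e1 e2] := splineE part (m0 i) (m1 i) jJ xz.
    by rewrite e1; have [_ -> _ _ _] := PP i _ jJ.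
  by rewrite e2; have [_ _ -> _ _] := PP i _ jJ.
have cub : cubic_C1_space L J z U.
  split.
    split.
      apply/within_continuous_rowP => i; have [h1 _ _] := TU i.
      exact: primitive_continuous (ltW L0) h1.
    exists W; have cW i : {within `[0, L], continuous (fun x => W x 0 i)}.
      by have [_ h2 _] := TU i; exact: primitive_continuous (ltW L0) h2.
    split; first exact/within_continuous_rowP.
    by move=> x i xL; have [h1 _ _] := TU i; exact: (primitive_derive h1 (cW i)).
  move=> j i jJ; exists (P i j); split; first by have [] := PP i j jJ.
  by move=> x xz; rewrite mxE; have [] := splineE part (m0 i) (m1 i) jJ xz.
have sS : L2 L S by move=> i; have [_ _] := TU i.
have PP' := PP.
clearbody U W S.
have [HU D1U D2U] := triple_H2 L0 TU.
exists U; split => //.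
  move=> j jJ; have [n1 n2] := node j jJ; split => //.
  by rewrite -n2; apply: D1U; exact: partition_in part _ jJ.
move=> y e cy ye.
have sy : L2 L y.
  by move=> i; apply: sq_integrable_continuous; move: i; exact/within_continuous_rowP.
have su := H2_D2 Hu; have sU := H2_D2 HU.
have s1 := L2B su sU; have s2 := L2B su sS.
have ae i : {ae mu, forall x, x \in `[0, L] ->
    (D2 L u - D2 L U) x 0 i = (D2 L u - S) x 0 i}.
  apply: filterS (D2U i); first exact: (ae_filter_ringOfSetsType mu).
  move=> x h xL; rewrite curve_subE; apply: etrans (esym (curve_subE _ _ _ _)).
  exact: (congr1 (fun r : R => D2 L u x 0 i - r) (h xL)).
have -> : l2ip L (D2 L u - D2 L U) (D2 L u - D2 L U) = l2ip L (D2 L u - S) (D2 L u - S).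
  exact: l2ip_sq_ae ae.
have comp i : \int[mu]_(x in `[0, L]) ((D2 L u - S) x 0 i ^+ 2) <=
    2 * \int[mu]_(x in `[0, L]) ((D2 L u - y) x 0 i ^+ 2) + 2 * L * e ^+ 2.
  have [p1 p2 p3] := T i.
  have cyi : {within `[0, L], continuous (fun x => y x 0 i)}.
    by move: i {p1 p2 p3}; exact/within_continuous_rowP.
  have sSi : sq_integrable 0 L (spline2 J z (P i)) by have := sS i; rewrite -SE.
  have := spline_error p1 p2 p3 cyi (PP' i) sSi (fun j x jJ xz => ye j x i jJ xz).
  have -> : \int[mu]_(x in `[0, L]) (2 * (D2 L u x 0 i - y x 0 i) ^+ 2 + 2 * e ^+ 2) =
    2 * \int[mu]_(x in `[0, L]) ((D2 L u - y) x 0 i ^+ 2) + 2 * L * e ^+ 2.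
    have E : (fun x => (D2 L u - y) x 0 i ^+ 2) = (fun x => (D2 L u x 0 i - y x 0 i) ^+ 2).
      by apply/funext => x; rewrite curve_subE.
    rewrite E.
    have [_ i1] := sq_integrable_sub p3 (sy i).
    have ic := sq_integrable_integrable (sq_integrable_cst 0 L (2 * e ^+ 2)).
    rewrite (Rintegral_lincomb _ i1 ic); congr (_ + _).
    by rewrite Rintegral_itv_cst; [ring|exact: ltW].
  apply: le_trans; rewrite le_eqVlt; apply/orP; left; apply/eqP.
  by apply: eq_Rintegral => x _; rewrite curve_subE; congr ((_ - _) ^+ 2); rewrite -SE.
have s3 := L2B su sy.
rewrite (l2ip_sqE s2) (l2ip_sqE s3).
apply: (@le_trans _ _ (\sum_i (2 * \int[mu]_(x in `[0, L]) ((D2 L u - y) x 0 i ^+ 2) +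
    2 * L * e ^+ 2))); first by apply: ler_sum => i _; exact: comp.
rewrite big_split/= -mulr_sumr lerD2l !big_ord_recl big_ord0.
by rewrite le_eqVlt; apply/orP; left; apply/eqP; ring.
Qed.

End partition.
End curve_splines.

(** * Boundary conditions *)

Section boundary_conditions.
Variables (R : realType) (L : R).
Hypothesis L0 : 0 < L.
Local Notation mu := (@lebesgue_measure R).
Local Notation curve := (R -> 'rV[R]_3).
Implicit Types (u v w : curve) (c d : 'rV[R]_3).

Let sum3 (r : R) : \sum_(j < 3) r = 3 * r.
Proof. by rewrite !big_ord_recl big_ord0; ring. Qed.

Lemma poly_curve_triple (p : 'I_3 -> {poly R}) : H2_triple L
  (fun x => \row_i (p i).[x]) (fun x => \row_i (p i)^`().[x])
  (fun x => \row_i (p i)^`()^`().[x]).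
Proof.
move=> i.
have E (q : 'I_3 -> {poly R}) : (fun x => (\row_i (q i).[x] : 'rV[R]_3) 0 i) = horner (q i).
  by apply/funext => x; rewrite mxE.
rewrite (E p) (E (fun i => (p i)^`())) (E (fun i => (p i)^`()^`())).
split; [exact: poly_primitive (ltW L0)|exact: poly_primitive (ltW L0)|].
by apply: sq_integrable_continuous; apply: continuous_subspaceT; exact: continuous_horner.
Qed.

Lemma constant_triple c : H2_triple L (fun=> c) (fun=> 0) (fun=> 0).
Proof.
have := poly_curve_triple (fun i => (c 0 i)%:P).
rewrite (_ : (fun x => \row_i _) = (fun=> c)); last first.
  by apply/funext => x; apply/rowP => i; rewrite mxE hornerC.
rewrite (_ : (fun x => \row_i (c 0 i)%:P^`().[x]) = (fun=> 0)); last first.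
  by apply/funext => x; apply/rowP => i; rewrite !mxE derivC horner0.
rewrite (_ : (fun x => \row_i (c 0 i)%:P^`()^`().[x]) = (fun=> 0))//.
by apply/funext => x; apply/rowP => i; rewrite !mxE derivC deriv0 horner0.
Qed.

Lemma H2_constant c : H2 L (fun=> c).
Proof. by have [] := triple_H2 L0 (constant_triple c). Qed.

Lemma triple_l2ip_D2 u v w : H2_triple L u v w ->
  l2ip L (D2 L u) (D2 L u) = l2ip L w w.
Proof.
move=> T; have [Hu _ ae] := triple_H2 L0 T.
have s1 := H2_D2 Hu; have s2 : L2 L w by move=> i; have [] := T i.
exact: l2ip_sq_ae ae.
Qed.

Variables (ell : nat) (Lbc : curve -> 'rV[R]_ell) (lbc : 'rV[R]_ell).
Hypothesis Lbc_bounded : bounded_linear L Lbc.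
Hypothesis Lbc_boundary : boundary_dependent L Lbc.
Hypothesis seminorm_is_norm :
  norm_on L [set v | H2 L v /\ Lbc v = 0] (fun v => L2norm L (D2 L v)).

Let f c := Lbc (fun=> c).

Let f_lin (a : R) c d : f (a *: c + d) = a *: f c + f d.
Proof.
by rewrite /f -(Lbc_bounded.1 a _ _ (H2_constant c) (H2_constant d)).
Qed.

Let f0 : f 0 = 0.
Proof.
have := f_lin 1 0 0; rewrite scaler0 addr0 scale1r => /eqP.
by rewrite -subr_eq0 opprD addrA subrr sub0r oppr_eq0 => /eqP.
Qed.

(** A constant curve has vanishing second derivative, so on the kernel of [Lbc] the norm property
    annihilates it. *)
Let f_inj c : f c = 0 -> c = 0.
Proof.
move=> fc; have [_ _ /(_ (fun=> c))] := seminorm_is_norm.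
move=> /(_ (conj (H2_constant c) fc)) h.
apply: (h _ 0 (left_in_itvcc L0)); rewrite /L2norm -/(l2ip L (D2 L (fun=> c)) (D2 L (fun=> c))).
rewrite (triple_l2ip_D2 (constant_triple c)).
rewrite (_ : l2ip _ _ _ = 0) ?sqrtr0//.
rewrite /l2ip (_ : (fun x : R => dot 0 0) = (fun=> 0)); first by rewrite Rintegral_cst// mul0r.
by apply/funext => x; rewrite /dot big1// => i _; rewrite mxE mul0r.
Qed.

(* Linear maps on finite-dimensional spaces with trivial kernel are bounded below. *)
Lemma Lbc_constant_bound : exists C : R, forall c i, `|c 0 i| <= C * `|Lbc (fun=> c)|.
Proof.
pose A : 'M[R]_(3, ell) := \matrix_(i, j) f (delta_mx 0 i) 0 j.
have fE c : f c = c *m A.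
  have fsum (s : seq 'I_3) : f (\sum_(i <- s) c 0 i *: delta_mx 0 i) =
      \sum_(i <- s) c 0 i *: f (delta_mx 0 i).
    elim: s => [|i s IHs]; first by rewrite !big_nil f0.
    by rewrite !big_cons f_lin IHs.
  rewrite [in LHS](row_sum_delta c) fsum; apply/rowP => j.
  rewrite summxE mxE; apply: eq_bigr => i _.
  by rewrite !mxE.
have free : row_free A.
  rewrite -kermx_eq0; apply/eqP/row_matrixP => i; rewrite row0.
  apply: f_inj; rewrite fE -row_mul mulmx_ker; exact: row0.
have [B AB] := row_freeP free.
exists (\sum_i \sum_j `|B j i|) => c i.
have cE : c = f c *m B by rewrite fE -mulmxA AB mulmx1.
have -> : c 0 i = \sum_j f c 0 j * B j i by rewrite {1}cE mxE.
rewrite -/(f c); apply: le_trans (ler_norm_sum _ _ _) _.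
rewrite mulr_suml (bigD1 i)//=; apply: ler_wpDr.
  by apply: sumr_ge0 => k _; rewrite mulr_ge0// sumr_ge0.
rewrite mulr_suml; apply: ler_sum => j _.
by rewrite normrM mulrC ler_wpM2l//; exact: row_entry_le_norm.
Qed.

Lemma within_continuous_bounded (g : R -> R) : {within `[0, L], continuous g} ->
  exists2 K, 0 <= K & forall x, x \in `[0, L] -> `|g x| <= K.
Proof.
move=> cg; have := continuous_compact cg (@segment_compact _ 0 L).
move=> /compact_bounded[M [_ MP]].
exists (`|M| + 1); first by rewrite addr_ge0.
move=> x xL; apply: (MP (`|M| + 1)); last by exists x.
by rewrite (le_lt_trans (ler_norm M))// ltrDl.
Qed.

(** Let [q] be the cubic that starts at 0, ends at [u L - u 0] and has the end slopes of [u]. Then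
    [u] and [u 0 + q] share all boundary data, so [Lbc] of the constant [u 0] equals [lbc - Lbc q].
    Here [q] is controlled by [M], and [Lbc] is bounded below on constants. *)
Lemma initial_point_bound (M : R) : 0 <= M -> exists C : R, forall u, H2 L u -> Lbc u = lbc ->
  (forall i, [/\ `|u L 0 i - u 0 0 i| <= M, `|D1 L u 0 0 i| <= M & `|D1 L u L 0 i| <= M]) ->
  forall i, `|u 0 0 i| <= C.
Proof.
move=> M0; have [C CP] := Lbc_constant_bound.
(* Hermite basis cubics for the slope at 0, the value at [L] and the slope at [L]; the one for the
   value at 0 is left out because [q] starts at 0. *)
have [p1 [_ p1a p1a' p1b p1b']] := hermite_poly 0 1 0 0 L0.
have [p2 [_ p2a p2a' p2b p2b']] := hermite_poly 0 0 1 0 L0.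
have [p3 [_ p3a p3a' p3b p3b']] := hermite_poly 0 0 0 1 L0.
have bnd (p : {poly R}) : exists2 K, 0 <= K & forall x, x \in `[0, L] -> `|p.[x]| <= K.
  by apply: within_continuous_bounded; apply: continuous_subspaceT; exact: continuous_horner.
have [K1 K10 K1P] := bnd p1^`()^`().
have [K2 K20 K2P] := bnd p2^`()^`().
have [K3 K30 K3P] := bnd p3^`()^`().
have [_ [C0 C0P]] := Lbc_bounded.
pose KM := M * (K1 + K2 + K3).
have [K KP] : exists K : R, forall v, H2 L v -> H2norm L v <= K * Num.sqrt (h2ip L v v).
  by eexists => v; exact: H2norm_le.
pose N := `|C0| * (`|K| * Num.sqrt (3 * M ^+ 2 + 3 * L * KM ^+ 2)).
exists (`|C| * (`|lbc| + N)) => u Hu Lu uM i.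
pose p i := D1 L u 0 0 i *: p1 + (u L 0 i - u 0 0 i) *: p2 + D1 L u L 0 i *: p3.
have T := poly_curve_triple p.
set q : curve := (fun x => \row_i (p i).[x]) in T.
set q' : curve := (fun x => \row_i (p i)^`().[x]) in T.
set q'' : curve := (fun x => \row_i (p i)^`()^`().[x]) in T.
have q0 : q 0 = 0.
  by apply/rowP => j; rewrite !mxE !hornerE p1a p2a p3a; ring.
have qL : q L = u L - u 0.
  by apply/rowP => j; rewrite !mxE !hornerE p1b p2b p3b; ring.
have q'0 : q' 0 = D1 L u 0.
  by apply/rowP => j; rewrite !mxE !derivD !derivZ !hornerE p1a' p2a' p3a'; ring.
have q'L : q' L = D1 L u L.
  by apply/rowP => j; rewrite !mxE !derivD !derivZ !hornerE p1b' p2b' p3b'; ring.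
have q''le x : x \in `[0, L] -> dot (q'' x) (q'' x) <= 3 * KM ^+ 2.
  move=> xL; rewrite dot_sqE; apply: (@le_trans _ _ (\sum_(j < 3) KM ^+ 2)); last first.
    by rewrite sum3.
  apply: ler_sum => j _; rewrite mxE !derivD !derivZ !hornerE.
  have [m1 m2 m3] := uM j.
  rewrite -(real_normK (num_real _)) ler_pXn2r ?nnegrE//; last first.
    by rewrite mulr_ge0// !addr_ge0.
  rewrite /KM !mulrDr; apply: le_trans (ler_normD _ _) _; apply: lerD; last first.
    by rewrite normrM ler_pM// K3P.
  by apply: le_trans (ler_normD _ _) _; apply: lerD; rewrite normrM ler_pM// (K1P, K2P).
clearbody q q' q''.
have [Hq D1q _] := triple_H2 L0 T.
have h2q : h2ip L q q <= 3 * M ^+ 2 + 3 * L * KM ^+ 2.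
  have d1 : dot (q 0) (q 0) = 0.
    by rewrite q0 /dot big1// => j _; rewrite mxE mul0r.
  have d2 : dot (D1 L q 0) (D1 L q 0) <= 3 * M ^+ 2.
    rewrite (D1q _ (left_in_itvcc L0)) q'0 dot_sqE; apply: (@le_trans _ _ (\sum_(j < 3) M ^+ 2)); last first.
      by rewrite sum3.
    apply: ler_sum => j _; have [_ m2 _] := uM j.
    by rewrite -(real_normK (num_real _)) ler_pXn2r ?nnegrE.
  have d3 : l2ip L (D2 L q) (D2 L q) <= 3 * L * KM ^+ 2.
    rewrite (triple_l2ip_D2 T).
    have s2 : L2 L q'' by move=> j; have [] := T j.
    have -> : 3 * L * KM ^+ 2 = \int[mu]_(x in `[0, L]) (3 * KM ^+ 2).
      by rewrite Rintegral_itv_cst ?ltW//; ring.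
    apply: le_Rintegral => //; first exact: integrable_dot.
    exact: sq_integrable_integrable (sq_integrable_cst _ _ _).
  have alg (x1 x2 x3 y2 y3 : R) : x1 = 0 -> x2 <= y2 -> x3 <= y3 -> x1 + x2 + x3 <= y2 + y3 by lra.
  exact: (alg _ _ _ _ _ d1 d2 d3).
have Hc := H2_constant (u 0).
have Lq : `|Lbc q| <= N.
  apply: le_trans (C0P q Hq) _; apply: (@le_trans _ _ (`|C0| * H2norm L q)).
    by rewrite ler_wpM2r ?H2norm_ge0// ler_norm.
  rewrite ler_wpM2l//; apply: le_trans (KP q Hq) _.
  apply: (@le_trans _ _ (`|K| * Num.sqrt (h2ip L q q))).
    by rewrite ler_wpM2r ?sqrtr_ge0// ler_norm.
  by rewrite ler_wpM2l// ler_wsqrtr.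
have Hs := H2_lin L0 1 Hc Hq.
have D1s x : x \in `[0, L] -> D1 L (1 *: (fun=> u 0) + q) x = q' x.
  move=> xL; rewrite (D1_lin L0 1 Hc Hq xL).
  have [_ -> //] := triple_H2 L0 (constant_triple (u 0)).
  by rewrite scaler0 add0r D1q.
have E : Lbc u = Lbc (1 *: (fun=> u 0) + q).
  apply: Lbc_boundary => //.
  - have -> : (1 *: (fun=> u 0) + q) 0 = 1 *: u 0 + q 0 by [].
    by rewrite scale1r q0 addr0.
  - have -> : (1 *: (fun=> u 0) + q) L = 1 *: u 0 + q L by [].
    by rewrite scale1r qL addrC subrK.
  - by rewrite D1s ?left_in_itvcc// q'0.
  - by rewrite D1s ?right_in_itvcc// q'L.
have Ec : Lbc (fun=> u 0) = lbc - Lbc q.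
  by rewrite -Lu E (Lbc_bounded.1 1 _ _ Hc Hq) scale1r addrK.
apply: le_trans (CP (u 0) i) _; rewrite Ec.
apply: (@le_trans _ _ (`|C| * `|lbc - Lbc q|)); first by rewrite ler_wpM2r// ler_norm.
by rewrite ler_wpM2l// (le_trans (ler_normB _ _))// lerD2l.
Qed.

Lemma H2_coercive (M : R) : exists M' : R, forall u, H2 L u -> Lbc u = lbc ->
  dot (D1 L u 0) (D1 L u 0) <= 1 -> dot (D1 L u L) (D1 L u L) <= 1 ->
  l2ip L (D2 L u) (D2 L u) <= M -> h2ip L u u <= M'.
Proof.
(* Bounds [|u L - u 0|^2]: the factor [L] is the Hoelder estimate, the bracket bounds the squared L2
   norm of [u'] through its initial slope and [M]. *)
pose B := L * (2 * L + 2 * L ^+ 2 * `|M|).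
have B0 : 0 <= B by rewrite mulr_ge0 ?addr_ge0 ?mulr_ge0 ?sqr_ge0// ltW.
have N0 : 0 <= 1 + Num.sqrt B by rewrite addr_ge0// sqrtr_ge0.
have [C CP] := initial_point_bound N0.
exists (3 * `|C| ^+ 2 + 1 + M) => u Hu Lu d0 dL l2.
have entry_le (c : 'rV[R]_3) i : dot c c <= 1 -> `|c 0 i| <= 1.
  move=> c1; rewrite -(@ler_pXn2r _ 2)// ?nnegrE// real_normK ?num_real// expr1n.
  exact: le_trans (dot_entry _ _) c1.
have d1 := curve_L2_bound L0 (H2_primitive2 L0 Hu) (H2_D2 Hu).
have dist := curve_holder (H2_primitive1 L0 Hu) (H2_D1_L2 L0 Hu) (right_in_itvcc L0) (left_in_itvcc L0).
have uC i : `|u 0 0 i| <= C.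
  apply: CP => // j; split.
  - apply: (@le_trans _ _ (Num.sqrt B)); last by rewrite lerDr.
    rewrite -sqrtr_sqr ler_wsqrtr//.
    have e1 := dot_entry (u L - u 0) j; rewrite !mxE in e1; apply: le_trans e1 _.
    apply: le_trans dist _; rewrite subr0 gtr0_norm//; apply: ler_wpM2l; first exact: ltW.
    apply: le_trans d1 _; apply: lerD.
      by rewrite -[leRHS]mulr1; apply: ler_wpM2l => //; rewrite mulr_ge0// ltW.
    by apply: ler_wpM2l; [rewrite mulr_ge0// sqr_ge0|exact: le_trans l2 (ler_norm _)].
  - by apply: le_trans (entry_le _ j d0) _; rewrite lerDl sqrtr_ge0.
  - by apply: le_trans (entry_le _ j dL) _; rewrite lerDl sqrtr_ge0.
have dd : dot (u 0) (u 0) <= 3 * `|C| ^+ 2.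
  rewrite dot_sqE; apply: (@le_trans _ _ (\sum_(j < 3) `|C| ^+ 2)); last first.
    by rewrite sum3.
  apply: ler_sum => j _; rewrite -(real_normK (num_real (u 0 0 j))) ler_pXn2r ?nnegrE//.
  by apply: le_trans (uC j) (ler_norm _).
exact: lerD (lerD dd d0) l2.
Qed.

End boundary_conditions.

(** * Energies and limits of curves *)

Section energies.
Variables (R : realType) (L : R).
Hypothesis L0 : 0 < L.
Local Notation mu := (@lebesgue_measure R).
Local Notation curve := (R -> 'rV[R]_3).
Implicit Types (u v w : curve).

Lemma enorm_sq n (c : 'rV[R]_n) : enorm c ^+ 2 = dot c c.
Proof. by rewrite sqr_sqrtr// /dot sumr_ge0// => i _; rewrite -expr2 sqr_ge0. Qed.

Lemma row_cvg n (c_ : nat -> 'rV[R]_n) (c : 'rV[R]_n) :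
  (forall i, c_ k 0 i @[k --> \oo] --> c 0 i) -> c_ @ \oo --> c.
Proof.
move=> cc; apply/cvgrPdist_lt => e e0.
have h i : \forall k \near \oo, `|c 0 i - c_ k 0 i| < e.
  by have /cvgrPdist_lt := cc i; exact.
apply: filterS (@filter_forall _ _ _ _ _ h) => k hk.
rewrite [`|_|]mx_normrE; apply: bigmax_lt => // -[i j] _ /=.
by rewrite !mxE !ord1; exact: hk.
Qed.

Lemma row_cvg_entry n (c_ : nat -> 'rV[R]_n) (c : 'rV[R]_n) i :
  c_ @ \oo --> c -> c_ k 0 i @[k --> \oo] --> c 0 i.
Proof.
by move=> cc; exact: (cvg_comp _ _ cc (@coord_continuous _ _ _ 0 i c)).
Qed.

Lemma H2_continuous u : H2 L u -> {within `[0, L], continuous u}.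
Proof. by case=> _ []. Qed.

Lemma weak_point0 (u_ : nat -> curve) u x i : weak_cvg L u_ u -> x \in `[0, L] ->
  u_ k x 0 i @[k --> \oo] --> u x 0 i.
Proof. by move=> uu xL; exact: (uu _ (bounded_linear_point0 L0 i xL)). Qed.

Lemma weak_point1 (u_ : nat -> curve) u x i : weak_cvg L u_ u -> x \in `[0, L] ->
  D1 L (u_ k) x 0 i @[k --> \oo] --> D1 L u x 0 i.
Proof. by move=> uu xL; exact: (uu _ (bounded_linear_point1 L0 i xL)). Qed.

Lemma l2ip_triangle v w : L2 L v -> L2 L w ->
  l2ip L v v <= 2 * l2ip L w w + 2 * l2ip L (v - w) (v - w).
Proof.
move=> sv sw; have sd := L2B sv sw.
rewrite (l2ip_sqE sv) (l2ip_sqE sw) (l2ip_sqE sd) !mulr_sumr -big_split/=.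
apply: ler_sum => i _.
have [_ i1] := sw i; have [_ i2] := sd i; have [_ i0] := sv i.
rewrite (_ : 2 * _ + 2 * _ = \int[mu]_(x in `[0, L]) (2 * (w x 0 i) ^+ 2 + 2 * ((v - w) x 0 i) ^+ 2)).
  apply: le_Rintegral => //.
    by apply: integrable_lincomb => //; exact: integrable_scale.
  move=> x _; rewrite curve_subE; have := sqr_ge0 (v x 0 i - 2 * w x 0 i); nra.
have i3 := integrable_scale 2 i2.
rewrite (Rintegral_lincomb 2 i1 i3); congr (_ + _).
by rewrite RintegralZl.
Qed.

Variable nS : 'rV[R]_3 -> 'rV[R]_3.
Hypothesis nS_continuous : continuous nS.
Hypothesis nS_le1 : forall s, enorm (nS s) <= 1.

Lemma dot_normal_le1 s : dot (nS s) (nS s) <= 1.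
Proof. by rewrite -enorm_sq expr_le1// sqrtr_ge0. Qed.

Lemma measurable_normal u i : H2 L u -> measurable_fun `[0, L] (fun x => nS (u x) 0 i).
Proof.
move=> /H2_continuous cu; apply: within_continuous_measurable => x.
apply: (@continuous_comp _ _ _ (u : subspace `[0, L] -> _) (fun s => nS s 0 i)).
  exact: cu.
apply: (@continuous_comp _ _ _ nS (fun s : 'rV[R]_3 => s 0 i)); first exact: nS_continuous.
exact: coord_continuous.
Qed.

Section energy_sequences.
Variables (u_ : nat -> curve) (u : curve) (g_ : nat -> R) (g M : R).
Hypothesis Hu_ : forall k, H2 L (u_ k).
Hypothesis Hu : H2 L u.
Hypothesis weak : weak_cvg L u_ u.
Hypothesis g01_ : forall k, 0 <= g_ k <= 1.
Hypothesis g01 : 0 <= g <= 1.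
Hypothesis g_cvg : g_ @ \oo --> g.
Hypothesis bnd : forall k, l2ip L (D2 L (u_ k)) (D2 L (u_ k)) <= M.

Lemma quad_sequence : exists2 a : nat -> R, a @ \oo --> quad L g (D2 L u) (nS \o u) &
  forall k, a k <= quad L (g_ k) (D2 L (u_ k)) (nS \o u_ k) <=
    a k + l2ip L (D2 L (u_ k) - D2 L u) (D2 L (u_ k) - D2 L u).
Proof.
apply: (@quad_asymptotics R L (fun k => D2 L (u_ k)) (D2 L u) (fun k => nS \o u_ k)
  (nS \o u) g_ g M) => //.
- by move=> k; exact: H2_D2.
- exact: H2_D2.
- by move=> k i; exact: measurable_normal.
- by move=> i; exact: measurable_normal.
- by move=> k x; exact: dot_normal_le1.
- by move=> x; exact: dot_normal_le1.
- move=> x i xL; apply: (@row_cvg_entry 3 (fun k => nS (u_ k x)) (nS (u x)) i).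
  have c : (fun k => u_ k x) @ \oo --> u x.
    by apply: row_cvg => j; exact: (@weak_point0 _ _ _ j weak xL).
  exact: (cvg_comp _ _ c (@nS_continuous (u x))).
- by move=> f sf; exact: (weak (bounded_linear_D2 L0 sf)).
Qed.

Lemma quad_lsc (c : R) : (forall k, quad L (g_ k) (D2 L (u_ k)) (nS \o u_ k) <= c) ->
  quad L g (D2 L u) (nS \o u) <= c.
Proof.
move=> qc; have [a ca aP] := quad_sequence.
apply: (cvgn_le ca) => k; apply: le_trans (qc k).
by case/andP: (aP k).
Qed.

Hypothesis strong : strong_cvg L u_ u.

Lemma quad_cvg : quad L (g_ k) (D2 L (u_ k)) (nS \o u_ k) @[k --> \oo] -->
  quad L g (D2 L u) (nS \o u).
Proof.
have [a ca aP] := quad_sequence.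
rewrite (_ : (fun k => _) = a \+ (fun k => quad L (g_ k) (D2 L (u_ k)) (nS \o u_ k) - a k)); last first.
  by apply/funext => k /=; rewrite addrC subrK.
rewrite -[X in _ --> X]addr0; apply: cvgD => //.
apply: (@squeeze_dist R _ (fun k => H2norm L (u_ k - u) * H2norm L (u_ k - u))); last first.
  by rewrite -[X in _ --> X](mulr0 0); apply: cvgM; exact: strong.
move=> k; have /andP[q1 q2] := aP k.
have e : l2ip L (D2 L (u_ k) - D2 L u) (D2 L (u_ k) - D2 L u) <= H2norm L (u_ k - u) * H2norm L (u_ k - u).
  rewrite -expr2 H2norm_sq -(l2ip_D2_sub L0 (Hu_ k) Hu) lerDr.
  by rewrite addr_ge0// l2ip_ge0.
rewrite subr0 ger0_norm ?subr_ge0//.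
by rewrite lerBlDl (le_trans q2)// lerD2l.
Qed.

End energy_sequences.

Lemma strong_D2_bound (u_ : nat -> curve) u : (forall k, H2 L (u_ k)) -> H2 L u ->
  strong_cvg L u_ u -> exists M : R, forall k, l2ip L (D2 L (u_ k)) (D2 L (u_ k)) <= M.
Proof.
move=> Hu_ Hu strong.
have [K [_ KP]] : bounded_fun (fun k => H2norm L (u_ k - u)).
  by apply: cvg_seq_bounded; apply/cvg_ex; exists 0.
exists (2 * l2ip L (D2 L u) (D2 L u) + 2 * (`|K| + 1) ^+ 2) => k.
apply: le_trans (l2ip_triangle (H2_D2 (Hu_ k)) (H2_D2 Hu)) _.
rewrite lerD2l ler_pM2l//; apply: (@le_trans _ _ (H2norm L (u_ k - u) ^+ 2)).
  by rewrite H2norm_sq -(l2ip_D2_sub L0 (Hu_ k) Hu) lerDr addr_ge0// l2ip_ge0.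
have := KP (`|K| + 1); rewrite (le_lt_trans (ler_norm K)) ?ltrDl//.
move=> /(_ isT k I) h; rewrite ler_pXn2r ?nnegrE ?H2norm_ge0// ?addr_ge0//.
exact: le_trans (ler_norm _) h.
Qed.

Lemma bending_energyE (A : set curve) (g : R) u : A u -> H2 L u -> 0 <= g <= 1 ->
  bending_energy L nS A g u = (2^-1 * quad L g (D2 L u) (nS \o u))%:E.
Proof.
move=> Au Hu g01; rewrite /bending_energy mem_set// EFinM; congr (_ * _)%E.
rewrite (_ : energy_density L nS g u = fun x =>
  dot (D2 L u x) (D2 L u x) - g * dot (D2 L u x) ((nS \o u) x) ^+ 2); last first.
  by apply/funext => x; rewrite /energy_density enorm_sq real_normK// num_real.
rewrite /quad /Rintegral fineK//.
apply: integrable_fin_num => //; apply: integrable_quad => //.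
- exact: H2_D2.
- by move=> i; exact: measurable_normal.
- by move=> x; exact: dot_normal_le1.
Qed.

Lemma quad_ge (g : R) u : H2 L u -> 0 <= g <= 1 ->
  (1 - g) * l2ip L (D2 L u) (D2 L u) <= quad L g (D2 L u) (nS \o u).
Proof.
move=> Hu g01; have s := H2_D2 Hu; have i1 := integrable_dot s s.
rewrite /l2ip -RintegralZl//.
apply: le_Rintegral => //.
- exact: integrable_scale.
- apply: integrable_quad => // [i|x]; [exact: measurable_normal|exact: dot_normal_le1].
move=> x _; rewrite mulrBl mul1r lerB// ler_wpM2l//; first by case/andP: g01.
rewrite (le_trans (dot_cauchy_schwarz _ _))// ler_piMr ?dot_ge0//.
exact: dot_normal_le1.
Qed.

End energies.

(** * Constraints in the weak limit *)

Section limits_of_admissible_curves.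
Variables (R : realType) (L : R).
Hypothesis L0 : 0 < L.
Local Notation curve := (R -> 'rV[R]_3).
Implicit Types (u v w : curve).

(** The bound [M] gives the [f_ k] a common Hoelder modulus of order one half, so convergence at [x]
    carries over to points moving towards [x]. *)
Lemma equicontinuous_point_cvg (f_ g_ : nat -> curve) (c : 'rV[R]_3) (y_ : nat -> R) (x M : R) i :
  (forall k, primitive_curve L (f_ k) (g_ k)) -> (forall k, L2 L (g_ k)) ->
  (forall k, l2ip L (g_ k) (g_ k) <= M) -> f_ k x 0 i @[k --> \oo] --> c 0 i ->
  x \in `[0, L] -> (forall k, y_ k \in `[0, L]) -> y_ @ \oo --> x ->
  f_ k (y_ k) 0 i @[k --> \oo] --> c 0 i.
Proof.
move=> fg sg gM fx xL yL yx.
rewrite (_ : (fun k => _) = (fun k => f_ k x 0 i + (f_ k (y_ k) 0 i - f_ k x 0 i))); last first.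
  by apply/funext => k; rewrite addrC subrK.
rewrite -[X in _ --> X]addr0; apply: cvgD => //.
apply: (@squeeze_dist R _ (fun k => Num.sqrt (`|y_ k - x| * M))) => [k|]; last first.
  rewrite -sqrtr0; apply: cvgn_sqrt; rewrite -[X in _ --> X](mul0r M).
  apply: cvgM; last exact: cvg_cst.
  by rewrite -(normr0 R) -(subrr x); apply: cvg_norm; apply: cvgB => //; exact: cvg_cst.
rewrite subr0 -sqrtr_sqr ler_wsqrtr//.
have := dot_entry (f_ k (y_ k) - f_ k x) i; rewrite !mxE => h; apply: le_trans h _.
apply: le_trans (curve_holder (fg k) (sg k) (yL k) xL) _.
by rewrite ler_wpM2l.
Qed.

Variables (Phi : 'rV[R]_3 -> R) (ell : nat).
Variables (Lbc : curve -> 'rV[R]_ell) (lbc : 'rV[R]_ell).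
Hypothesis Phi_continuous : continuous Phi.
Hypothesis Lbc_bounded : bounded_linear L Lbc.

(** The points [y_ k] may move with [k]: for splines they are nodes approaching [x], for admissible
    curves [x] itself. The bounds on initial slopes and second derivatives make curves and slopes
    equicontinuous. *)
Lemma limit_admissible (u_ : nat -> curve) u (M : R) : (forall k, H2 L (u_ k)) -> H2 L u ->
  weak_cvg L u_ u -> (forall k, Lbc (u_ k) = lbc) ->
  (forall k, dot (D1 L (u_ k) 0) (D1 L (u_ k) 0) <= 1) ->
  (forall k, l2ip L (D2 L (u_ k)) (D2 L (u_ k)) <= M) ->
  (forall x, x \in `[0, L] -> exists y_ : nat -> R,
    [/\ forall k, y_ k \in `[0, L], y_ @ \oo --> x &
        forall k, enorm (D1 L (u_ k) (y_ k)) = 1 /\ Phi (u_ k (y_ k)) = 0]) ->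
  admissible L Phi Lbc lbc u.
Proof.
move=> Hu_ Hu uu Lu d0 d2 ex.
pose M1 := 2 * L + 2 * L ^+ 2 * M.
have d1 k : l2ip L (D1 L (u_ k)) (D1 L (u_ k)) <= M1.
  apply: le_trans (curve_L2_bound L0 (H2_primitive2 L0 (Hu_ k)) (H2_D2 (Hu_ k))) _.
  apply: lerD; first by rewrite -[leRHS]mulr1; apply: ler_wpM2l => //; rewrite mulr_ge0// ltW.
  by apply: ler_wpM2l => //; rewrite mulr_ge0// sqr_ge0.
split=> // [x xL|]; last first.
  apply/rowP => j; have := uu _ (bounded_linear_entry j Lbc_bounded).
  rewrite (_ : (fun k => _) = fun=> lbc 0 j); last by apply/funext => k; rewrite Lu.
  by move=> h; apply/esym; apply: (cvg_unique _ (cvg_cst _) h).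
have [y_ [yL yx yP]] := ex x xL; split.
- rewrite enorm_sq; have c i : D1 L (u_ k) (y_ k) 0 i @[k --> \oo] --> D1 L u x 0 i.
    apply: (equicontinuous_point_cvg (fun k => H2_primitive2 L0 (Hu_ k))
      (fun k => H2_D2 (Hu_ k)) d2 _ xL yL yx).
    exact: weak_point1.
  have := dot_convergence c c.
  rewrite (_ : (fun k => _) = fun=> 1); last first.
    by apply/funext => k; rewrite -enorm_sq (yP k).1 expr1n.
  by move=> h; apply: (cvg_unique _ h (cvg_cst _)).
- have c i : u_ k (y_ k) 0 i @[k --> \oo] --> u x 0 i.
    apply: (equicontinuous_point_cvg (fun k => H2_primitive1 L0 (Hu_ k))
      (fun k => H2_D1_L2 L0 (Hu_ k)) d1 _ xL yL yx).
    exact: (@weak_point0 _ _ L0 _ _ _ i uu xL).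
  have h : (fun k => Phi (u_ k (y_ k))) @ \oo --> Phi (u x).
    exact: (cvg_comp _ _ (row_cvg c) (@Phi_continuous (u x))).
  rewrite (_ : (fun k => _) = fun=> 0) in h; last by apply/funext => k; rewrite (yP k).2.
  by apply: (cvg_unique _ h (cvg_cst _)).
Qed.

End limits_of_admissible_curves.

(** * Strong approximation by Hermite splines *)

Section spline_approximation.
Variables (R : realType) (L : R).
Hypothesis L0 : 0 < L.
Local Notation mu := (@lebesgue_measure R).
Local Notation curve := (R -> 'rV[R]_3).
Implicit Types (u v w U : curve).
Local Opaque D1 D2 l2ip.

Lemma l2ip_subC v w : l2ip L (v - w) (v - w) = l2ip L (w - v) (w - v).
Proof.
Local Transparent l2ip.
rewrite /l2ip; apply: eq_Rintegral => x _; rewrite !dot_sqE; apply: eq_bigr => i _.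
by rewrite !curve_subE; ring.
Local Opaque l2ip.
Qed.

Lemma H3_D2_continuous v : H3 L v -> exists2 y : curve, {within `[0, L], continuous y} &
  H2 L v /\ forall i, {ae mu, forall x, x \in `[0, L] -> D2 L v x 0 i = y x 0 i}.
Proof.
move=> [sv [cv [v1 [vv1 [s1 [c1 [v2 [v12 [s2 [c2 _]]]]]]]]]].
have T : H2_triple L v v1 v2.
  move=> i; split; [exact: sobolev1_triple|exact: sobolev1_triple|exact: s2].
by have [Hv _ ae] := triple_H2 L0 T; exists v2.
Qed.

Section partition.
Variables (J : nat) (z : nat -> R).
Hypothesis part : mesh_partition L J z.

Lemma partition_gt0 : (0 < J)%N.
Proof.
have [z0 zJ _] := part.
by rewrite lt0n; apply/eqP => J0; move: L0; rewrite -zJ J0 z0 ltxx.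
Qed.

Lemma mesh_size_le j : (j < J)%N -> `|z j.+1 - z j| <= mesh_size J z.
Proof. by move=> jJ; exact: (le_bigmax _ _ (Ordinal jJ)). Qed.

Lemma element_diameter j x : (j < J)%N -> x \in `[z j, z j.+1] -> `|x - z j| <= mesh_size J z.
Proof.
move=> jJ; rewrite in_itv/= => /andP[zx xz]; apply: le_trans (mesh_size_le jJ).
by rewrite !ger0_norm ?subr_ge0 ?lerB// (le_trans zx).
Qed.

Lemma partition_node x : x \in `[0, L] ->
  exists2 j, (j <= J)%N & `|z j - x| <= mesh_size J z.
Proof.
move=> xL; have [j jJ xj] := partition_find part xL partition_gt0.
by exists j; [exact: ltnW|rewrite distrC; exact: element_diameter].
Qed.

(** Equal initial data cancel the two boundary terms of [h2ip]. *)
Lemma interpolation_error u U : H2 L u -> H2 L U -> U 0 = u 0 -> D1 L U 0 = D1 L u 0 ->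
  h2ip L (U - u) (U - u) = l2ip L (D2 L u - D2 L U) (D2 L u - D2 L U).
Proof.
move=> Hu HU e0 e1; rewrite /h2ip.
have -> : dot ((U - u) 0) ((U - u) 0) = 0.
  have -> : (U - u) 0 = U 0 - u 0 by [].
  by rewrite e0 subrr /dot big1// => i _; rewrite mxE mul0r.
have -> : dot (D1 L (U - u) 0) (D1 L (U - u) 0) = 0.
  by rewrite (D1_sub L0 HU Hu (left_in_itvcc L0)) e1 subrr /dot big1// => i _; rewrite mxE mul0r.
have E := etrans (l2ip_D2_sub L0 HU Hu) (l2ip_subC (D2 L U) (D2 L u)).
by rewrite E add0r add0r.
Qed.

End partition.

Lemma H3_approximation_D2 u v (y : curve) : H2 L u -> H2 L v -> {within `[0, L], continuous y} ->
  (forall i, {ae mu, forall x, x \in `[0, L] -> D2 L v x 0 i = y x 0 i}) ->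
  l2ip L (D2 L u - y) (D2 L u - y) <= H2norm L (v - u) ^+ 2.
Proof.
move=> Hu Hv cy ae.
have su := H2_D2 Hu; have sv := H2_D2 Hv.
have sy : L2 L y.
  by move=> i; apply: sq_integrable_continuous; have/within_continuous_rowP := cy; exact.
have s1 := L2B su sy; have s2 := L2B su sv.
have aed i : {ae mu, forall x, x \in `[0, L] -> (D2 L u - y) x 0 i = (D2 L u - D2 L v) x 0 i}.
  apply: filterS (ae i); first exact: (ae_filter_ringOfSetsType mu).
  move=> x h xL; apply: etrans (curve_subE _ _ _ _) _; apply: etrans (esym (curve_subE _ _ _ _)).
  by congr (_ - _); apply/esym; exact: h xL.
have E : l2ip L (D2 L u - y) (D2 L u - y) = l2ip L (D2 L (v - u)) (D2 L (v - u)).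
  apply: etrans (l2ip_sq_ae s1 s2 aed) _; apply: etrans (l2ip_subC _ _) _.
  by apply/esym; exact: (l2ip_D2_sub L0 Hv Hu).
have alg (a b c : R) : 0 <= a -> 0 <= b -> c <= a + b + c by lra.
rewrite E H2norm_sq; apply: alg; exact: l2ip_ge0.
Qed.

Lemma rows_uniform (y : curve) : {within `[0, L], continuous y} ->
  forall e : R, 0 < e -> exists2 d, 0 < d & forall x t i, x \in `[0, L] -> t \in `[0, L] ->
    `|x - t| < d -> `|y x 0 i - y t 0 i| < e.
Proof.
move=> /within_continuous_rowP cy e e0.
have ex i : exists d : R, 0 < d /\ forall x t, x \in `[0, L] -> t \in `[0, L] ->
    `|x - t| < d -> `|y x 0 i - y t 0 i| < e.
  by have [d d0 dP] := within_continuous_uniform (cy i) e0; exists d.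
have [d dP] := choice ex.
exists (\big[Num.min/1]_i d i) => [|x t i xL tL xt].
  by apply: lt_bigmin => // i _; exact: (dP i).1.
by apply: (dP i).2 => //; apply: lt_le_trans xt _; exact: bigmin_le_cond.
Qed.

Section approximating_sequence.
Variables (J_ : nat -> nat) (z_ : nat -> nat -> R).
Hypothesis part : forall k, mesh_partition L (J_ k) (z_ k).
Hypothesis mesh0 : mesh_size (J_ k) (z_ k) @[k --> \oo] --> (0 : R).
Variable u : curve.
Hypothesis Hu : H2 L u.
Hypothesis approx : forall e : R, 0 < e -> exists2 v, H3 L v & H2norm L (v - u) < e.

Lemma strong_spline_approximation : exists U_ : nat -> curve,
  [/\ forall k, cubic_C1_space L (J_ k) (z_ k) (U_ k), forall k, H2 L (U_ k),
      forall k j, (j <= J_ k)%N -> U_ k (z_ k j) = u (z_ k j) /\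
        D1 L (U_ k) (z_ k j) = D1 L u (z_ k j)
    & strong_cvg L U_ u].
Proof.
have [U_ UP] := choice (fun k => cubic_interpolant L0 (part k) Hu).
exists U_; split=> [k|k|k j jJ|]; try by have [? ? ? ?] := UP k; auto.
have HU k : H2 L (U_ k) by have [] := UP k.
have [K K0 KP] : exists2 K : R, 0 <= K &
    forall v, H2 L v -> H2norm L v <= K * Num.sqrt (h2ip L v v).
  by eexists; last (move=> v; exact: H2norm_le); exact: sqrtr_ge0.
suff d0 : h2ip L (U_ k - u) (U_ k - u) @[k --> \oo] --> (0 : R).
  apply: (@squeeze_dist R _ (fun k => K * Num.sqrt (h2ip L (U_ k - u) (U_ k - u)))).
    move=> k; rewrite subr0 ger0_norm ?H2norm_ge0//.
    by apply: KP; exact: H2B.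
  rewrite -[X in _ --> X](mulr0 K); apply: cvgM; first exact: cvg_cst.
  by rewrite -sqrtr0; exact: cvgn_sqrt.
apply/cvgn_distP => e e0.
(* The error is [2 e / 4] from the distance to the H3 curve plus [6 L q] from the oscillation of its
   second derivative; [L + 1] makes [6 L q < e / 2] strict. *)
pose q := e / (12 * (L + 1)).
have q0 : 0 < q by rewrite divr_gt0// mulr_gt0// addr_gt0.
have e4 : 0 < Num.sqrt (e / 4) by rewrite sqrtr_gt0 divr_gt0.
have [v H3v vu] := approx e4.
have [y cy [Hv ae]] := H3_D2_continuous H3v.
have l1 := H3_approximation_D2 Hu Hv cy ae.
have l2 : H2norm L (v - u) ^+ 2 < e / 4.
  rewrite -[ltRHS]sqr_sqrtr; last by rewrite divr_ge0// ltW.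
  by rewrite ltr_pXn2r// nnegrE ?H2norm_ge0// ltW.
have sq0 : 0 < Num.sqrt q by rewrite sqrtr_gt0.
have [d dd0 dP] := rows_uniform cy sq0.
have [N NP] := (cvgn_distP _ _).1 mesh0 _ dd0.
exists N => k Nk; rewrite subr0.
have [_ HUk UE err] := UP k; have [z0 _ _] := part k.
have := UE 0%N isT; rewrite z0 => -[e0' e1'].
rewrite (interpolation_error Hu HUk e0' e1').
have osc : forall j x i, (j < J_ k)%N -> x \in `[z_ k j, z_ k j.+1] ->
    `|y x 0 i - y (z_ k j) 0 i| <= Num.sqrt q.
  move=> j x i jJ xj; apply/ltW/dP.
  - apply: subitvP xj; have [i1 i2] := (partition_in (part k) (ltnW jJ), partition_in (part k) jJ).
    move: i1 i2; rewrite !in_itv/= => /andP[a _] /andP[_ b].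
    by rewrite subitvE !bnd_simp a b.
  - exact: (partition_in (part k) (ltnW jJ)).
  - apply: le_lt_trans (element_diameter jJ xj) _.
    by have := NP k Nk; rewrite subr0; apply: le_lt_trans; exact: ler_norm.
have := err y (Num.sqrt q) cy osc; rewrite sqr_sqrtr; last exact: ltW.
rewrite ger0_norm ?l2ip_ge0// => h.
have qE : 6 * L * q < e / 2.
  have L1 : 0 < L + 1 by rewrite addr_gt0.
  rewrite /q (_ : 6 * L * _ = (e / 2) * (L / (L + 1))); last first.
    by field; rewrite gt_eqF.
  by rewrite gtr_pMr ?divr_gt0// ltr_pdivrMr// mul1r ltrDl.
have alg (a b c f : R) : f <= 2 * a + c -> a <= b -> b < e / 4 -> c < e / 2 -> f < e by lra.
exact: alg h l1 l2 qE.
Qed.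

End approximating_sequence.
End spline_approximation.

(** * Gamma-convergence of the discretized energies *)

Section gamma_limits.
Variables (R : realType) (L : R) (Phi : 'rV[R]_3 -> R).
Variables (nS : 'rV[R]_3 -> 'rV[R]_3) (ell : nat).
Variables (Lbc : (R -> 'rV[R]_3) -> 'rV[R]_ell) (lbc : 'rV[R]_ell).
Hypothesis L0 : 0 < L.
Hypothesis Phi_continuous : continuous Phi.
Hypothesis nS_continuous : continuous nS.
Hypothesis nS_le1 : forall s, enorm (nS s) <= 1.
Hypothesis Lbc_bounded : bounded_linear L Lbc.
Hypothesis Lbc_boundary : boundary_dependent L Lbc.
Hypothesis seminorm_is_norm :
  norm_on L [set v | H2 L v /\ Lbc v = 0] (fun v => L2norm L (D2 L v)).
Local Notation curve := (R -> 'rV[R]_3).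
Local Notation A := (admissible L Phi Lbc lbc).
Implicit Types (u v : curve) (g c M : R).
Local Opaque D1 D2 l2ip.

Lemma bending_energy_dom (B : set curve) g u c :
  (bending_energy L nS B g u <= c%:E)%E -> B u.
Proof.
by rewrite /bending_energy; case: ifPn => [/set_mem//|_]; rewrite leye_eq.
Qed.

Lemma bending_energy_le (B : set curve) g u c : H2 L u -> 0 <= g <= 1 ->
  (bending_energy L nS B g u <= c%:E)%E -> quad L g (D2 L u) (nS \o u) <= 2 * c.
Proof.
move=> Hu g01 uc; move: (uc); rewrite bending_energyE//; last exact: bending_energy_dom uc.
by rewrite lee_fin ler_pdivrMl.
Qed.

Lemma bending_energy_le_quad (B : set curve) g u c : B u -> H2 L u -> 0 <= g <= 1 ->
  quad L g (D2 L u) (nS \o u) <= 2 * c -> (bending_energy L nS B g u <= c%:E)%E.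
Proof. by move=> Bu Hu g01 uc; rewrite bending_energyE// lee_fin ler_pdivrMl. Qed.

Lemma unit_endpoints_coercive M : exists M', forall u, H2 L u -> Lbc u = lbc ->
  enorm (D1 L u 0) = 1 -> enorm (D1 L u L) = 1 -> l2ip L (D2 L u) (D2 L u) <= M ->
  h2ip L u u <= M'.
Proof.
have [M' M'P] := @H2_coercive _ _ L0 _ Lbc lbc Lbc_bounded Lbc_boundary seminorm_is_norm M.
by exists M' => u Hu Lu e0 eL; apply: M'P => //; rewrite -enorm_sq ?e0 ?eL expr1n.
Qed.

Section splines.
Variables (J : nat) (z : nat -> R).
Hypothesis part : mesh_partition L J z.

Lemma admissible_h_H2 u : admissible_h L Phi Lbc lbc J z u -> H2 L u.
Proof.
by move=> [sp _ _]; have [w [s T]] := cubic_space_triple L0 part sp; have [] := triple_H2 L0 T.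
Qed.

Lemma admissible_h_ends u : admissible_h L Phi Lbc lbc J z u ->
  enorm (D1 L u 0) = 1 /\ enorm (D1 L u L) = 1.
Proof.
move=> [_ uP _]; have [z0 zJ _] := part.
by have := uP 0%N isT; have := uP J (leqnn J); rewrite z0 zJ => -[-> _] [-> _].
Qed.

End splines.

Lemma spline_gamma_approximation g (J : nat -> nat) (z : nat -> nat -> R) : 0 < g < 1 ->
  strongly_dense L (A `&` H3 L) A ->
  (forall k, mesh_partition L (J k) (z k)) ->
  mesh_size (J k) (z k) @[k --> \oo] --> (0 : R) ->
  let A_ k := admissible_h L Phi Lbc lbc (J k) (z k) in
  Gamma_approximation L A_ (fun k => bending_energy L nS (A_ k) g)
    A (bending_energy L nS A g).
Proof.
move=> /andP[g0 g1] H3_dense part mesh0 A_.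
have g01 : 0 <= g <= 1 by rewrite !ltW.
(* The factor 2 undoes the one half in the energy; the division by [1 - g] is where [g < 1]
   enters. *)
have d2 k u c : H2 L u -> (bending_energy L nS (A_ k) g u <= c%:E)%E ->
    l2ip L (D2 L u) (D2 L u) <= 2 * c / (1 - g).
  move=> Hu uc; rewrite ler_pdivlMr ?subr_gt0// mulrC.
  exact: le_trans (quad_ge nS_continuous nS_le1 Hu g01) (bending_energy_le Hu g01 uc).
apply: gamma_approximation_of_sublevels.
- by move=> k u; exact: admissible_h_H2.
- by move=> u nu; rewrite /bending_energy memNset.
- by move=> u_ u Hu_ Hu; exact: strong_weak_cvg.
- move=> phi u_ u c hphi Hu_ Hu uc uu.
  have Au_ k := bending_energy_dom (uc k).
  have Au : A u.
    apply: (@limit_admissible _ _ L0 _ _ _ _ Phi_continuous Lbc_bounded u_ u (2 * c / (1 - g))) => //.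
    + by move=> k; have [] := Au_ k.
    + by move=> k; rewrite -enorm_sq (admissible_h_ends (part _) (Au_ k)).1 expr1n.
    + by move=> k; exact: d2 (uc k).
    (* In each partition a node within one mesh size of [x] is chosen, so that these nodes tend to
       [x]. *)
    + move=> x xL; have [j jP] := choice (fun k =>
        ex2_ind (fun j h1 h2 => ex_intro (fun j => (j <= J (phi k))%N /\
          `|z (phi k) j - x| <= mesh_size (J (phi k)) (z (phi k))) j (conj h1 h2))
          (partition_node L0 (part (phi k)) xL)).
      exists (fun k => z (phi k) (j k)); split.
      * by move=> k; exact: (partition_in (part _) (jP k).1).
      * apply: (squeeze_dist (fun k => (jP k).2)).
        exact: (cvgn_subseq hphi mesh0).
      * by move=> k; have [_ + _] := Au_ k; apply; exact: (jP k).1.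
  apply: bending_energy_le_quad => //.
  apply: (@quad_lsc _ _ L0 nS nS_continuous nS_le1 u_ u (fun=> g) g (2 * c / (1 - g))) => //.
  + exact: cvg_cst.
  + by move=> k; exact: d2 (uc k).
  + by move=> k; exact: bending_energy_le (uc k).
- move=> u_ c uc; have [M' M'P] := unit_endpoints_coercive (2 * c / (1 - g)).
  have Hu_ k : H2 L (u_ k) := admissible_h_H2 (part k) (uc k).1.
  apply: (@H2_weak_compactness _ _ L0 u_ M') => // k.
  have [e0 eL] := admissible_h_ends (part k) (uc k).1.
  apply: M'P => //; first by have [[]] := uc k.
  exact: d2 (uc k).2.
- move=> u Au; have [Hu uP Lu] := Au.
  have approx (e : R) : 0 < e -> exists2 v, H3 L v & H2norm L (v - u) < e.
    by move=> e0; have [v [_ H3v] vu] := H3_dense u Au e e0; exists v.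
  have [U_ [sp HU UE strong]] := strong_spline_approximation L0 part mesh0 Hu approx.
  have AU k : A_ k (U_ k).
    have [z0 zJ _] := part k; split=> // [j jJ|].
      have [-> ->] := UE k j jJ; have [|e1 ->] := uP (z k j); first exact: partition_in jJ.
      by split=> //; move/eqP: e1; rewrite sqrp_eq1 ?sqrtr_ge0// => /eqP.
    have [U0 U10] := UE k 0%N isT; have [UL U1L] := UE k (J k) (leqnn _).
    rewrite z0 in U0 U10; rewrite zJ in UL U1L.
    by rewrite -Lu; apply: Lbc_boundary.
  exists U_; split=> //.
  have [M MP] := strong_D2_bound L0 HU Hu strong.
  have Ek k := bending_energyE nS_continuous nS_le1 (AU k) (HU k) g01.
  rewrite (_ : (fun k => _) = fun k => (2^-1 * quad L g (D2 L (U_ k)) (nS \o U_ k))%:E); last first.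
    by apply/funext => k; exact: Ek.
  rewrite bending_energyE//; apply: cvg_EFin; first exact: nearW.
  apply: cvgM; first exact: cvg_cst.
  apply: (@quad_cvg _ _ L0 nS nS_continuous nS_le1 U_ u (fun=> g) g M) => //.
  + exact: strong_weak_cvg.
  + exact: cvg_cst.
Qed.

End gamma_limits.

(** * Level sets and normal acceleration *)

Section level_sets.
Variable R : realType.
Implicit Types (f p : 'rV[R]_3 -> R) (s t g h a : 'rV[R]_3) (u v : R -> 'rV[R]_3).

Lemma diff_grad f s h : differentiable f s -> 'd f s h = dot (grad f s) h.
Proof.
move=> df; rewrite {1}(row_sum_delta h) linear_sum; apply: eq_bigr => i _.
by rewrite linearZ/= mxE (deriveE _ df) mulrC.
Qed.

Lemma differential_estimate f s (e : R) : differentiable f s -> 0 < e ->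
  \forall h \near (0 : 'rV[R]_3), `|f (s + h) - f s - dot (grad f s) h| <= e * `|h|.
Proof.
move=> df e0; have /eqaddoP : f \o shift s = cst (f s) + 'd f s +o_ (0 : 'rV[R]_3) id.
  exact: diff_locally.
move=> /(_ e e0); apply: filterS => h.
have -> : (f \o shift s - (cst (f s) + 'd f s)) h = f (h + s) - (f s + 'd f s h) by [].
by rewrite diff_grad// opprD addrA (addrC h).
Qed.

Lemma curve_chain_rule f u (x : R) t : differentiable f (u x) ->
  (forall i, is_derive x 1 (fun y => u y 0 i) (t 0 i)) ->
  is_derive x 1 (f \o u) (dot (grad f (u x)) t).
Proof.
move=> df du.
have dux : derivable u x 1.
  by apply/derivable_mxP => i j; rewrite (ord1 i); have [] := du j.
have Du : 'D_1 u x = t.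
  by rewrite derive_mx//; apply/rowP => j; rewrite mxE; have [_ ->] := du j.
have du' : differentiable u x by exact/derivable1_diffP.
have dfu : differentiable (f \o u) x by exact: differentiable_comp.
split; first exact/derivable1_diffP.
have E : 'd u x 1 = t by rewrite -Du deriveE.
by rewrite deriveE// diff_comp//= E diff_grad.
Qed.

(* Moving from [s] by a small multiple of [t + tau * delta * grad f s] changes the
   sign of [f] between [tau = -1] and [tau = 1]; at a zero in between [p] vanishes,
   while to first order it changes by a multiple of [dot (grad p s) t]. *)
Lemma tangent_zero_set f p s t : continuous f -> differentiable f s -> differentiable p s ->
  f s = 0 -> p s = 0 -> (\forall s' \near s, f s' = 0 -> p s' = 0) -> grad f s != 0 ->
  dot (grad f s) t = 0 -> dot (grad p s) t = 0.
Proof.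
move=> cf df dp fs ps fp gf gt; apply: contrapT => /eqP pt.
set g := grad f s in gf gt; set P := dot (grad p s) t in pt; set q := dot (grad p s) g.
have G0 : 0 < dot g g.
  rewrite lt_neqAle dot_ge0 andbT eq_sym; apply: contra gf => /eqP.
  rewrite dot_sqE => /eqP; rewrite psumr_eq0 => [/allP h|i _]; last exact: sqr_ge0.
  apply/eqP/rowP => i; rewrite [RHS]mxE; have := h i (mem_index_enum i).
  by rewrite implyTb sqrf_eq0 => /eqP.
have P0 : 0 < `|P| by rewrite normr_gt0.
(* Small enough that the correction along the gradient of [f] changes the first-order term [P] of
   [p] by at most a quarter; the [+ 1] covers [q = 0]. *)
pose d := `|P| / (4 * (`|q| + 1)).
have q1 : 0 < `|q| + 1 by rewrite ltr_wpDl.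
have d0 : 0 < d by rewrite divr_gt0// mulr_gt0.
have dq : d * `|q| <= `|P| / 4.
  rewrite /d (_ : _ * `|q| = `|P| / 4 * (`|q| / (`|q| + 1))); last by field; rewrite gt_eqF.
  by rewrite ler_piMr ?divr_ge0// ler_pdivrMr// mul1r lerDl.
clearbody d.
pose N := `|t| + d * `|g|.
have N0 : 0 <= N by rewrite addr_ge0// mulr_ge0// ltW.
have N1 : 0 < N + 1 by rewrite ltr_wpDl.
have NN : N / (N + 1) < 1 by rewrite ltr_pdivrMr// mul1r ltrDl.
(* The step [h tau] has norm at most [eps N], so with this tolerance the remainder of [f] stays
   strictly below [eps d (dot g g)], its first-order change at [tau = 1]. The next tolerance keeps
   the remainder of [p] within a quarter of [eps |P|]. *)
have e1 : 0 < d * dot g g / (N + 1) by rewrite divr_gt0// mulr_gt0.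
have e2 : 0 < `|P| / (4 * (N + 1)) by rewrite divr_gt0// mulr_gt0.
have fp0 : \forall h \near (0 : 'rV[R]_3), f (s + h) = 0 -> p (s + h) = 0.
  have /nbhs_ballP[r /= r0 rP] := fp; apply/nbhs_ballP; exists r => // h.
  rewrite -ball_normE/= sub0r normrN => hr; apply: rP.
  by rewrite -ball_normE/= opprD addrA subrr sub0r normrN.
have [r r0 rP] : exists2 r : R, 0 < r & forall h, `|h| < r ->
    [/\ `|f (s + h) - f s - dot g h| <= d * dot g g / (N + 1) * `|h|,
        `|p (s + h) - p s - dot (grad p s) h| <= `|P| / (4 * (N + 1)) * `|h|
      & f (s + h) = 0 -> p (s + h) = 0].
  have := filterI (differential_estimate df e1) (filterI (differential_estimate dp e2) fp0).
  move=> /(_ _ _)/nbhs_ballP[r /= r0 rP]; exists r => // h hr.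
  have [|? []] := rP h; last by [].
  by rewrite -ball_normE/= sub0r normrN.
pose eps := r / (2 * (N + 1)).
have eps0 : 0 < eps by rewrite divr_gt0// mulr_gt0.
pose h tau := eps *: (t + (tau * d) *: g).
have hN tau : `|tau| <= 1 -> `|h tau| <= eps * N.
  move=> tau1; rewrite normrZ gtr0_norm// ler_pM2l// (le_trans (ler_normD _ _))// lerD2l.
  by rewrite normrZ normrM (gtr0_norm d0) ler_wpM2r// ler_piMl// ltW.
have epsN : eps * N < r.
  rewrite /eps (_ : _ * N = (r / 2) * (N / (N + 1))); last by field; rewrite gt_eqF.
  by apply: (@lt_le_trans _ _ (r / 2)); [rewrite gtr_pMr// divr_gt0|lra].
have hr tau : `|tau| <= 1 -> `|h tau| < r by move=> /hN h1; exact: le_lt_trans h1 epsN.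
have dot_h (c : 'rV[R]_3) tau : dot c (h tau) = eps * (dot c t + tau * d * dot c g).
  by rewrite /h dotZr dotC addrC dot_linl addrC (dotC t) (dotC g).
have est1 tau : `|tau| <= 1 -> `|f (s + h tau) - eps * (tau * d * dot g g)| < eps * (d * dot g g).
  move=> tau1; have [+ _ _] := rP _ (hr tau tau1); rewrite fs subr0 dot_h gt add0r.
  move=> h1; apply: le_lt_trans h1 _.
  apply: (@le_lt_trans _ _ (d * dot g g / (N + 1) * (eps * N))).
    by rewrite ler_pM2l// hN.
  rewrite (_ : d * dot g g / (N + 1) * _ = eps * (d * dot g g) * (N / (N + 1))); last first.
    by field; rewrite gt_eqF.
  have Q0 : 0 < eps * (d * dot g g) by rewrite mulr_gt0// mulr_gt0.
  by move: (eps * _) Q0 => Q Q0; rewrite gtr_pMr.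
(* A zero of [p] would bound [|P + tau d q|] by [|P| / 4]; with [d |q| <= |P| / 4] this contradicts
   [P] being nonzero. *)
have est2 tau : `|tau| <= 1 -> p (s + h tau) <> 0.
  move=> tau1 ph; have [_ + _] := rP _ (hr tau tau1); rewrite ph ps subrr sub0r normrN dot_h -/q -/P.
  rewrite normrM gtr0_norm// => h1.
  have : eps * `|P + tau * d * q| <= eps * (`|P| / 4).
    apply: le_trans h1 _; apply: (@le_trans _ _ (`|P| / (4 * (N + 1)) * (eps * N))).
      by rewrite ler_pM2l// hN.
    rewrite (_ : _ * (eps * N) = eps * (`|P| / 4) * (N / (N + 1))); last by field; rewrite gt_eqF.
    by rewrite ler_piMr ?ltW// mulr_gt0// divr_gt0.
  rewrite ler_pM2l// => h2.
  have h3 : `|tau * d * q| <= `|P| / 4.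
    rewrite !normrM (gtr0_norm d0) -mulrA; apply: le_trans dq.
    by rewrite ler_piMl// mulr_ge0// ltW.
  have := ler_normD (P + tau * d * q) (- (tau * d * q)); rewrite addrK normrN.
  by move: h2 h3 P0; lra.
have [tau tau1 ftau] : exists2 tau, tau \in `[(-1), 1] & f (s + h tau) = 0.
  have f1 : 0 <= f (s + h 1).
    have := est1 1; rewrite normr1 lexx mul1r => /(_ isT); rewrite ltr_norml => /andP[+ _].
    have alg (B C : R) : - C < B - C -> 0 <= B by lra.
    exact: alg.
  have fm1 : f (s + h (-1)) <= 0.
    have := est1 (-1); rewrite normrN normr1 lexx mulN1r => /(_ isT); rewrite ltr_norml => /andP[_].
    have alg (B C : R) : B - - C < C -> B <= 0 by lra.
    by rewrite mulNr mulrN; exact: alg.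
  apply: (@IVT R (fun tau => f (s + h tau)) (-1) 1 0); first by lra.
    apply: continuous_subspaceT => tau.
    apply: (@continuous_comp _ _ _ (fun tau => s + h tau) f); last exact: cf.
    apply: cvgD; first exact: cvg_cst.
    apply: cvgZr; apply: cvgD; first exact: cvg_cst.
    by apply: cvgZl; apply: cvgM; [exact: cvg_id|exact: cvg_cst].
  by rewrite min_l ?max_r ?(le_trans fm1)// fm1 f1.
have tau1' : `|tau| <= 1 by move: tau1; rewrite in_itv/= ler_norml.
have [_ _ /(_ ftau)] := rP _ (hr tau tau1').
exact: est2.
Qed.

End level_sets.

(** * Normal acceleration of unit speed curves in a C2 surface *)

Section normal_acceleration.
Variables (R : realType) (Phi : 'rV[R]_3 -> R).
Hypothesis Phi_C1 : C1_on setT Phi.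
Hypothesis Phi_regular : forall s, zero_set Phi s -> grad Phi s != 0.
Local Notation S := (zero_set Phi).
Implicit Types (Psi : 'rV[R]_3 -> R) (U : set 'rV[R]_3) (s t a : 'rV[R]_3) (u v : R -> 'rV[R]_3).

Lemma C1_continuous : continuous Phi.
Proof. by move=> s; apply: differentiable_continuous; exact: (Phi_C1 (s := s) I).1. Qed.

Lemma dot_eq0 a : dot a a = 0 -> a = 0.
Proof.
rewrite dot_sqE => /eqP; rewrite psumr_eq0 => [/allP h|i _]; last exact: sqr_ge0.
apply/rowP => i; rewrite [RHS]mxE; have := h i (mem_index_enum i).
by rewrite implyTb sqrf_eq0 => /eqP.
Qed.

(** The component [t] of [grad Psi s] orthogonal to [grad Phi s] is tangent to the zero set of
    [Phi], hence orthogonal to [grad Psi s] as well, hence zero. Regularity of [Psi] keeps the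
    factor nonzero. *)
Lemma grad_proportional U Psi s : C2_equation S U Psi -> S s -> U s ->
  exists2 k : R, k != 0 & grad Psi s = k *: grad Phi s.
Proof.
move=> [oU [C1Psi _] SU regular] Ss Us.
set g := grad Phi s; have g0 : g != 0 by exact: Phi_regular.
have gg : dot g g != 0 by apply: contra g0 => /eqP/dot_eq0 ->.
have SUP s' : U s' -> Phi s' = 0 -> Psi s' = 0.
  by move=> Us' Ss'; have [] : (zero_set Psi `&` U) s' by rewrite -SU.
set p := grad Psi s; pose k := dot p g / dot g g.
pose t := p - k *: g.
have dotB (a b c : 'rV[R]_3) : dot a (b - k *: c) = dot a b - k * dot a c.
  by rewrite -scaleNr addrC dotC dot_linl (dotC c) (dotC b); ring.
have gt : dot g t = 0 by rewrite dotB (dotC g p) /k mulfVK// subrr.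
have pt : dot p t = 0.
  apply: (@tangent_zero_set _ Phi Psi s t) => //.
  - exact: C1_continuous.
  - exact: (Phi_C1 (s := s) I).1.
  - exact: (C1Psi s Us).1.
  - exact: SUP.
  - have : \forall s' \near s, U s' by exact: open_nbhs_nbhs.
    by apply: filterS => s'; exact: SUP.
have tt : dot t (p - k *: g) = 0 by rewrite dotB (dotC t p) (dotC t g) pt gt mulr0 subr0.
have pE : p = k *: g by apply/eqP; rewrite -subr_eq0; apply/eqP/dot_eq0.
exists k => //; apply/eqP => k0; have : p != 0 by apply: regular.
by rewrite pE k0 scale0r eqxx.
Qed.

Lemma enormZ (k : R) a : enorm (k *: a) = `|k| * enorm a.
Proof. by rewrite /enorm dotZl dotZr mulrA -expr2 sqrtrM ?sqr_ge0// sqrtr_sqr. Qed.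

Lemma enorm_gt0 a : a != 0 -> 0 < enorm a.
Proof.
move=> a0; rewrite sqrtr_gt0 lt_neqAle dot_ge0 andbT eq_sym.
by apply: contra a0 => /eqP/dot_eq0 ->.
Qed.

Lemma dot_unit_normal U Psi s a : C2_equation S U Psi -> S s -> U s ->
  `|dot a (unit_normal Phi s)| = `|dot (grad Psi s) a| / enorm (grad Psi s).
Proof.
move=> eqS Ss Us; have [k k0 ->] := grad_proportional eqS Ss Us.
have g0 := enorm_gt0 (Phi_regular Ss).
rewrite /unit_normal dotZr dotZl enormZ !normrM normfV (gtr0_norm g0) dotC.
by field; rewrite normr_eq0 k0 gt_eqF.
Qed.

(* Differentiating [Psi (u y) = 0] twice. *)
Lemma second_derivative_zero_set U Psi u v (x : R) a : C2_equation S U Psi -> U (u x) ->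
  (\forall y \near x, S (u y)) ->
  (\forall y \near x, forall i, is_derive (y : R) 1 (fun z : R => u z 0 i) (v y 0 i)) ->
  (forall i, is_derive x 1 (fun z : R => v z 0 i) (a 0 i)) ->
  dot (grad Psi (u x)) a =
  - \sum_i dot (grad (fun s => grad Psi s 0 i) (u x)) (v x) * v x 0 i.
Proof.
move=> [oU [C1Psi C2Psi] SU _] Ux Su du dv.
have cu : {for x, continuous u}.
  apply: differentiable_continuous; apply/derivable1_diffP/derivable_mxP => i j.
  by rewrite (ord1 i); have [] := nbhs_singleton du j.
have Uu : \forall y \near x, U (u y) by apply: cu; exact: open_nbhs_nbhs.
have Psi0 : \forall y \near x, (Psi \o u) y = 0.
  apply: filterS (filterI Su Uu) => y [Sy Uy].
  by have [] : (zero_set Psi `&` U) (u y) by rewrite -SU.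
(* The derivative of [Psi \o u], which vanishes on a whole neighbourhood of [x]. The second
   differentiation takes place at [x] alone, the only point where [v] is assumed differentiable. *)
pose G := \sum_i ((fun y => grad Psi (u y) 0 i) * (fun y => v y 0 i)) : R -> R.
have GE y : G y = dot (grad Psi (u y)) (v y) by rewrite /G fct_sumE.
have G0 : \forall y \near x, G y = 0.
  have Psi00 := near_join Psi0.
  apply: filterS (filterI Psi00 (filterI Uu du)) => y [P0 [Uy duy]].
  have [_] : is_derive y 1 (cst 0) (dot (grad Psi (u y)) (v y)).
    exact: (near_eq_is_derive P0 (curve_chain_rule (C1Psi _ Uy).1 duy)).
  by rewrite GE derive_cst.
have dG : is_derive x 1 G (\sum_i (grad Psi (u x) 0 i *: a 0 i +
    v x 0 i *: dot (grad (fun s => grad Psi s 0 i) (u x)) (v x))).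
  apply: is_derive_sum => i.
  have := curve_chain_rule (f := fun s => grad Psi s 0 i) (C2Psi i _ Ux).1 (nbhs_singleton du).
  by move=> dP; exact: (is_deriveM dP (dv i)).
have E : \sum_i (grad Psi (u x) 0 i *: a 0 i +
    v x 0 i *: dot (grad (fun s => grad Psi s 0 i) (u x)) (v x)) = 0.
  have [_] := near_eq_is_derive (g := cst 0) G0 dG.
  by rewrite derive_cst.
rewrite big_split/= in E; apply/eqP; rewrite -subr_eq0 opprK; apply/eqP; rewrite -[RHS]E; congr (_ + _).
by apply: eq_bigr => i _; rewrite mulrC.
Qed.

(** Dominates [|D^2 Psi (v, v)| / |grad Psi|] for unit [v]; a sum of absolute entries is visibly
    continuous in [s]. *)
Let curvature_bound Psi s :=
  (\sum_i \sum_j `|grad (fun s => grad Psi s 0 i) s 0 j|) / enorm (grad Psi s).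

Let curvature_bound_continuous U Psi s : C2_equation S U Psi -> S s -> U s ->
  {for s, continuous (curvature_bound Psi)}.
Proof.
move=> [oU [C1Psi C2Psi] SU regular] Ss Us.
have entry (F : 'rV[R]_3 -> 'rV[R]_3) i : {for s, continuous F} ->
    {for s, continuous (fun s => F s 0 i)}.
  by move=> cF; exact: (cvg_comp _ _ cF (@coord_continuous _ _ _ 0 i (F s))).
have sum (n : nat) (F : 'I_n -> 'rV[R]_3 -> R) : (forall i, {for s, continuous (F i)}) ->
    {for s, continuous (fun s => \sum_i F i s)}.
  by move=> cF; exact: (@cvg_bigsum R _ (nbhs s) _ n F (fun i => F i s)).
apply: (@continuousM _ _ (fun s => \sum_i \sum_j `|grad (fun s => grad Psi s 0 i) s 0 j|)
  (fun s => (enorm (grad Psi s))^-1)).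
  apply: (sum _ (fun i s => \sum_j `|grad (fun s => grad Psi s 0 i) s 0 j|)) => i.
  apply: (sum _ (fun j s => `|grad (fun s => grad Psi s 0 i) s 0 j|)) => j.
  have c := entry _ j (C2Psi i s Us).2.
  exact: (cvg_norm c).
apply: continuousV; first by rewrite gt_eqF// enorm_gt0// regular.
apply: (@continuous_comp _ _ _ (fun s => dot (grad Psi s) (grad Psi s)) Num.sqrt); last first.
  exact: sqrt_continuous.
apply: (sum _ (fun i s => grad Psi s 0 i * grad Psi s 0 i)) => i.
have c := entry _ i (C1Psi s Us).2.
exact: (continuousM c c).
Qed.

(** Attached to a point, for all curves through it, so that a compactness argument over points
    applies. *)
Let bounded_normal_acceleration (C : R) s := forall u v (x : R) a, u x = s ->
  (\forall y \near x, S (u y)) ->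
  (\forall y \near x, forall i, is_derive (y : R) 1 (fun z : R => u z 0 i) (v y 0 i)) ->
  (forall i, is_derive x 1 (fun z : R => v z 0 i) (a 0 i)) ->
  dot (v x) (v x) = 1 -> `|dot a (unit_normal Phi s)| <= C.

Let local_bound U Psi s (C : R) : C2_equation S U Psi -> S s -> U s ->
  curvature_bound Psi s <= C -> bounded_normal_acceleration C s.
Proof.
move=> eqS Ss Us CB u v x a uxs Su du dv vv; apply: le_trans CB.
rewrite (dot_unit_normal a eqS Ss Us).
have p0 : 0 < enorm (grad Psi s) by apply: enorm_gt0; have [_ _ _] := eqS; exact.
rewrite ler_pM2r ?invr_gt0//.
have E := second_derivative_zero_set eqS (eq_ind_r U Us uxs) Su du dv.
rewrite uxs in E; rewrite E normrN.
have v1 i : `|v x 0 i| <= 1.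
  rewrite -(@ler_pXn2r _ 2)// ?nnegrE// real_normK ?num_real// expr1n -vv.
  exact: dot_entry.
apply: le_trans (ler_norm_sum _ _ _) _; apply: ler_sum => i _.
rewrite normrM; apply: le_trans (ler_piMr _ (v1 i)) _ => //.
apply: le_trans (ler_norm_sum _ _ _) _; apply: ler_sum => j _.
by rewrite normrM ler_piMr.
Qed.

(** Compactness of a cube in covering form: a point of [S] has a neighbourhood in one chart where
    [curvature_bound] stays below a constant, and a point off the closed set [S] has one that no
    curve in [S] meets. The constant does not depend on the curve. *)
Lemma normal_acceleration_bound (M : R) : C2_surface S -> exists C : R,
  forall u v (x : R) a, (forall i, `|u x 0 i| <= M) ->
  (\forall y \near x, S (u y)) ->
  (\forall y \near x, forall i, is_derive (y : R) 1 (fun z : R => u z 0 i) (v y 0 i)) ->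
  (forall i, is_derive x 1 (fun z : R => v z 0 i) (a 0 i)) ->
  dot (v x) (v x) = 1 -> `|dot a (unit_normal Phi (u x))| <= C.
Proof.
move=> S_C2; pose K := [set s : 'rV[R]_3 | forall i, `[(- M), M]%classic (s ord0 i)].
have cK : compact K by apply: (@rV_compact R 3 (fun=> `[(- M), M]%classic)) => i; exact: segment_compact.
have : \forall C \near +oo, K `<=` bounded_normal_acceleration C.
  have /compact_near_coveringP/(_ R +oo bounded_normal_acceleration) := cK; apply => s _.
  have [Ss|nSs] := pselect (S s).
    have [U [Psi [Us eqS]]] := S_C2 s Ss.
    have nU : \forall s' \near s, U s' by apply: open_nbhs_nbhs; split=> //; have [] := eqS.
    have nB : \forall s' \near s, curvature_bound Psi s' < curvature_bound Psi s + 1.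
      have := curvature_bound_continuous eqS Ss Us => /cvgrPdist_lt /(_ 1 ltr01).
      by apply: filterS => s'; rewrite ltr_norml => /andP[+ _]; lra.
    exists (U `&` [set s' | curvature_bound Psi s' < curvature_bound Psi s + 1],
            [set C | curvature_bound Psi s + 1 <= C]) => /=.
      split; first exact: (filterI nU nB).
      by exists (curvature_bound Psi s + 1); split; [exact: num_real|move=> C; exact: ltW].
    move=> [s' C] /= [[Us' Bs'] BC] u v x a uxs Su.
    have Ss' : S s' by rewrite -uxs; exact: nbhs_singleton Su.
    by apply: (local_bound eqS Ss' Us') Su => //; exact: le_trans (ltW Bs') BC.
  have nS : \forall s' \near s, ~ S s'.
    have : \forall s' \near s, Phi s' != 0.
      have N : nbhs (Phi s) [set y : R | y != 0].
        by apply: open_nbhs_nbhs; split; [exact: open_neq|exact/eqP].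
      exact: (C1_continuous N).
    by apply: filterS => s' /eqP.
  exists ([set s' | ~ S s'], setT) => /=; first by split=> //; exact: filterT.
  move=> [s' C] /= [nSs' _] u v x a uxs Su; exfalso; apply: nSs'; rewrite -uxs.
  exact: nbhs_singleton Su.
move=> [C0 [_ CP]]; exists (C0 + 1) => u v x a uM.
have Ks : K (u x) by move=> i; rewrite /= in_itv/= -ler_norml; exact: uM.
by apply: (CP (C0 + 1)) => //; rewrite ltrDl.
Qed.

End normal_acceleration.

(** * The limit of the energies as gamma tends to 1 *)

Section geodesic_curvature_limit.
Variables (R : realType) (L : R) (Phi : 'rV[R]_3 -> R).
Variables (nS : 'rV[R]_3 -> 'rV[R]_3) (ell : nat).
Variables (Lbc : (R -> 'rV[R]_3) -> 'rV[R]_ell) (lbc : 'rV[R]_ell).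
Hypothesis L0 : 0 < L.
Hypothesis Phi_C1 : C1_on setT Phi.
Hypothesis Phi_regular : forall s, zero_set Phi s -> grad Phi s != 0.
Hypothesis nS_continuous : continuous nS.
Hypothesis nS_le1 : forall s, enorm (nS s) <= 1.
Hypothesis nS_normal : forall s, zero_set Phi s -> nS s = unit_normal Phi s.
Hypothesis Lbc_bounded : bounded_linear L Lbc.
Hypothesis Lbc_boundary : boundary_dependent L Lbc.
Hypothesis seminorm_is_norm :
  norm_on L [set v | H2 L v /\ Lbc v = 0] (fun v => L2norm L (D2 L v)).
Hypothesis S_C2 : C2_surface (zero_set Phi).
Local Notation mu := (@lebesgue_measure R).
Local Notation curve := (R -> 'rV[R]_3).
Local Notation A := (admissible L Phi Lbc lbc).
Implicit Types (u v : curve) (g c M : R).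
Local Opaque D1 D2 l2ip.

Let dot_D1 u x : A u -> x \in `[0, L] -> dot (D1 L u x) (D1 L u x) = 1.
Proof. by move=> [_ uP _] xL; rewrite -enorm_sq; exact: (uP x xL).1. Qed.

Let arclength_dist u x i : A u -> x \in `[0, L] -> `|u x 0 i - u 0 0 i| <= L.
Proof.
move=> Au xL; have [Hu _ _] := Au.
have l1 : l2ip L (D1 L u) (D1 L u) = L.
  Local Transparent l2ip.
  rewrite /l2ip -[RHS]mulr1 -[X in X * _]subr0 -(Rintegral_itv_cst 1 (ltW L0)).
  by apply: eq_Rintegral => y; rewrite inE/= => yL; exact: dot_D1.
  Local Opaque l2ip.
have := curve_holder (H2_primitive1 L0 Hu) (H2_D1_L2 L0 Hu) xL (left_in_itvcc L0).
rewrite l1 subr0 => h.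
have := dot_entry (u x - u 0) i; rewrite !mxE => h2.
move: xL; rewrite in_itv/= => /andP[x0 xL].
rewrite -(@ler_pXn2r _ 2)// ?nnegrE ?(ltW L0)// real_normK ?num_real//.
apply: le_trans h2 _; apply: le_trans h _.
by rewrite expr2 ler_pM2r// ger0_norm.
Qed.

Let range_bound : exists M, forall u x i, A u -> x \in `[0, L] -> `|u x 0 i| <= M.
Proof.
(* [L + 1] bounds both the displacement between the ends, at most the arc length [L], and the unit
   slopes. *)
have N0 : 0 <= L + 1 by rewrite addr_ge0// ltW.
have [C CP] := @initial_point_bound _ _ L0 _ Lbc lbc Lbc_bounded Lbc_boundary
  seminorm_is_norm (L + 1) N0.
exists (C + L) => u x i Au xL.
have e1 y j : y \in `[0, L] -> `|D1 L u y 0 j| <= L + 1.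
  move=> yL; apply: (@le_trans _ _ 1); last by rewrite lerDr ltW.
  rewrite -(@ler_pXn2r _ 2)// ?nnegrE// real_normK ?num_real// expr1n -(dot_D1 Au yL).
  exact: dot_entry.
have [Hu _ Lu] := Au.
have u0 : `|u 0 0 i| <= C.
  apply: CP => // j; split; [|exact/e1/left_in_itvcc|exact/e1/right_in_itvcc].
  by apply: le_trans (arclength_dist j Au (right_in_itvcc L0)) _; rewrite lerDl.
have := arclength_dist i Au xL; have := ler_normD (u 0 0 i) (u x 0 i - u 0 0 i).
by rewrite addrC subrK; move: u0; lra.
Qed.

Let ae_normal_bound : exists C, forall u, A u ->
  {ae mu, forall x, x \in `[0, L] -> dot (D2 L u x) (nS (u x)) ^+ 2 <= C}.
Proof.
have [M MP] := range_bound.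
have [C CP] := normal_acceleration_bound Phi_C1 Phi_regular M S_C2.
exists (C ^+ 2) => u Au; have [Hu uP _] := Au.
(* The inequality becomes an equality with [Num.min] because [ae_eq_itvoo_cc], which adds the end
   points, compares two functions. *)
suff : {ae mu, forall x, x \in `[0, L] ->
    Num.min (dot (D2 L u x) (nS (u x)) ^+ 2) (C ^+ 2) = dot (D2 L u x) (nS (u x)) ^+ 2}.
  apply: filterS; first exact: (ae_filter_ringOfSetsType mu).
  by move=> x h xL; apply/min_idPl; exact: h.
apply: ae_eq_itvoo_cc.
have d2 i := primitive_derive_ae (H2_primitive2 L0 Hu i).
have d2all := @filter_forall _ _ _ _ (ae_filter_ringOfSetsType mu) d2.
apply: (@filterS _ _ (ae_filter_ringOfSetsType mu) _ _ _ d2all) => x d2x xL.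
have near_in : \forall y \near x, y \in `]0, L[ by exact: near_in_itvoo.
have sub y : y \in `]0, L[ -> y \in `[0, L] by exact: subset_itv_oo_cc.
have Sx : zero_set Phi (u x) by exact: (uP x (sub x xL)).2.
apply/min_idPl; rewrite nS_normal// -(real_normK (num_real (dot _ _))).
have h : `|dot (D2 L u x) (unit_normal Phi (u x))| <= C.
  apply: (CP u (D1 L u)).
  - by move=> i; apply: MP => //; exact: sub.
  - by apply: filterS near_in => y yL; exact: (uP y (sub y yL)).2.
  - apply: filterS near_in => y yL i.
    have c1 := primitive_continuous (ltW L0) (H2_primitive2 L0 Hu i).
    exact: (primitive_derive (H2_primitive1 L0 Hu i) c1 yL).
  - by move=> i; exact: d2x.
  - exact: dot_D1 (sub x xL).
by rewrite ler_pXn2r ?nnegrE// (le_trans _ h).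
Qed.

(** The integrand of [quad] falls short of [|u''|^2] by [g (u'' . n)^2], which is bounded almost
    everywhere uniformly in [u] and [g]. *)
Let D2_bound : exists C, forall u g, A u -> 0 <= g <= 1 ->
  l2ip L (D2 L u) (D2 L u) <= quad L g (D2 L u) (nS \o u) + C.
Proof.
have [C CP] := ae_normal_bound.
exists (L * `|C|) => u g Au g01; have [Hu _ _] := Au.
have s := H2_D2 Hu; have i1 := integrable_dot s s.
have m2 := measurable_normal nS_continuous _ Hu.
have n1 (x : R) : dot ((nS \o u) x) ((nS \o u) x) <= 1 by exact: dot_normal_le1.
have iq : mu.-integrable `[0, L] (EFin \o (fun x =>
    dot (D2 L u x) (D2 L u x) - g * dot (D2 L u x) ((nS \o u) x) ^+ 2)).
  exact: integrable_quad.
have md : measurable_fun `[0, L] (fun x => dot (D2 L u x) ((nS \o u) x)).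
  by apply: measurable_dot => // i; case: (s i).
have md2 : measurable_fun `[0, L] (fun x => dot (D2 L u x) ((nS \o u) x) ^+ 2).
  exact: measurable_funX.
(* Truncation at [|C|] changes the integrand on a null set only and makes the bound hold at every
   point, so that the integrals can be compared pointwise. *)
have mC : measurable_fun `[0, L] (fun x : R => Num.min (dot (D2 L u x) ((nS \o u) x) ^+ 2) `|C|).
  by apply: measurable_minr => //; exact: measurable_cst.
have ms : measurable_fun `[0, L] (fun x => dot (D2 L u x) (D2 L u x)).
  by apply: measurable_dot => i; case: (s i).
have ae : {ae mu, forall x, x \in `[0, L] ->
    dot (D2 L u x) (D2 L u x) - g * dot (D2 L u x) ((nS \o u) x) ^+ 2 =
    dot (D2 L u x) (D2 L u x) - g * Num.min (dot (D2 L u x) ((nS \o u) x) ^+ 2) `|C|}.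
  apply: filterS (CP u Au); first exact: (ae_filter_ringOfSetsType mu).
  by move=> x h xL; rewrite min_l// (le_trans (h xL)) ?ler_norm.
have mq1 : measurable_fun `[0, L] (fun x =>
    dot (D2 L u x) (D2 L u x) - g * dot (D2 L u x) ((nS \o u) x) ^+ 2).
  by apply: measurable_funB => //; apply: measurable_funM => //; exact: measurable_cst.
have mq2 : measurable_fun `[0, L] (fun x =>
    dot (D2 L u x) (D2 L u x) - g * Num.min (dot (D2 L u x) ((nS \o u) x) ^+ 2) `|C|).
  by apply: measurable_funB => //; apply: measurable_funM => //; exact: measurable_cst.
have i2 := ae_eq_integrable ae mq2 iq.
have ic := sq_integrable_integrable (sq_integrable_cst 0 L (- `|C|)).
rewrite -lerBlDr /quad (ae_eq_Rintegral ae mq1 mq2).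
have -> : l2ip L (D2 L u) (D2 L u) - L * `|C| =
    \int[mu]_(x in `[0, L]) (1 * dot (D2 L u x) (D2 L u x) + - `|C|).
  by rewrite (Rintegral_lincomb 1 i1 ic) mul1r Rintegral_itv_cst ?ltW// subr0 mulrN.
apply: le_Rintegral => //; first exact: integrable_lincomb.
move=> x _; rewrite mul1r lerD2l lerN2.
have /andP[g0 g1] := g01; apply: (@le_trans _ _ (1 * `|C|)); last by rewrite mul1r.
by apply: ler_pM => //; [rewrite le_min sqr_ge0/=|rewrite ge_min lexx orbT].
Qed.

Lemma geodesic_gamma_approximation (gamma_ : nat -> R) : (forall k, 0 <= gamma_ k < 1) ->
  gamma_ @ \oo --> (1 : R) ->
  Gamma_approximation L (fun=> A) (fun k => bending_energy L nS A (gamma_ k))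
    A (bending_energy L nS A 1).
Proof.
move=> gamma01 gamma1.
have g01 k : 0 <= gamma_ k <= 1 by have /andP[-> /ltW] := gamma01 k.
have l01 : 0 <= (1 : R) <= 1 by rewrite ler01 lexx.
have [C CP] := D2_bound.
have AH2 u : A u -> H2 L u by case.
have Ae u : A u -> enorm (D1 L u 0) = 1 /\ enorm (D1 L u L) = 1.
  move=> Au; rewrite /enorm (dot_D1 Au (left_in_itvcc L0)) (dot_D1 Au (right_in_itvcc L0)) sqrtr1.
  by split.
have d2 k u c : A u -> (bending_energy L nS A (gamma_ k) u <= c%:E)%E ->
    l2ip L (D2 L u) (D2 L u) <= 2 * c + C.
  move=> Au uc; apply: le_trans (CP u (gamma_ k) Au (g01 k)) _; rewrite lerD2r.
  exact: (bending_energy_le nS_continuous nS_le1 (AH2 u Au) (g01 k) uc).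
apply: gamma_approximation_of_sublevels.
- by move=> _; exact: AH2.
- by move=> u nu; rewrite /bending_energy memNset.
- by move=> u_ u Hu_ Hu; exact: strong_weak_cvg.
- move=> phi u_ u c hphi Hu_ Hu uc uu.
  have Au_ k := bending_energy_dom (uc k).
  have Au : A u.
    apply: (@limit_admissible _ _ L0 _ _ _ _ (C1_continuous Phi_C1) Lbc_bounded u_ u (2 * c + C)) => //.
    + by move=> k; have [] := Au_ k.
    + by move=> k; rewrite (dot_D1 (Au_ k) (left_in_itvcc L0)).
    + by move=> k; exact: d2 (uc k).
    + move=> x xL; exists (fun=> x); split => //; first exact: cvg_cst.
      move=> k; split; first by rewrite /enorm (dot_D1 (Au_ k) xL) sqrtr1.
      by have [_ uP _] := Au_ k; exact: (uP x xL).2.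
  apply: bending_energy_le_quad => //.
  apply: (@quad_lsc _ _ L0 nS nS_continuous nS_le1 u_ u (gamma_ \o phi) 1 (2 * c + C)) => //.
  + by move=> k; exact: g01.
  + exact: (cvgn_subseq hphi gamma1).
  + by move=> k; exact: d2 (uc k).
  + by move=> k; exact: bending_energy_le (uc k).
- move=> u_ c uc; have [M' M'P] := @unit_endpoints_coercive _ _ _ Lbc lbc L0 Lbc_bounded
    Lbc_boundary seminorm_is_norm (2 * c + C).
  have Hu_ k : H2 L (u_ k) := AH2 _ (uc k).1.
  apply: (@H2_weak_compactness _ _ L0 u_ M') => // k.
  have [e0 eL] := Ae _ (uc k).1.
  apply: M'P => //; first by have [[]] := uc k.
  exact: (d2 k _ _ (uc k).1 (uc k).2).
(* The admissible set does not depend on the parameter, so the constant sequence recovers [u], its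
   energies converging as [gamma_] tends to 1. *)
- move=> u Au; have Hu := AH2 u Au.
  have strong : strong_cvg L (fun=> u) u.
    rewrite /strong_cvg (_ : (fun k => _) = fun=> 0); first exact: cvg_cst.
    apply/funext => _; apply/eqP; rewrite eq_le H2norm_ge0 andbT.
    apply: le_trans (H2norm_le L0 (H2B L0 Hu Hu)) _.
    rewrite (interpolation_error L0 Hu Hu)// (_ : l2ip _ _ _ = 0) ?sqrtr0 ?mulr0//.
    Local Transparent l2ip.
    rewrite /l2ip (_ : (fun x => _) = fun=> 0); first by rewrite Rintegral_cst// mul0r.
    apply/funext => x; rewrite /dot big1// => i _.
    by rewrite (etrans (curve_subE (D2 L u) (D2 L u) x i) (subrr _)) mul0r.
    Local Opaque l2ip.
  exists (fun=> u); split=> //.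
  rewrite (_ : (fun k => _) = fun k => (2^-1 * quad L (gamma_ k) (D2 L u) (nS \o u))%:E); last first.
    by apply/funext => k; exact: bending_energyE.
  rewrite bending_energyE//; apply: cvg_EFin; first exact: nearW.
  apply: cvgM; first exact: cvg_cst.
  apply: (@quad_cvg _ _ L0 nS nS_continuous nS_le1 (fun=> u) u gamma_ 1 (l2ip L (D2 L u) (D2 L u))) => //.
  by move=> F bF; exact: cvg_cst.
Qed.

End geodesic_curvature_limit.

Theorem corollary2p6 (R : realType) (L : R) (Phi : 'rV[R]_3 -> R)
  (nS : 'rV[R]_3 -> 'rV[R]_3) (ell : nat)
  (Lbc : (R -> 'rV[R]_3) -> 'rV[R]_ell) (lbc : 'rV[R]_ell)
  (L_gt0 : 0 < L)
  (Phi_C1 : C1_on setT Phi)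
  (Phi_regular : forall s, zero_set Phi s -> grad Phi s != 0)
  (nS_continuous : continuous nS)
  (nS_le1 : forall s, enorm (nS s) <= 1)
  (nS_normal : forall s, zero_set Phi s -> nS s = unit_normal Phi s)
  (Lbc_bounded : bounded_linear L Lbc)
  (Lbc_boundary : boundary_dependent L Lbc)
  (A_nonempty : admissible L Phi Lbc lbc !=set0)
  (seminorm_is_norm :
     norm_on L [set v | H2 L v /\ Lbc v = 0] (fun v => L2norm L (D2 L v)))
  (H3_dense :
     strongly_dense L (admissible L Phi Lbc lbc `&` H3 L)
       (admissible L Phi Lbc lbc)) :
  let A := admissible L Phi Lbc lbc in
  (* (a) *)
  (forall gamma : R, 0 < gamma < 1 ->
   forall (J : nat -> nat) (z : nat -> nat -> R),
     (forall k, mesh_partition L (J k) (z k)) ->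
     mesh_size (J k) (z k) @[k --> \oo] --> (0 : R) ->
     let A_ k := admissible_h L Phi Lbc lbc (J k) (z k) in
     Gamma_approximation L A_ (fun k => bending_energy L nS (A_ k) gamma)
       A (bending_energy L nS A gamma)) /\
  (* (b) *)
  (forall cS : R, C2_surface (zero_set Phi) ->
     (forall s kappa, principal_curvature (zero_set Phi) s kappa ->
        `|kappa| <= cS) ->
   forall gamma_ : nat -> R, (forall k, 0 <= gamma_ k < 1) ->
     gamma_ @ \oo --> (1 : R) ->
     Gamma_approximation L (fun=> A)
       (fun k => bending_energy L nS A (gamma_ k))
       A (bending_energy L nS A 1)).
Proof.
split=> [gamma gamma01 J z part mesh0|cS S_C2 _ gamma_ gamma01 gamma1].
  exact: (spline_gamma_approximation L_gt0 (C1_continuous Phi_C1) nS_continuous nS_le1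
    Lbc_bounded Lbc_boundary seminorm_is_norm gamma01 H3_dense part mesh0).
exact: (geodesic_gamma_approximation lbc L_gt0 Phi_C1 Phi_regular nS_continuous nS_le1 nS_normal
  Lbc_bounded Lbc_boundary seminorm_is_norm S_C2 gamma01 gamma1).
Qed.
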